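(* Consider the linear regression model, kernel matrix $P=P(\eta)$, cost functions and notation described in the context. Assume the noise is Gaussian, $V\sim\mathcal N(0,\sigma^2I_N)$, and: (A1) the minimizers $\hat\eta_{\mathrm{EB}},\hat\eta_{\mathrm{Sy}},\hat\eta_{\mathrm{EEB}},\hat\eta_{\mathrm{MSEy}}$ (defined in the context) are interior points of $\Omega$; (A2) $P$ is positive definite and $\Phi^T\Phi/N\to\Sigma$ almost surely as $N\to\infty$, with $\Sigma\in\mathbb{R}^{n\times n}$ positive definite; (A3) the sets of minimizers $\eta_b^*$ of $W_b$ and $\eta_y^*$ of $W_y$ over $\Omega$ each consist of isolated points; (A4) $\|\Phi^T\Phi/N-\Sigma\|_F=O_p(\delta_N)$, where $\delta_N\to0$ as $N\to\infty$; (A5) $\Omega$ is an open subset of $\mathbb{R}^p$ (so that $\eta_b^*$ and $\eta_y^*$ are interior points of $\Omega$). Suppose further that $\delta_N=o(1/\sqrt N)$ as $N\to\infty$ (in particular, if $\delta_N=N^k$, then $k<-1/2$). Then, as $N\to\infty$, $$\sqrt N(\hat\eta_{\mathrm{Sy}}-\eta_y^* )\xrightarrow{d}\mathcal N\left(0,\ C_y(\eta_y^* )^{-1}D_y(\eta_y^* )C_y(\eta_y^* )^{-1}\right),$$ where $C_y(\eta_y^* )$ and $D_y(\eta_y^* )$ are the matrices with $(k,l)$ entries $$C_y(\eta_y^* )_{k,l}=2\sigma^4\left.\left\{\theta_0^T\frac{\partial P^{-1}}{\partial\eta_l}\Sigma^{-1}\frac{\partial P^{-1}}{\partial\eta_k}\theta_0+\theta_0^TP^{-1}\Sigma^{-1}\frac{\partial^2P^{-1}}{\partial\eta_k\partial\eta_l}\theta_0-\operatorname{Tr}\left(\Sigma^{-1}\frac{\partial^2P^{-1}}{\partial\eta_k\partial\eta_l}\right)\right\}\right|_{\eta_y^*},$$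 $$D_y(\eta_y^* )_{k,l}=4\sigma^{10}\left.\left\{\theta_0^T\left[P^{-1}\Sigma^{-1}\frac{\partial P^{-1}}{\partial\eta_k}+\frac{\partial P^{-1}}{\partial\eta_k}\Sigma^{-1}P^{-1}\right]\Sigma^{-1}\left[P^{-1}\Sigma^{-1}\frac{\partial P^{-1}}{\partial\eta_l}+\frac{\partial P^{-1}}{\partial\eta_l}\Sigma^{-1}P^{-1}\right]\theta_0\right\}\right|_{\eta_y^*}.$$
   Context: Model: $Y=\Phi\theta_0+V$, with $Y\in\mathbb{R}^N$, $\Phi\in\mathbb{R}^{N\times n}$ of full column rank $n$, $N>n$, true parameter $\theta_0\in\mathbb{R}^n$, and $V\in\mathbb{R}^N$ having i.i.d. entries of mean $0$ and variance $\sigma^2>0$. Dependence on $N$ is suppressed in the notation. Kernel matrix: $P=P(\eta)\in\mathbb{R}^{n\times n}$ is a (symmetric) kernel matrix parameterized by a hyper-parameter $\eta\in\Omega\subset\mathbb{R}^p$. Notation: $Q=\Phi P\Phi^T+\sigma^2I_N$, $\hat\theta^{\mathrm R}(\eta)=P\Phi^TQ^{-1}Y$; $\|\cdot\|_2$ is the Euclidean norm and $\|\cdot\|_F$ the Frobenius norm; $\xrightarrow{d}$ denotes convergence in distribution. $\xi_N=O_p(a_N)$ means: for every $\epsilon>0$ there is $L>0$ with $\mathbb P(|\xi_N/a_N|>L)<\epsilon$ for all $N$. Cost functions and minimizers over $\eta\in\Omega$: - $\hat\eta_{\mathrm{EB}}$ minimizes $\mathcal F_{\mathrm{EB}}=Y^TQ^{-1}Y+\log\det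 Q$; - $\hat\eta_{\mathrm{Sy}}$ minimizes $\mathcal F_{\mathrm{Sy}}=\|Y-\Phi\hat\theta^{\mathrm R}(\eta)\|_2^2+2\sigma^2\operatorname{Tr}(\Phi P\Phi^TQ^{-1})$; - $\hat\eta_{\mathrm{EEB}}$ minimizes $\theta_0^T\Phi^TQ^{-1}\Phi\theta_0+\sigma^2\operatorname{Tr}(Q^{-1})+\log\det Q$; - $\hat\eta_{\mathrm{MSEy}}$ minimizes $\sigma^4\theta_0^T\Phi^TQ^{-2}\Phi\theta_0+\sigma^6\operatorname{Tr}(Q^{-2})-2\sigma^4\operatorname{Tr}(Q^{-1})+2N\sigma^2$. Limit functions: $W_b(\eta)=\theta_0^TP^{-1}\theta_0+\log\det P$ and $W_y(\eta)=\sigma^4\theta_0^TP^{-T}\Sigma^{-1}P^{-1}\theta_0-2\sigma^4\operatorname{Tr}(\Sigma^{-1}P^{-1})$; $\eta_b^*=\arg\min_{\eta\in\Omega}W_b$ and $\eta_y^*=\arg\min_{\eta\in\Omega}W_y$.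
   Formalization: Adds that, with probability tending to 1, the Sy minimizer lies in a compact subset of Ω where η_y* is the only minimizer of W_y (otherwise false); also makes explicit that Φ and V are independent, P is C² on Ω, C_y(η_y* ) is invertible, the Sy minimizer is measurable and δ_N>0. *)

(* Defs.v *)
From HB Require Import structures.
From mathcomp Require Import all_boot all_order all_algebra.
From mathcomp Require Import all_classical all_reals all_analysis.

Set Implicit Arguments.
Unset Strict Implicit.
Unset Printing Implicit Defensive.

Import Order.TTheory GRing.Theory Num.Theory.
Import numFieldNormedType.Exports.

Local Open Scope classical_set_scope.
Local Open Scope ring_scope.

Section matrices.
Context {R : realType}.

(* For a column vector this is the Euclidean norm.  The library norm [`|A|] on
   matrices is the maximum norm. *)
Definition frob_norm m n (A : 'M[R]_(m, n)) : R :=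
  Num.sqrt (\sum_i \sum_j A i j ^+ 2).

(* x^T A y as a scalar *)
Definition bform n (x : 'cV[R]_n) (A : 'M[R]_n) (y : 'cV[R]_n) : R :=
  (x^T *m A *m y) 0 0.

Definition posdef n (A : 'M[R]_n) : Prop :=
  A^T = A /\ forall x : 'cV[R]_n, x != 0 -> 0 < bform x A x.

End matrices.

Section optimization_and_calculus.
Context {R : realType} {p : nat}.

Definition argmin_on (D : set 'cV[R]_p) (f : 'cV[R]_p -> R) : set 'cV[R]_p :=
  [set x | D x /\ forall y, D y -> f x <= f y].

Definition partial n (k : 'I_p) (f : 'cV[R]_p -> 'M[R]_n) :
  'cV[R]_p -> 'M[R]_n := 'D_(delta_mx k 0) f.

(* Existence and continuity of all second partial derivatives at the points of
   an open set; the first partial derivatives are then continuous as well. *)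
Definition C2_on n (D : set 'cV[R]_p) (f : 'cV[R]_p -> 'M[R]_n) : Prop :=
  forall x, D x -> forall k l : 'I_p,
    [/\ derivable f x (delta_mx l 0),
        derivable (partial l f) x (delta_mx k 0) &
        {for x, continuous (partial k (partial l f))}].

End optimization_and_calculus.

Section probability.
Context {R : realType}.

Definition borel m n := g_sigma_algebraType (@open 'M[R]_(m, n)).

Section on_a_space.
Context {d : measure_display} {T : measurableType d} (Pr : probability T R).

Definition random_matrix m n (X : T -> 'M[R]_(m, n)) : Prop :=
  forall i j, measurable_fun [set: T] (fun w => X w i j).

(* The family X, V_1, ..., V_N (X as a whole and the N entries of V) is
   mutually independent.  Taking some of the sets to be full gives the product
   rule for every subfamily. *)
Definition mutually_independent m n N
    (X : T -> 'M[R]_(m, n)) (V : T -> 'cV[R]_N) : Prop :=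
  forall (A : set (borel m n)) (B : 'I_N -> set R),
    measurable A -> (forall i, measurable (B i)) ->
    Pr (X @^-1` A `&` [set w | forall i, B i (V w i 0)]) =
    (Pr (X @^-1` A) * \prod_(i < N) Pr [set w | B i (V w i 0%R)])%E.

(* X = O_p(a): the bound is required for all indices, not only eventually. *)
Definition bigO_p (X : nat -> T -> R) (a : nat -> R) : Prop :=
  forall eps : R, 0 < eps -> exists2 L : R, 0 < L &
    forall N, (Pr [set w | (L < `|X N w / a N|)%R] < eps%:E)%E.

(* Weak convergence of the laws of X_N to mu. *)
Definition cvg_in_distribution p (X : nat -> T -> 'cV[R]_p)
    (mu : probability (borel p 1) R) : Prop :=
  forall f : 'cV[R]_p -> R, continuous f ->
    (exists c, forall x, `|f x| <= c) ->
    ('E_Pr[f \o X N])%E @[N --> \oo] --> (\int[mu]_x (f x)%:E)%E.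

End on_a_space.

(* Univariate N(m, v) parameterized by the variance, with N(m, 0) the point
   mass at m ([normal_prob] takes the standard deviation and is not a point
   mass when that is 0). *)
Definition normal_law (m v : R) (B : set R) : \bar R :=
  if v == 0 then \d_m B else normal_prob m (Num.sqrt v) B.

(* mu = N(m, S), possibly degenerate: a^T x ~ N(a^T m, a^T S a) for every a. *)
Definition multivariate_normal p (m : 'cV[R]_p) (S : 'M[R]_p)
    (mu : probability (borel p 1) R) : Prop :=
  forall (a : 'cV[R]_p) (B : set R), measurable B ->
    mu [set x : 'cV[R]_p | B ((a^T *m x) 0 0)] =
    normal_law ((a^T *m m) 0 0) (bform a S a) B.

End probability.

Section cost_functions.
Context {R : realType} {N n : nat}.
Variables (sigma : R) (Phi : 'M[R]_(N, n)).

Definition Qmx (P : 'M[R]_n) : 'M[R]_N := Phi *m P *m Phi^T + (sigma ^+ 2)%:M.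

Definition theta_reg (Y : 'cV[R]_N) (P : 'M[R]_n) : 'cV[R]_n :=
  P *m Phi^T *m invmx (Qmx P) *m Y.

Definition cost_EB (Y : 'cV[R]_N) (P : 'M[R]_n) : R :=
  bform Y (invmx (Qmx P)) Y + ln (\det (Qmx P)).

Definition cost_Sy (Y : 'cV[R]_N) (P : 'M[R]_n) : R :=
  frob_norm (Y - Phi *m theta_reg Y P) ^+ 2
  + 2 * sigma ^+ 2 * \tr (Phi *m P *m Phi^T *m invmx (Qmx P)).

Definition cost_EEB (theta0 : 'cV[R]_n) (P : 'M[R]_n) : R :=
  bform theta0 (Phi^T *m invmx (Qmx P) *m Phi) theta0
  + sigma ^+ 2 * \tr (invmx (Qmx P)) + ln (\det (Qmx P)).

Definition cost_MSEy (theta0 : 'cV[R]_n) (P : 'M[R]_n) : R :=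
  let Q2 := invmx (Qmx P) *m invmx (Qmx P) in
  sigma ^+ 4 * bform theta0 (Phi^T *m Q2 *m Phi) theta0
  + sigma ^+ 6 * \tr Q2 - 2 * sigma ^+ 4 * \tr (invmx (Qmx P))
  + 2 * N%:R * sigma ^+ 2.

End cost_functions.

Section limits.
Context {R : realType} {n p : nat}.
Variables (theta0 : 'cV[R]_n) (sigma : R) (Sigma : 'M[R]_n).
Variable P : 'cV[R]_p -> 'M[R]_n.

Definition W_b (eta : 'cV[R]_p) : R :=
  bform theta0 (invmx (P eta)) theta0 + ln (\det (P eta)).

Definition W_y (eta : 'cV[R]_p) : R :=
  sigma ^+ 4 *
    bform theta0 ((invmx (P eta))^T *m invmx Sigma *m invmx (P eta)) theta0
  - 2 * sigma ^+ 4 * \tr (invmx Sigma *m invmx (P eta)).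

Local Notation Pinv := (fun eta => invmx (P eta)).

Definition C_y (eta : 'cV[R]_p) : 'M[R]_p := \matrix_(k, l)
  (2 * sigma ^+ 4 *
   (bform theta0
      (partial l Pinv eta *m invmx Sigma *m partial k Pinv eta) theta0
    + bform theta0
      (Pinv eta *m invmx Sigma *m partial k (partial l Pinv) eta) theta0
    - \tr (invmx Sigma *m partial k (partial l Pinv) eta))).

Definition D_y (eta : 'cV[R]_p) : 'M[R]_p :=
  let B k := Pinv eta *m invmx Sigma *m partial k Pinv eta
             + partial k Pinv eta *m invmx Sigma *m Pinv eta in
  \matrix_(k, l)
    (4 * sigma ^+ 10 * bform theta0 (B k *m invmx Sigma *m B l) theta0).

End limits.

(* Main.v *)
(* By the matrix inversion lemma, N (F_Sy - c) = G(B, D, t, P(eta)), where c does not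
   depend on eta, t is the least squares estimate, B = (Phi^T Phi / N)^-1,
   D = sigma^2 B / N, and W_y = G(Sigma^-1, 0, theta0, P(eta)).  Compactness makes the
   minimizer of G consistent as (B, D, t) -> (Sigma^-1, 0, theta0), and expanding the
   gradient of G around eta_y gives
     sqrt N (eta_Sy - eta_y) = - C_y^-1 L sqrt N (t - theta0) + o(1),
   because B - Sigma^-1 = o(1 / sqrt N) drops out at this order.  Moreover
   sqrt N (t - theta0) = chol(B) xi with xi = U(Phi) V for a matrix U(Phi) with
   orthonormal rows; as Phi and V are independent and the Gaussian law is invariant
   under rotations, xi is N(0, sigma^2 I_n) for every N.  Hence eta_Sy is coupled, up to
   o(1), with a fixed linear image of a variable of fixed Gaussian law, and no limit
   theorem is needed beyond this coupling. *)
Require Import Defs.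
From HB Require Import structures.
From mathcomp Require Import all_boot all_order all_algebra.
From mathcomp Require Import all_classical all_reals all_analysis.
From mathcomp Require Import measurable_realfun ring lra.

Set Implicit Arguments.
Unset Strict Implicit.
Unset Printing Implicit Defensive.

Import Order.TTheory GRing.Theory Num.Theory.
Import numFieldNormedType.Exports.

Local Open Scope classical_set_scope.
Local Open Scope ring_scope.

(** * Positive definite matrices and the Sy cost *)

(** Two obstacles shape the proof. No rate for [eta_Sy] is known beforehand: consistency only says
    that its distance to [eta_y] tends to 0. Hence every expansion is scaled by
    [|eta - eta_y| + 1 / sqrt N], for which the rescaled distance and the rescaled noise are both
    bounded; invertibility of [C_y] then forces the distance to be of order [1 / sqrt N]. Further,
    the rate of [Phi^T Phi / N] and the localization of the estimates hold only in probability,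
    while the expansion is analytic. It is therefore proved for deterministic data, uniformly over
    all data close to the limit, and applied off an event of small probability.

    The Gaussian law on R^N is handled as an iterated one-dimensional integral. Givens rotations mix
    two directions at a time, so its invariance reduces to plane rotations. The factor [4 sigma^10]
    in [D_y] arises as [(2 sigma^4)^2 sigma^2]: the derivative [L] of the gradient enters twice, the
    noise variance once. *)

Section positive_definite.
Context {R : realType}.

Lemma posdef_tr n (A : 'M[R]_n) : posdef A -> A^T = A.
Proof. by case. Qed.

Lemma posdef_unit n (A : 'M[R]_n) : posdef A -> A \in unitmx.
Proof.
move=> [_ A0]; rewrite -row_free_unit -kermx_eq0.
apply/negPn/negP => /rowV0Pn[v /sub_kermxP vA v0].
have := A0 v^T; rewrite trmx_eq0 v0 /bform trmxK vA mul0mx mxE ltxx.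
by move/(_ isT).
Qed.

Lemma trmx_invmx n (A : 'M[R]_n) : A^T = A -> (invmx A)^T = invmx A.
Proof. by move=> AT; rewrite trmx_inv AT. Qed.

Lemma posdef_invmx n (A : 'M[R]_n) : posdef A -> posdef (invmx A).
Proof.
move=> pA; have uA := posdef_unit pA; have [AT A0] := pA.
split=> [|x x0]; first exact: trmx_invmx.
have := A0 (invmx A *m x); rewrite /bform trmx_mul trmx_invmx//.
rewrite -!mulmxA (mulmxA A) mulmxV// mul1mx; apply.
by apply: contra x0 => /eqP x0; rewrite -(mulKVmx uA x) x0 mulmx0.
Qed.

Lemma posdefD n (A B : 'M[R]_n) : posdef A -> posdef B -> posdef (A + B).
Proof.
move=> [AT A0] [BT B0]; split=> [|x x0]; first by rewrite linearD /= AT BT.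
by rewrite /bform mulmxDr mulmxDl mxE addr_gt0 ?A0 ?B0.
Qed.

Lemma posdefZ n c (A : 'M[R]_n) : 0 < c -> posdef A -> posdef (c *: A).
Proof.
move=> c0 [AT A0]; split=> [|x x0]; first by rewrite linearZ /= AT.
by rewrite /bform -scalemxAr -scalemxAl mxE mulr_gt0 ?A0.
Qed.

Lemma dotmxE n (v : 'cV[R]_n) : (v^T *m v) 0 0 = \sum_i v i 0 ^+ 2.
Proof. by rewrite mxE; apply: eq_bigr => i _; rewrite mxE expr2. Qed.

Lemma sqr_frob_norm_col n (v : 'cV[R]_n) : frob_norm v ^+ 2 = (v^T *m v) 0 0.
Proof.
rewrite /frob_norm sqr_sqrtr; last first.
  by apply: sumr_ge0 => i _; apply: sumr_ge0 => j _; exact: sqr_ge0.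
by rewrite dotmxE; apply: eq_bigr => i _; rewrite big_ord1.
Qed.

Lemma dotmx_gt0 n (v : 'cV[R]_n) : v != 0 -> 0 < (v^T *m v) 0 0.
Proof.
move=> v0; rewrite lt_neqAle dotmxE sumr_ge0 ?andbT; last first.
  by move=> i _; exact: sqr_ge0.
rewrite eq_sym; apply: contra v0; rewrite psumr_eq0; last first.
  by move=> i _; exact: sqr_ge0.
move=> /allP v0; apply/eqP/matrixP => i j; rewrite ord1 mxE.
by have := v0 i (mem_index_enum i); rewrite implyTb sqrf_eq0 => /eqP.
Qed.

Lemma posdef_gram N n (A : 'M[R]_(N, n)) : \rank A = n -> posdef (A^T *m A).
Proof.
move=> rA; split=> [|x x0]; first by rewrite trmx_mul trmxK.
rewrite /bform mulmxA -mulmxA -trmx_mul; apply: dotmx_gt0.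
apply: contra x0 => /eqP Ax0; rewrite -trmx_eq0.
have fA : row_free A^T by rewrite /row_free mxrank_tr rA.
by apply/eqP/(row_free_inj fA); rewrite mul0mx -trmx_mul Ax0 trmx0.
Qed.

Lemma bform_tr n (x : 'cV[R]_n) A y : bform x A y = bform y A^T x.
Proof.
rewrite /bform -[in LHS](trmxK (x^T *m A *m y)) mxE.
by rewrite !trmx_mul !trmxK mulmxA.
Qed.

End positive_definite.

Section cost.
Context {R : realType} {n : nat}.

(* With t the least squares estimate, B = (Phi^T Phi / N)^-1 and D = (sigma^2 / N) B
   this is N times the Sy cost up to a term free of P; W_y is its value at
   t = theta0, B = Sigma^-1, D = 0. *)
Definition Gcost (sigma : R) (B D : 'M[R]_n) (t : 'cV[R]_n) (P : 'M[R]_n) : R :=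
  let M := invmx (P + D) in
  sigma ^+ 4 * bform t (M *m B *m M) t - 2 * sigma ^+ 4 * \tr (B *m M).

Lemma W_yE p theta0 sigma Sigma (P : 'cV[R]_p -> 'M[R]_n) eta :
  posdef (P eta) ->
  W_y theta0 sigma Sigma P eta = Gcost sigma (invmx Sigma) 0 theta0 (P eta).
Proof.
by move=> [PT _]; rewrite /W_y /Gcost addr0 trmx_invmx.
Qed.

Variables (N : nat) (sigma : R) (Phi : 'M[R]_(N, n)).
Hypothesis s0 : 0 < sigma.
Let S := Phi^T *m Phi.
Hypothesis pS : posdef S.
Let uS := posdef_unit pS.
Let ST := posdef_tr pS.
Let D := sigma ^+ 2 *: invmx S.
Let Pi := 1%:M - Phi *m invmx S *m Phi^T.

(** Here [Pi] projects onto the orthogonal complement of the range of [Phi], and the inverse of [Q]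
    is [sigma^-2 Pi] plus a term supported on that range. The two parts annihilate each other, so
    squaring the inverse produces no cross terms, and only the second part involves [P]. *)
Lemma cost_SyE_unnormalized (P : 'M[R]_n) (Y : 'cV[R]_N) : posdef P ->
  cost_Sy sigma Phi Y P =
  bform Y Pi Y + 2 * sigma ^+ 2 * \tr (1%:M - Pi)
  + Gcost sigma (invmx S) D (invmx S *m Phi^T *m Y) P.
Proof.
move=> pP.
have s20 : sigma ^+ 2 != 0 by rewrite expf_neq0// gt_eqF.
have pPD : posdef (P + D).
  by apply: posdefD => //; apply: posdefZ; [rewrite exprn_gt0|exact: posdef_invmx].
have uPD := posdef_unit pPD.
set M := invmx (P + D).
have MT : M^T = M by apply: trmx_invmx; exact: posdef_tr pPD.
have SiT : (invmx S)^T = invmx S by exact: trmx_invmx.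
have PiT : Pi^T = Pi.
  by rewrite /Pi linearB /= trmx1 !trmx_mul trmxK SiT mulmxA.
have PhiPi : Phi^T *m Pi = 0.
  by rewrite /Pi mulmxBr mulmx1 !mulmxA -/S mulmxV// mul1mx subrr.
have PiPhi : Pi *m Phi = 0.
  by rewrite -[LHS]trmxK trmx_mul PiT PhiPi trmx0.
have PiPi : Pi *m Pi = Pi.
  by rewrite {1}/Pi mulmxBl mul1mx -!mulmxA PhiPi !mulmx0 subr0.
set X := sigma ^- 2 *: Pi
         + Phi *m (invmx S *m M *m invmx S) *m Phi^T.
have XT : X^T = X.
  rewrite /X linearD /= linearZ /= PiT; congr (_ + _).
  by rewrite !trmx_mul trmxK SiT MT !mulmxA.
have QX : Qmx sigma Phi P *m X = 1%:M.
  have E1 : Phi *m P *m Phi^T *m X = Phi *m (P *m M *m invmx S) *m Phi^T.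
    rewrite /X mulmxDr -scalemxAr -(mulmxA _ _ Pi) PhiPi mulmx0 scaler0 add0r.
    by rewrite -!mulmxA (mulmxA Phi^T Phi) -/S (mulmxA S) mulmxV// mul1mx.
  have E2 : (sigma ^+ 2)%:M *m X = Pi + Phi *m (D *m M *m invmx S) *m Phi^T.
    rewrite mul_scalar_mx /X scalerDr scalerA mulfV// scale1r /D.
    by rewrite -!scalemxAl -!scalemxAr -!scalemxAl.
  (* The terms in [P] and [D] recombine into [P + D], which cancels [M]; what is left is
     [Pi + Phi S^-1 Phi^T], the identity. *)
  rewrite /Qmx mulmxDl E1 E2 addrCA -mulmxDl -mulmxDr -!mulmxDl mulmxV//.
  by rewrite mul1mx /Pi subrK.
have uQ : Qmx sigma Phi P \in unitmx by case/mulmx1_unit: QX.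
have QiE : invmx (Qmx sigma Phi P) = X.
  by rewrite -[RHS](mulKmx uQ) QX mulmx1.
have PQ : Phi *m P *m Phi^T *m X = 1%:M - sigma ^+ 2 *: X.
  by rewrite -QX /Qmx mulmxDl mul_scalar_mx addrK.
have XX : X *m X = sigma ^- 4 *: Pi
    + Phi *m (invmx S *m (M *m invmx S *m M) *m invmx S) *m Phi^T.
  have PK K : Pi *m (Phi *m K *m Phi^T) = 0 by rewrite !mulmxA PiPhi !mul0mx.
  have KP K : Phi *m K *m Phi^T *m Pi = 0 by rewrite -mulmxA PhiPi mulmx0.
  rewrite /X mulmxDr !mulmxDl -scalemxAl -scalemxAr -scalemxAl -scalemxAr PiPi.
  rewrite PK KP !scaler0 addr0 add0r scalerA -exprVn -exprD exprVn; congr (_ + _).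
  by rewrite -!mulmxA (mulmxA Phi^T Phi) -/S (mulmxA S) mulmxV// mul1mx.
(* By [PQ] the residual [Y - Phi theta_reg] is [sigma^2 X Y], and the trace penalty is also
   expressed through [X]. *)
have -> : cost_Sy sigma Phi Y P =
    sigma ^+ 4 * bform Y (X *m X) Y + 2 * sigma ^+ 2 * \tr (1%:M - sigma ^+ 2 *: X).
  rewrite /cost_Sy QiE PQ /theta_reg QiE !mulmxA PQ mulmxBl mul1mx opprB.
  rewrite addrCA subrr addr0 sqr_frob_norm_col -scalemxAl.
  rewrite [X in X *m _]linearZ /= -scalemxAl -scalemxAr scalerA trmx_mul XT mxE /bform -exprD.
  by rewrite !mulmxA.
rewrite XX /Gcost -/M.
have -> : bform Y (sigma ^- 4 *: Pi
    + Phi *m (invmx S *m (M *m invmx S *m M) *m invmx S) *m Phi^T) Y =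
    sigma ^- 4 * bform Y Pi Y +
    bform (invmx S *m Phi^T *m Y) (M *m invmx S *m M) (invmx S *m Phi^T *m Y).
  rewrite /bform mulmxDr mulmxDl -scalemxAr -scalemxAl mxE [X in X + _ = _]mxE.
  by congr (_ + _); rewrite !trmx_mul trmxK SiT !mulmxA.
have -> : 1%:M - sigma ^+ 2 *: X =
  (1%:M - Pi) - sigma ^+ 2 *: (Phi *m (invmx S *m M *m invmx S) *m Phi^T).
  by rewrite /X scalerDr scalerA mulfV// scale1r opprD addrA.
have trE : \tr (Phi *m (invmx S *m M *m invmx S) *m Phi^T) = \tr (invmx S *m M).
  by rewrite mxtrace_mulC mulmxA -/S !mulmxA mulmxV// mul1mx mxtrace_mulC.
rewrite linearB /= [X in _ - X]linearZ /= trE /D.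
have s40 : sigma != 0 by rewrite gt_eqF.
set a := bform Y Pi Y; set b := bform _ _ _; set c := \tr (1%:M - Pi).
by set e := \tr (_ *m M); rewrite /=; field.
Qed.
End cost.

(** * Entrywise limits and the Cholesky factor *)

Section entrywise_limits.
Context {R : realType} {I : Type} (F : set_system I) {FF : Filter F}.

(** Entrywise, so that each matrix operation reduces to limits of finite sums and products of
    scalars; [cvg_mxP] translates to and from the matrix norm. The filter is arbitrary because
    sequences of samples, punctured neighbourhoods and product filters all occur. *)
Definition cvgm m n (q : I -> 'M[R]_(m, n)) (q0 : 'M[R]_(m, n)) : Prop :=
  forall i j, q x i j @[x --> F] --> q0 i j.

Lemma cvg_sumr (J : Type) (r : seq J) (Q : pred J) (f : J -> I -> R) (f0 : J -> R) :
  (forall j, Q j -> f j x @[x --> F] --> f0 j) ->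
  \sum_(j <- r | Q j) f j x @[x --> F] --> \sum_(j <- r | Q j) f0 j.
Proof. by move=> ff0; apply: cvg_big => //; exact: add_continuous. Qed.

Lemma cvg_prodr (J : Type) (r : seq J) (Q : pred J) (f : J -> I -> R) (f0 : J -> R) :
  (forall j, Q j -> f j x @[x --> F] --> f0 j) ->
  \prod_(j <- r | Q j) f j x @[x --> F] --> \prod_(j <- r | Q j) f0 j.
Proof. by move=> ff0; apply: cvg_big => //; exact: mul_continuous. Qed.

Lemma cvgm_cst m n (A : 'M[R]_(m, n)) : cvgm (fun=> A) A.
Proof. by move=> i j; exact: cvg_cst. Qed.

Lemma near_eq_cvgm m n (q q' : I -> 'M[R]_(m, n)) q0 :
  (\forall x \near F, q x = q' x) -> cvgm q' q0 -> cvgm q q0.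
Proof.
move=> qq' q'0 i j; apply: cvg_trans (q'0 i j); apply: near_eq_cvg.
by apply: filterS qq' => x ->.
Qed.

Lemma cvgmD m n (q q' : I -> 'M[R]_(m, n)) q0 q'0 :
  cvgm q q0 -> cvgm q' q'0 -> cvgm (fun x => q x + q' x) (q0 + q'0).
Proof.
move=> qq0 q'q'0 i j; rewrite mxE; under eq_cvg do rewrite mxE.
by apply: cvgD; [exact: qq0|exact: q'q'0].
Qed.

Lemma cvgmZ m n (c : I -> R) (q : I -> 'M[R]_(m, n)) (c0 : R) q0 :
  c x @[x --> F] --> c0 -> cvgm q q0 -> cvgm (fun x => c x *: q x) (c0 *: q0).
Proof.
move=> cc0 qq0 i j; rewrite mxE; under eq_cvg do rewrite mxE.
by apply: cvgM => //; exact: qq0.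
Qed.

Lemma cvgmN m n (q : I -> 'M[R]_(m, n)) q0 :
  cvgm q q0 -> cvgm (fun x => - q x) (- q0).
Proof.
move=> qq0 i j; rewrite mxE; under eq_cvg do rewrite mxE.
by apply: cvgN; exact: qq0.
Qed.

Lemma cvgmB m n (q q' : I -> 'M[R]_(m, n)) q0 q'0 :
  cvgm q q0 -> cvgm q' q'0 -> cvgm (fun x => q x - q' x) (q0 - q'0).
Proof. by move=> qq0 q'q'0; apply: cvgmD => //; exact: cvgmN. Qed.

Lemma cvgmM m n k (q : I -> 'M[R]_(m, n)) (q' : I -> 'M[R]_(n, k)) q0 q'0 :
  cvgm q q0 -> cvgm q' q'0 -> cvgm (fun x => q x *m q' x) (q0 *m q'0).
Proof.
move=> qq0 q'q'0 i j; rewrite mxE; under eq_cvg do rewrite mxE.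
by apply: cvg_sumr => l _; apply: cvgM; [exact: qq0|exact: q'q'0].
Qed.

Lemma cvgmT m n (q : I -> 'M[R]_(m, n)) q0 :
  cvgm q q0 -> cvgm (fun x => (q x)^T) q0^T.
Proof. by move=> qq0 i j; rewrite mxE; under eq_cvg do rewrite mxE; exact: qq0. Qed.

Lemma cvgm_det n (q : I -> 'M[R]_n) q0 : cvgm q q0 ->
  \det (q x) @[x --> F] --> \det q0.
Proof.
move=> qq0; apply: cvg_sumr => s _; apply: cvgM; first exact: cvg_cst.
by apply: cvg_prodr => i _; exact: qq0.
Qed.

Lemma cvgm_adj n (q : I -> 'M[R]_n) q0 : cvgm q q0 ->
  cvgm (fun x => \adj (q x)) (\adj q0).
Proof.
move=> qq0 i j; rewrite mxE; under eq_cvg do rewrite mxE.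
apply: cvgM; first exact: cvg_cst.
by apply: cvgm_det => k l; rewrite !mxE; under eq_cvg do rewrite !mxE; exact: qq0.
Qed.

Lemma cvgm_near_unit n (q : I -> 'M[R]_n) q0 : cvgm q q0 -> q0 \in unitmx ->
  \forall x \near F, q x \in unitmx.
Proof.
rewrite unitmxE unitfE => /cvgm_det qq0 u0.
near=> x; rewrite unitmxE unitfE; near: x.
exact: (cvgr_neq0 (\det q0)).
Unshelve. all: by end_near. Qed.

Lemma cvgm_invmx n (q : I -> 'M[R]_n) q0 : cvgm q q0 -> q0 \in unitmx ->
  cvgm (fun x => invmx (q x)) (invmx q0).
Proof.
move=> qq0 u0; have uq := cvgm_near_unit qq0 u0.
apply: (@near_eq_cvgm _ _ _ (fun x => (\det (q x))^-1 *: \adj (q x))).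
  by apply: filterS uq => x ux; rewrite /invmx ux.
rewrite /invmx u0; apply: cvgmZ; last exact: cvgm_adj.
by apply: cvgV; [move: u0; rewrite unitmxE unitfE|exact: cvgm_det].
Qed.

Lemma cvgm_mxtrace n (q : I -> 'M[R]_n) q0 : cvgm q q0 ->
  \tr (q x) @[x --> F] --> \tr q0.
Proof. by move=> qq0; apply: cvg_sumr => i _; exact: qq0. Qed.

Lemma cvgm_bform n (x y : I -> 'cV[R]_n) (q : I -> 'M[R]_n) x0 y0 q0 :
  cvgm x x0 -> cvgm y y0 -> cvgm q q0 ->
  bform (x i) (q i) (y i) @[i --> F] --> bform x0 q0 y0.
Proof.
by move=> xx0 yy0 qq0; apply: (cvgmM (cvgmM (cvgmT xx0) qq0) yy0).
Qed.

End entrywise_limits.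

Section cholesky.
Context {R : realType}.

(* The Cholesky factor, by recursion on Schur complements: an explicit square root,
   so that it is visibly measurable, and continuous at positive definite matrices. *)
Fixpoint chol n : 'M[R]_n -> 'M[R]_n :=
  match n return 'M[R]_n -> 'M[R]_n with
  | 0 => fun A => A
  | n'.+1 => fun A : 'M[R]_(1 + n') =>
    let a := ulsubmx A 0 0 in let b := dlsubmx A in
    (block_mx (Num.sqrt a)%:M 0 ((Num.sqrt a)^-1 *: b)
      (chol (drsubmx A - a^-1 *: (b *m b^T))) : 'M[R]_(1 + n'))
  end.

Lemma posdef_schur n (A : 'M[R]_(1 + n)) : posdef A ->
  0 < ulsubmx A 0 0 /\
  posdef (drsubmx A - (ulsubmx A 0 0)^-1 *: (dlsubmx A *m (dlsubmx A)^T)).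
Proof.
move=> [AT A0]; set a := ulsubmx A 0 0; set b := dlsubmx A; set D := drsubmx A.
have ulE : ulsubmx A = a%:M.
  by apply/matrixP => i j; rewrite !ord1 [RHS]mxE eqxx mulr1n.
have AE : A = block_mx a%:M b^T b D.
  rewrite -ulE -[LHS](submxK A) -/b -/D; congr block_mx.
  by rewrite /b trmx_dlsub AT.
have bfE (c : R) (y : 'cV[R]_n) : bform (col_mx c%:M y) A (col_mx c%:M y) =
    a * c ^+ 2 + 2 * c * (b^T *m y) 0 0 + (y^T *m D *m y) 0 0.
  rewrite /bform tr_col_mx AE mul_row_block mul_row_col !mulmxDl tr_scalar_mx.
  have -> : y^T *m b = (b^T *m y)^T by rewrite trmx_mul trmxK.
  rewrite -!scalar_mxM mul_mx_scalar mul_scalar_mx -scalemxAl.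
  set u := b^T *m y; set v := y^T *m D *m y.
  by rewrite !mxE eqxx mulr1n; ring.
have a0 : 0 < a.
  have := A0 (col_mx 1%:M 0); rewrite bfE !mulmx0 ![in X in X -> _]mxE.
  rewrite expr1n mulr0 mulr1 !addr0.
  apply; rewrite col_mx_eq0 negb_and; apply/orP; left.
  by apply/eqP => /matrixP/(_ 0 0)/eqP; rewrite !mxE oner_eq0.
split=> //; split=> [|y y0].
  rewrite linearB linearZ /= trmx_mul trmxK; congr (_ - _).
  by rewrite /D trmx_drsub AT.
(* Completing the square: for fixed [y] this first coordinate minimizes the form, and the minimum is
   the form of the Schur complement at [y]. *)
have := A0 (col_mx (- (a^-1 * (b^T *m y) 0 0))%:M y).
rewrite col_mx_eq0 negb_and y0 orbT => /(_ isT).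
rewrite bfE /bform mulmxBr mulmxBl -scalemxAr -scalemxAl.
have -> : y^T *m (b *m b^T) *m y = (b^T *m y)^T *m (b^T *m y).
  by rewrite trmx_mul trmxK !mulmxA.
set u := b^T *m y; set v := y^T *m D *m y.
rewrite [X in _ -> _ < X](_ : _ = v 0 0 - a^-1 * (u 0 0 * u 0 0)); last first.
  by clearbody u v; rewrite !mxE big_ord1 !mxE.
by congr (0 < _); field; rewrite gt_eqF.
Qed.

Lemma chol_correct n (A : 'M[R]_n) : posdef A -> chol A *m (chol A)^T = A.
Proof.
elim: n A => [|n IH] A pA; first by rewrite [LHS]flatmx0 [RHS]flatmx0.
have [a0 pD] := @posdef_schur n A pA.
have [AT _] := pA; rewrite /=.
set a := ulsubmx _ 0 0; set b := dlsubmx _; set D := drsubmx _.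
rewrite -/a -/b -/D in pD, a0.
rewrite (@tr_block_mx _ 1 n 1 n) (@mulmx_block _ 1 n 1 n 1 n).
rewrite IH// trmx0 tr_scalar_mx !mul0mx !mulmx0 !addr0.
have sa0 : Num.sqrt a != 0 by rewrite gt_eqF// sqrtr_gt0.
have saa : Num.sqrt a * Num.sqrt a = a by rewrite -expr2 sqr_sqrtr// ltW.
have bTE : ((Num.sqrt a)^-1 *: b)^T = (Num.sqrt a)^-1 *: b^T by rewrite linearZ.
rewrite bTE !mul_scalar_mx mul_mx_scalar !scalerA mulfV// !scale1r.
rewrite -scalemxAl -scalemxAr scalerA -invfM saa addrCA subrr addr0.
rewrite scale_scalar_mx saa -[RHS](@submxK _ 1 n 1 n).
have -> : ulsubmx (A : 'M[R]_(1 + n)) = a%:M.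
  by apply/matrixP => i j; rewrite !ord1 [RHS]mxE eqxx mulr1n.
have -> : ursubmx (A : 'M[R]_(1 + n)) = b^T.
  by rewrite /b (@trmx_dlsub R 1 n 1 n) AT.
by [].
Qed.

Lemma cvgm_block (I : Type) (F : set_system I) m1 m2 n1 n2
  (A : I -> 'M[R]_(m1, n1)) (B : I -> 'M[R]_(m1, n2))
  (C : I -> 'M[R]_(m2, n1)) (D : I -> 'M[R]_(m2, n2)) A0 B0 C0 D0 :
  cvgm F A A0 -> cvgm F B B0 -> cvgm F C C0 -> cvgm F D D0 ->
  cvgm F (fun x => block_mx (A x) (B x) (C x) (D x)) (block_mx A0 B0 C0 D0).
Proof.
move=> AA0 BB0 CC0 DD0 i j; rewrite -(fintype.splitK i) -(fintype.splitK j).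
case: (fintype.split i) => i' /=; case: (fintype.split j) => j' /=.
- by rewrite block_mxEul; under eq_cvg do rewrite block_mxEul; exact: AA0.
- by rewrite block_mxEur; under eq_cvg do rewrite block_mxEur; exact: BB0.
- by rewrite block_mxEdl; under eq_cvg do rewrite block_mxEdl; exact: CC0.
- by rewrite block_mxEdr; under eq_cvg do rewrite block_mxEdr; exact: DD0.
Qed.

Lemma cvgm_chol (I : Type) (F : set_system I) {FF : Filter F} n
  (q : I -> 'M[R]_n) q0 : posdef q0 -> cvgm F q q0 ->
  cvgm F (fun x => chol (q x)) (chol q0).
Proof.
elim: n q q0 => [|n IH] q q0 pq qq0; first by move=> [].
have [a0 pD] := @posdef_schur n q0 pq.
have cul : ulsubmx (q x : 'M[R]_(1 + n)) 0 0 @[x --> F] -->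
    ulsubmx (q0 : 'M[R]_(1 + n)) 0 0.
  by rewrite !mxE; under eq_cvg do rewrite !mxE; exact: qq0.
have csq : Num.sqrt (ulsubmx (q x : 'M[R]_(1 + n)) 0 0) @[x --> F] -->
    Num.sqrt (ulsubmx (q0 : 'M[R]_(1 + n)) 0 0).
  by apply: continuous_cvg => //; exact: sqrt_continuous.
have cdl : cvgm F (fun x => dlsubmx (q x : 'M[R]_(1 + n)))
    (dlsubmx (q0 : 'M[R]_(1 + n))).
  by move=> i j; rewrite !mxE; under eq_cvg do rewrite !mxE; exact: qq0.
have cdr : cvgm F (fun x => drsubmx (q x : 'M[R]_(1 + n)))
    (drsubmx (q0 : 'M[R]_(1 + n))).
  by move=> i j; rewrite !mxE; under eq_cvg do rewrite !mxE; exact: qq0.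
apply: (@cvgm_block I F 1 n 1 n).
- move=> i j; rewrite !ord1 mxE; under eq_cvg do rewrite mxE eqxx mulr1n.
  exact: csq.
- exact: cvgm_cst.
- apply: cvgmZ => //; apply: cvgV => //.
  by rewrite gt_eqF// sqrtr_gt0.
- apply: IH => //; apply: cvgmB => //; apply: cvgmZ.
    by apply: cvgV => //; rewrite gt_eqF.
  by apply: cvgmM => //; exact: cvgmT.
Qed.

End cholesky.

(** * Measurability of matrix operations *)

Section random_matrices.
Context {R : realType} {d : measure_display} {T : measurableType d}.

Lemma measurable_funVr (f : T -> R) : measurable_fun setT f ->
  measurable_fun setT (fun x => (f x)^-1).
Proof.
move=> mf; apply: (measurableT_comp (f := @GRing.inv R)) => //.
(* Inversion is discontinuous at 0, where its value is 0 by convention; the point 0 and its open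
   complement are treated separately. *)
rewrite -(setUv [set 0 : R]); apply/measurable_funU => //; first exact: measurableC.
split; first exact: measurable_fun_set1.
apply: open_continuous_measurable_fun.
  exact/closed_openC/closed_eq.
by move=> x; rewrite inE => /eqP x0; exact: inv_continuous.
Qed.

Lemma random_matrix_cst m n (A : 'M[R]_(m, n)) :
  random_matrix (fun _ : T => A).
Proof. by move=> i j; exact: measurable_cst. Qed.

Lemma random_matrixD m n (X Y : T -> 'M[R]_(m, n)) :
  random_matrix X -> random_matrix Y -> random_matrix (fun w => X w + Y w).
Proof.
move=> mX mY i j; under eq_fun do rewrite mxE.
by apply: measurable_funD; [exact: mX|exact: mY].
Qed.

Lemma random_matrixZ m n (c : T -> R) (X : T -> 'M[R]_(m, n)) :
  measurable_fun setT c -> random_matrix X -> random_matrix (fun w => c w *: X w).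
Proof.
move=> mc mX i j; under eq_fun do rewrite mxE.
by apply: measurable_funM => //; exact: mX.
Qed.

Lemma random_matrixN m n (X : T -> 'M[R]_(m, n)) :
  random_matrix X -> random_matrix (fun w => - X w).
Proof.
move=> mX i j; under eq_fun do rewrite mxE.
by apply: measurable_funN; exact: mX.
Qed.

Lemma random_matrixB m n (X Y : T -> 'M[R]_(m, n)) :
  random_matrix X -> random_matrix Y -> random_matrix (fun w => X w - Y w).
Proof. by move=> mX mY; apply: random_matrixD => //; exact: random_matrixN. Qed.

Lemma random_matrixM m n k (X : T -> 'M[R]_(m, n)) (Y : T -> 'M[R]_(n, k)) :
  random_matrix X -> random_matrix Y -> random_matrix (fun w => X w *m Y w).
Proof.
move=> mX mY i j; under eq_fun do rewrite mxE.
apply: measurable_sum => l.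
by apply: measurable_funM; [exact: mX|exact: mY].
Qed.

Lemma random_matrixT m n (X : T -> 'M[R]_(m, n)) :
  random_matrix X -> random_matrix (fun w => (X w)^T).
Proof. by move=> mX i j; under eq_fun do rewrite mxE; exact: mX. Qed.

Lemma measurable_det n (X : T -> 'M[R]_n) : random_matrix X ->
  measurable_fun setT (fun w => \det (X w)).
Proof.
move=> mX; apply: measurable_sum => s; apply: measurable_funM => //.
by apply: measurable_prod => i _; exact: mX.
Qed.

Lemma random_matrix_invmx n (X : T -> 'M[R]_n) :
  random_matrix X -> random_matrix (fun w => invmx (X w)).
Proof.
move=> mX i j; have mdet := measurable_det mX.
(* On a singular matrix [invmx] returns the matrix itself, hence the first branch. *)
rewrite (_ : (fun w => _) = (fun w => if \det (X w) == 0 then X w i j else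
    (\det (X w))^-1 * cofactor (X w) j i)); last first.
  apply/funext => w; rewrite /invmx unitmxE unitfE.
  by case: eqVneq => //= _; rewrite !mxE.
apply: measurable_fun_ifT; [|exact: mX|].
  by apply: measurable_fun_eqr => //; exact: measurable_cst.
apply: measurable_funM; first exact: measurable_funVr.
apply: measurable_funM; first exact: measurable_cst.
by apply: measurable_det => k l; under eq_fun do rewrite !mxE; exact: mX.
Qed.

(** Positivity is not assumed: square root and inversion are measurable as total functions, with
    their default values. *)
Lemma random_matrix_chol n (X : T -> 'M[R]_n) :
  random_matrix X -> random_matrix (fun w => chol (X w)).
Proof.
elim: n X => [|n IH] X mX //.
have mul : measurable_fun setT (fun w => ulsubmx (X w : 'M[R]_(1 + n)) 0 0).
  by under eq_fun do rewrite !mxE; exact: mX.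
have msq : measurable_fun setT (fun w => Num.sqrt (ulsubmx (X w : 'M[R]_(1 + n)) 0 0)).
  apply: (measurableT_comp (f := @Num.sqrt R)) => //.
  by apply: continuous_measurable_fun; exact: sqrt_continuous.
have mdl : random_matrix (fun w => dlsubmx (X w : 'M[R]_(1 + n))).
  by move=> i j; under eq_fun do rewrite !mxE; exact: mX.
have mdr : random_matrix (fun w => drsubmx (X w : 'M[R]_(1 + n))).
  by move=> i j; under eq_fun do rewrite !mxE; exact: mX.
have mch : random_matrix (fun w => chol (drsubmx (X w : 'M[R]_(1 + n))
    - (ulsubmx (X w : 'M[R]_(1 + n)) 0 0)^-1 *:
      (dlsubmx (X w : 'M[R]_(1 + n)) *m (dlsubmx (X w : 'M[R]_(1 + n)))^T))).
  apply: IH; apply: random_matrixB => //; apply: random_matrixZ.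
    exact: measurable_funVr.
  by apply: random_matrixM => //; exact: random_matrixT.
move=> i j.
pose M w : 'M[R]_(1 + n) := chol (X w).
rewrite (_ : (fun w => _) = (fun w => M w i j))//.
rewrite -(@fintype.splitK 1 n i) -(@fintype.splitK 1 n j).
case: (@fintype.split 1 n i) => i' /=; case: (@fintype.split 1 n j) => j' /=.
- apply: (eq_measurable_fun _ _ msq) => w _.
  by rewrite /M block_mxEul !ord1 [RHS]mxE eqxx mulr1n.
- apply: (eq_measurable_fun (D := setT) (fun _ : T => 0 : R)) => [w _|]; last exact: measurable_cst.
  by rewrite /M block_mxEur mxE.
- pose c w := (Num.sqrt (ulsubmx (X w : 'M[R]_(1 + n)) 0 0))^-1.
  apply: (eq_measurable_fun (D := setT)
    (fun w => c w * dlsubmx (X w : 'M[R]_(1 + n)) i' j')) => [w _|].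
    by rewrite /M block_mxEdl [RHS]mxE.
  by apply: measurable_funM; [exact: measurable_funVr|exact: mdl].
- apply: (eq_measurable_fun _ _ (mch i' j')) => w _.
  by rewrite /M block_mxEdr.
Qed.

End random_matrices.

(** * Differential calculus *)

Section matrix_topology.
Context {R : realType}.

Lemma mx_norm_le m n (A : 'M[R]_(m, n)) (c : R) : 0 <= c ->
  (forall i j, `|A i j| <= c) -> `|A| <= c.
Proof.
move=> c0 Ac; rewrite [leLHS]/Num.Def.normr /= mx_normrE.
by apply: bigmax_le => // -[i j] _; exact: Ac.
Qed.

Lemma mx_norm_ge m n (A : 'M[R]_(m, n)) i j : `|A i j| <= `|A|.
Proof.
by rewrite [leRHS]/Num.Def.normr /= mx_normrE; exact: (le_bigmax _ _ (i, j)).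
Qed.

Lemma cvg_mxP (I : Type) (F : set_system I) {FF : Filter F} m n
    (q : I -> 'M[R]_(m, n)) q0 :
  q x @[x --> F] --> q0 <-> cvgm F q q0.
Proof.
split=> [/cvgrPdist_le qq0 i j|qq0].
  apply/cvgrPdist_le => e e0; have := qq0 e e0; apply: filterS => x.
  by apply: le_trans; rewrite (le_trans _ (mx_norm_ge _ i j))// !mxE.
apply/cvgrPdist_le => e e0.
have : \forall x \near F, forall ij : 'I_m * 'I_n,
    `|q0 ij.1 ij.2 - q x ij.1 ij.2| <= e.
  by apply: filter_forall => -[i j] /=; move/cvgrPdist_le: (qq0 i j); apply.
apply: filterS => x qx; apply: mx_norm_le; first exact: ltW.
by move=> i j; rewrite !mxE; exact: (qx (i, j)).
Qed.

End matrix_topology.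

Section mean_value.
Context {R : realType} {V : normedModType R}.
Implicit Types (f : V -> R) (x v w : V).

Lemma line_quotient f x v (s h : R) :
  h^-1 *: (f ((h *: (1 : R) + s) *: v + x) - f (s *: v + x)) =
  h^-1 *: ((f \o shift (s *: v + x)) (h *: v) - f (s *: v + x)).
Proof. by rewrite /= /shift [h *: 1]mulr1 scalerDl addrA. Qed.

Lemma line_derivable f x v (s : R) : derivable f (s *: v + x) v ->
  is_derive s (1 : R) (fun t : R => f (t *: v + x)) ('D_v f (s *: v + x)).
Proof.
have E : (fun h : R => h^-1 *: (((fun t : R => f (t *: v + x)) \o shift s)
    (h *: (1 : R)) - f (s *: v + x))) =
  (fun h : R => h^-1 *: ((f \o shift (s *: v + x)) (h *: v) - f (s *: v + x))).
  by apply/funext => h; exact: line_quotient.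
by move=> df; split; rewrite ?/derivable ?/derive E.
Qed.

(** The step [t] may have either sign, so the intermediate point is located only by [|c| <= |t|]. *)
Lemma MVT_line f x v (t : R) :
  (forall s, `|s| <= `|t| -> derivable f (s *: v + x) v) ->
  exists2 c, `|c| <= `|t| & f (t *: v + x) - f x = t * 'D_v f (c *: v + x).
Proof.
move=> df; set g := fun s : R => f (s *: v + x).
have dg s : `|s| <= `|t| -> is_derive s (1 : R) g ('D_v f (s *: v + x)).
  by move=> /df; exact: line_derivable.
have cg a b : (forall s, s \in `[a, b] -> `|s| <= `|t|) ->
    {within `[a, b], continuous g}.
  move=> ab; apply: derivable_within_continuous => s /ab /dg.
  by move=> [].
have g0 : g 0 = f x by rewrite /g scale0r add0r.
have [t0|t0] := leP 0 t.
- have itv s : s \in `[0, t] -> `|s| <= `|t|.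
    by rewrite in_itv /= => /andP[s0 st]; rewrite !ger0_norm.
  have [||c ct] := @MVT_segment _ g (fun s => 'D_v f (s *: v + x)) 0 t t0.
  + by move=> s st; apply/dg/itv; exact: subset_itv_oo_cc.
  + exact: cg.
  by rewrite g0 subr0 mulrC => gt; exists c => //; exact: itv.
- have itv s : s \in `[t, 0] -> `|s| <= `|t|.
    by rewrite in_itv /= => /andP[s0 st]; rewrite !ler0_norm ?lerN2// ltW.
  have [||c ct] := @MVT_segment _ g (fun s => 'D_v f (s *: v + x)) t 0 (ltW t0).
  + by move=> s st; apply/dg/itv; exact: subset_itv_oo_cc.
  + exact: cg.
  rewrite g0 sub0r => gt; exists c; first exact: itv.
  by rewrite -[LHS]opprB gt; ring.
Qed.

Lemma translate_quotient f (c x v : V) :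
  (fun h : R => h^-1 *: (((fun y => f (c + y)) \o shift x) (h *: v) - f (c + x)))
  = (fun h : R => h^-1 *: ((f \o shift (c + x)) (h *: v) - f (c + x))).
Proof. by apply/funext => h; rewrite /= /shift addrCA. Qed.

Lemma derivable_translate f (c x v : V) : derivable f (c + x) v ->
  derivable (fun y => f (c + y)) x v.
Proof. by rewrite /derivable translate_quotient. Qed.

Lemma derive_translate f (c x v : V) :
  'D_v (fun y => f (c + y)) x = 'D_v f (c + x).
Proof. by rewrite /derive translate_quotient. Qed.

(** The second difference of [f] over the parallelogram spanned by [t v] and [t w] is symmetric in
    [v] and [w]. Two uses of the mean value theorem turn it, after division by [t^2], into a mixed
    derivative at a nearby point, in either order; continuity then gives both mixed derivatives at
    [x] as its limit. *)
Lemma schwarz_derive f x v w :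
  (\forall y \near x, derivable f y v) -> (\forall y \near x, derivable f y w) ->
  (\forall y \near x, derivable ('D_w f) y v) ->
  (\forall y \near x, derivable ('D_v f) y w) ->
  {for x, continuous ('D_v ('D_w f))} -> {for x, continuous ('D_w ('D_v f))} ->
  'D_v ('D_w f) x = 'D_w ('D_v f) x.
Proof.
have main u1 u2 :
    (\forall y \near x, derivable f y u1) ->
    (\forall y \near x, derivable ('D_u1 f) y u2) ->
    {for x, continuous ('D_u2 ('D_u1 f))} ->
    forall e : R, 0 < e -> \forall t \near (0 : R)^',
    `|t^-1 ^+ 2 * (f (t *: u2 + (t *: u1 + x)) - f (t *: u1 + x)
       - f (t *: u2 + x) + f x) - 'D_u2 ('D_u1 f) x| <= e.
  move=> d1 d2 c12 e e0.
  have : \forall y \near x, [/\ derivable f y u1, derivable ('D_u1 f) y u2 &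
      `|'D_u2 ('D_u1 f) x - 'D_u2 ('D_u1 f) y| <= e].
    have d3 : \forall y \near x, `|'D_u2 ('D_u1 f) x - 'D_u2 ('D_u1 f) y| <= e.
      by move/cvgrPdist_le: c12; apply.
    by apply: filterS3 d1 d2 d3 => y.
  move=> /nbhs_ballP[r /= r0 xr].
  have rE (a b t : R) : `|t| * (`|u1| + `|u2|) < r -> `|a| <= `|t| ->
      `|b| <= `|t| -> ball x r (a *: u1 + (b *: u2 + x)).
    move=> tr at_ bt; rewrite -ball_normE /ball_ /= distrC addrA addrK.
    rewrite (le_lt_trans _ tr)// (le_trans (ler_normD _ _))// !normrZ mulrDr.
    by rewrite lerD// ler_wpM2r.
  near=> t. 
  have t0 : t != 0 by near: t; exact: nbhs_dnbhs_neq.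
  have tr : `|t| * (`|u1| + `|u2|) < r.
    rewrite (@le_lt_trans _ _ (`|t| * (`|u1| + `|u2| + 1)))//.
      by rewrite ler_wpM2l// lerDl.
    rewrite -ltr_pdivlMr ?ltr_wpDl//; near: t; apply: dnbhs0_lt.
    by rewrite divr_gt0// ltr_wpDl.
  (* The mean value theorem for [g] along [u1] leaves an increment of the [u1]-derivative of [f];
     applied to that along [u2], it yields the mixed derivative. *)
  pose g y := f (t *: u2 + y) - f y.
  have dg (s : R) : `|s| <= `|t| -> derivable g (s *: u1 + x) u1 /\
      'D_u1 g (s *: u1 + x) =
      'D_u1 f (t *: u2 + (s *: u1 + x)) - 'D_u1 f (s *: u1 + x).
    move=> st.
    have [+ _ _] := xr _ (rE s 0 t tr st ltac:(by rewrite normr0)); rewrite scale0r add0r => d0.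
    have [+ _ _] := xr _ (rE s t t tr st (lexx _)); rewrite addrCA => dt.
    have dtr := derivable_translate dt.
    have gE : g = (fun y => f (t *: u2 + y)) \- f by [].
    split; first by rewrite gE; exact: (derivableB dtr d0).
    by rewrite gE (deriveB dtr d0) derive_translate.
  have [c1 c1t E1] := MVT_line (fun s st => (dg s st).1).
  have [D DE hD] : exists2 D : R, 'D_u1 f (t *: u2 + (c1 *: u1 + x))
      - 'D_u1 f (c1 *: u1 + x) = t * D & `|'D_u2 ('D_u1 f) x - D| <= e.
    have [|c2 c2t E2] := @MVT_line ('D_u1 f) (c1 *: u1 + x) u2 t.
      by move=> s st; rewrite addrCA; have [] := xr _ (rE c1 s t tr c1t st).
    exists ('D_u2 ('D_u1 f) (c2 *: u2 + (c1 *: u1 + x))); first exact: E2.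
    have hpt : ball x r (c2 *: u2 + (c1 *: u1 + x)).
      by rewrite addrCA; exact: (rE c1 c2 t tr c1t c2t).
    by have [_ _] := xr _ hpt.
  rewrite (dg _ c1t).2 DE in E1.
  rewrite distrC.
  have -> : f (t *: u2 + (t *: u1 + x)) - f (t *: u1 + x) - f (t *: u2 + x) + f x
    = t * (t * D) by rewrite -E1 /g; ring.
  by rewrite mulrA -expr2 mulrA -exprMn mulVf// expr1n mul1r.
move=> dv dw dvw dwv cvw cwv; apply/eqP; rewrite -subr_eq0 -normr_le0.
apply/ler_addgt0Pl => e e0; rewrite addr0.
have e20 : 0 < e / 2 by rewrite divr_gt0.
have [t [/=]] := filter_ex (filterI (main w v dw dvw cvw (e / 2) e20)
  (main v w dv dwv cwv (e / 2) e20)).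
rewrite (addrCA (t *: v) (t *: w) x).
move: (f (t *: w + (t *: v + x))) (f (t *: w + x)) (f (t *: v + x)) => a b c.
rewrite (addrAC a (- b) (- c)); set L := _ * _.
move: ('D_v ('D_w f) x) ('D_w ('D_v f) x) => A B LA LB.
by rewrite (splitr e) -(subrKA L) (le_trans (ler_normD _ _))// lerD// distrC.
Unshelve. all: by end_near. Qed.

End mean_value.

Section partial_derivatives.
Context {R : realType} {p : nat}.
Implicit Types (f : 'cV[R]_p -> R) (x y : 'cV[R]_p).

Let e_ (k : 'I_p) : 'cV[R]_p := delta_mx k 0.

(** The path from [x] to [y] changes one coordinate at a time, and the mean value theorem on each
    leg compares the increment with a partial derivative at [x]. In the maximum norm the whole path
    stays in the ball that contains [y]. *)
Lemma frechet_of_partials f x :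
  (forall k, \forall y \near x, derivable f y (e_ k)) ->
  (forall k, {for x, continuous ('D_(e_ k) f)}) ->
  forall e : R, 0 < e -> \forall y \near x,
    `|f y - f x - \sum_k (y - x) k 0 * 'D_(e_ k) f x| <= e * `|y - x|.
Proof.
move=> df cf e e0.
(* Dividing by [p.+1] keeps the sum of the [p] errors below [e] and covers [p = 0]. *)
pose Pk (k : 'I_p) y := derivable f y (e_ k) /\
    `|'D_(e_ k) f x - 'D_(e_ k) f y| <= e / p.+1%:R.
have : nbhs x (fun y => forall k, Pk k y).
  apply: (@filter_forall _ 'I_p Pk (nbhs x)) => k.
  have ck : \forall y \near x, `|'D_(e_ k) f x - 'D_(e_ k) f y| <= e / p.+1%:R.
    by move/cvgrPdist_le: (cf k); apply; rewrite divr_gt0.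
  by near=> y; split; near: y; [exact: df|exact: ck].
move=> /nbhs_ballP[r /= r0 xr].
apply/nbhs_ballP; exists r => //= y; rewrite -ball_normE /ball_ /= distrC => yr.
pose path (k : nat) : 'cV[R]_p := \col_i (if (i < k)%N then y i 0 else x i 0).
have pathS (k : 'I_p) : path k.+1 = (y - x) k 0 *: e_ k + path k.
  apply/matrixP => i j; rewrite ord1 !mxE eqxx andbT ltnS leq_eqVlt.
  have [/val_inj ->|ik] := eqVneq (i : nat) k.
    by rewrite eqxx ltnn mulr1 subrK.
  rewrite (_ : (i == k) = false) ?mulr0 ?add0r//.
  by apply/eqP => E; rewrite E eqxx in ik.
have ptr (k : 'I_p) (c : R) : `|c| <= `|(y - x) k 0| -> ball x r (c *: e_ k + path k).
  move=> ck; rewrite -ball_normE /ball_ /=; apply: le_lt_trans yr.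
  apply: mx_norm_le => // i j; rewrite ord1 !mxE eqxx andbT.
  have [->|ik] := eqVneq i k.
    rewrite ltnn mulr1 addrC opprD subrK normrN.
    by rewrite (le_trans ck)// mx_norm_ge.
  rewrite mulr0 add0r; case: ifP => _; last by rewrite subrr normr0.
  by have := mx_norm_ge (y - x) i 0; rewrite !mxE (distrC (y i 0)).
have fE : f y - f x = \sum_(k < p) (f (path k.+1) - f (path k)).
  rewrite -(big_mkord xpredT (fun k => f (path k.+1) - f (path k))).
  rewrite telescope_sumr//.
  have -> : path p = y by apply/matrixP => i j; rewrite ord1 mxE ltn_ord.
  by have -> : path 0%N = x by apply/matrixP => i j; rewrite ord1 mxE.
rewrite fE -sumrB (le_trans (ler_norm_sum _ _ _))//.
apply: (@le_trans _ _ (\sum_(k < p) e / p.+1%:R * `|y - x|)); last first.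
  rewrite sumr_const card_ord -[leLHS]mulr_natl mulrA ler_wpM2r//.
  rewrite mulrCA ger_pMr// ler_pdivrMr// mul1r ler_nat.
  exact: leqnSn.
apply: ler_sum => k _; rewrite pathS.
have [|c ck ->] := @MVT_line _ _ f (path k) (e_ k) ((y - x) k 0).
  by move=> s sk; have [] := xr _ (ptr k s sk) k.
rewrite -mulrBr normrM mulrC ler_pM//; last exact: mx_norm_ge.
by rewrite distrC; have [] := xr _ (ptr k c ck) k.
Unshelve. all: by end_near. Qed.

Lemma continuous_of_partials f x :
  (forall k, \forall y \near x, derivable f y (e_ k)) ->
  (forall k, {for x, continuous ('D_(e_ k) f)}) ->
  {for x, continuous f}.
Proof.
move=> df cf; apply/(@cvgrPdist_le _ _ _ (nbhs x) (nbhs_filter x)) => e e0.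
set S : R := \sum_k `|'D_(e_ k) f x|.
have S0 : 0 <= S by exact: sumr_ge0.
have near_xy : nbhs x (fun y => `|x - y| <= e / (1 + S)).
  by apply: (@cvgr_dist_le _ _ _ (nbhs x) _ id x cvg_id); rewrite divr_gt0// ltr_pwDl.
apply: filterS2 (frechet_of_partials df cf ltr01) near_xy => y fy yx.
rewrite distrC -[f y - f x](subrK (\sum_k (y - x) k 0 * 'D_(e_ k) f x)).
rewrite (le_trans (ler_normD _ _))//.
rewrite (@le_trans _ _ (`|y - x| * (1 + S)))//; last first.
  by rewrite distrC -ler_pdivlMr// ltr_pwDl.
rewrite mulrDr lerD ?mulr1//; first by rewrite mul1r in fy.
rewrite (le_trans (ler_norm_sum _ _ _))// /S mulr_sumr ler_sum// => k _.
by rewrite normrM ler_wpM2r// mx_norm_ge.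
Qed.

End partial_derivatives.

(** * First-order expansions along a filter *)

Section first_order_expansions.
Context {R : realType} {I : Type} (F : set_system I) {FF : Filter F}.
Variable rho : I -> R.
Hypothesis rho0 : rho x @[x --> F] --> (0 : R).
Hypothesis rhoN0 : \forall x \near F, rho x != 0.

Definition bddm m n (q : I -> 'M[R]_(m, n)) : Prop :=
  exists M : R, \forall x \near F, forall i j, `|q x i j| <= M.

(* q = q0 + rho * q1 + o(rho) along F, where the first-order term q1 may move with
   the index but stays bounded. *)
Definition dqm m n (q : I -> 'M[R]_(m, n)) q0 (q1 : I -> 'M[R]_(m, n)) : Prop :=
  bddm q1 /\ cvgm F (fun x => (rho x)^-1 *: (q x - q0) - q1 x) 0.

Lemma bddm_cst m n (A : 'M[R]_(m, n)) : bddm (fun=> A).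
Proof. by exists `|A|; near=> x => i j; exact: mx_norm_ge. Unshelve. all: by end_near. Qed.

Lemma bddmD m n (q q' : I -> 'M[R]_(m, n)) :
  bddm q -> bddm q' -> bddm (fun x => q x + q' x).
Proof.
move=> [M qM] [M' qM']; exists (M + M'); apply: filterS2 qM qM' => x qx q'x i j.
by rewrite mxE (le_trans (ler_normD _ _))// lerD.
Qed.

Lemma bddmN m n (q : I -> 'M[R]_(m, n)) : bddm q -> bddm (fun x => - q x).
Proof.
by move=> [M qM]; exists M; apply: filterS qM => x qx i j; rewrite mxE normrN.
Qed.

Lemma bddmM m n k (q : I -> 'M[R]_(m, n)) (q' : I -> 'M[R]_(n, k)) :
  bddm q -> bddm q' -> bddm (fun x => q x *m q' x).
Proof.
move=> [M qM] [M' qM']; exists (\sum_(l < n) M * M').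
apply: filterS2 qM qM' => x qx q'x i j.
rewrite mxE (le_trans (ler_norm_sum _ _ _))// ler_sum// => l _.
by rewrite normrM ler_pM.
Qed.

Lemma bddmZ m n (c : I -> R) (A : I -> 'M[R]_(m, n)) :
  (exists M : R, \forall x \near F, `|c x| <= M) -> bddm A ->
  bddm (fun x => c x *: A x).
Proof.
move=> [M cM] [M' AM]; exists (M * M'); apply: filterS2 cM AM => x cx Ax i j.
by rewrite mxE normrM ler_pM.
Qed.

Lemma bddm_sum m n (J : finType) (q : J -> I -> 'M[R]_(m, n)) :
  (forall j, bddm (q j)) -> bddm (fun x => \sum_j q j x).
Proof.
move=> qb; rewrite /bddm; elim: (index_enum J) => [|j s IH].
  by exists 0; near=> x => i j; rewrite big_nil mxE normr0.
have := bddmD (qb j) IH; move=> [M qM]; exists M; apply: filterS qM => x.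
by rewrite big_cons.
Unshelve. all: by end_near. Qed.

Lemma cvgm_bddm m n (q : I -> 'M[R]_(m, n)) q0 : cvgm F q q0 -> bddm q.
Proof.
move=> /cvg_mxP qq0; exists (`|q0| + 1).
have : \forall x \near F, `|q x| < `|q0| + 1.
  have := cvgr_norm_lt _ qq0; apply; by rewrite ltrDl.
by apply: filterS => x qx i j; rewrite (le_trans (mx_norm_ge _ _ _))// ltW.
Qed.

Lemma cvg_bdd_mul0 (f g : I -> R) : (exists M : R, \forall x \near F, `|f x| <= M) ->
  g x @[x --> F] --> (0 : R) -> f x * g x @[x --> F] --> (0 : R).
Proof.
move=> [M fM] /cvgr0Pnorm_le g0; apply/cvgr0Pnorm_le => e e0.
have M1 : 0 < `|M| + 1 by rewrite ltr_wpDl.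
near=> x; rewrite normrM.
rewrite (@le_trans _ _ ((`|M| + 1) * (e / (`|M| + 1))))//.
  apply: ler_pM => //; near: x; last by apply: g0; rewrite divr_gt0.
  apply: filterS fM => x fx.
  by rewrite (le_trans fx)// (le_trans (ler_norm _))// lerDl.
by rewrite mulrCA divff ?mulr1// gt_eqF.
Unshelve. all: by end_near. Qed.

Lemma cvgm_bddm_mul0 m n k (q : I -> 'M[R]_(m, n)) (q' : I -> 'M[R]_(n, k)) :
  bddm q -> cvgm F q' 0 -> cvgm F (fun x => q x *m q' x) 0.
Proof.
move=> [M qM] q'0 i j; rewrite mxE; under eq_cvg do rewrite mxE.
have := @cvg_sumr R I F _ 'I_n (index_enum _) xpredT
  (fun l x => q x i l * q' x l j) (fun=> 0).
rewrite big1//; apply=> l _; apply: cvg_bdd_mul0.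
  by exists M; apply: filterS qM => x.
by have := q'0 l j; rewrite mxE.
Qed.

Lemma bddm_tr m n (q : I -> 'M[R]_(m, n)) : bddm q -> bddm (fun x => (q x)^T).
Proof. by move=> [M qM]; exists M; apply: filterS qM => x qx i j; rewrite mxE. Qed.

Lemma cvgm_mul_bddm0 m n k (q : I -> 'M[R]_(m, n)) (q' : I -> 'M[R]_(n, k)) :
  cvgm F q 0 -> bddm q' -> cvgm F (fun x => q x *m q' x) 0.
Proof.
move=> q0 bq'.
have qT : cvgm F (fun x => (q x)^T) 0 by rewrite -(trmx0 R m n); exact: cvgmT.
have := cvgmT (cvgm_bddm_mul0 (bddm_tr bq') qT); rewrite trmx0.
by do ?move/(_ FF); move=> H; apply: (near_eq_cvgm _ H); near=> x; rewrite trmx_mul !trmxK.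
Unshelve. all: by end_near. Qed.

Lemma dqm_cvgm m n (q : I -> 'M[R]_(m, n)) q0 q1 : dqm q q0 q1 -> cvgm F q q0.
Proof.
move=> [bq1 qq0].
have c0 A : bddm A -> cvgm F (fun x => rho x *: A x) (0 : 'M[R]_(m, n)).
  move=> [M AM] i j; rewrite mxE; under eq_cvg do rewrite mxE mulrC.
  by apply: cvg_bdd_mul0 => //; exists M; apply: filterS AM => x.
have := cvgmD (cvgmD (c0 _ (cvgm_bddm qq0)) (c0 _ bq1)) (@cvgm_cst _ _ F _ _ _ q0).
rewrite !add0r; do ?move/(_ FF); move=> H; apply: (near_eq_cvgm _ H); apply: filterS rhoN0 => x rx.
by rewrite -scalerDr subrK scalerA mulfV// scale1r subrK.
Qed.

Lemma dqm_bddm m n (q : I -> 'M[R]_(m, n)) q0 q1 : dqm q q0 q1 -> bddm q.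
Proof. by move=> /dqm_cvgm; exact: cvgm_bddm. Qed.

Lemma dqm_eq1 m n (q : I -> 'M[R]_(m, n)) q0 q1 q1' :
  (forall x, q1 x = q1' x) -> dqm q q0 q1 -> dqm q q0 q1'.
Proof. by move=> /funext ->. Qed.

Lemma dqm_cst m n (A : 'M[R]_(m, n)) : dqm (fun=> A) A (fun=> 0).
Proof.
split; first exact: bddm_cst.
apply: (@near_eq_cvgm _ _ F _ _ _ _ (fun=> 0)); last exact: cvgm_cst.
by near=> x; rewrite subrr scaler0 subrr.
Unshelve. all: by end_near. Qed.

Lemma dqmD m n (q q' : I -> 'M[R]_(m, n)) q0 q1 q'0 q'1 :
  dqm q q0 q1 -> dqm q' q'0 q'1 ->
  dqm (fun x => q x + q' x) (q0 + q'0) (fun x => q1 x + q'1 x).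
Proof.
move=> [b c] [b' c']; split; first exact: bddmD.
have := cvgmD c c'; rewrite addr0; do ?move/(_ FF); move=> H; apply: (near_eq_cvgm _ H); near=> x.
by rewrite opprD addrACA scalerDr opprD addrACA.
Unshelve. all: by end_near. Qed.

Lemma dqmN m n (q : I -> 'M[R]_(m, n)) q0 q1 :
  dqm q q0 q1 -> dqm (fun x => - q x) (- q0) (fun x => - q1 x).
Proof.
move=> [b c]; split; first exact: bddmN.
have := cvgmN c; rewrite oppr0; do ?move/(_ FF); move=> H; apply: (near_eq_cvgm _ H); near=> x.
by rewrite -opprD scalerN -opprD.
Unshelve. all: by end_near. Qed.

(** Product rule. The remainder has three parts: the remainder of [q] times the bounded [q'], the
    bounded [q1] times [q' - q'0], and [q0] times the remainder of [q']; each is bounded times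
    vanishing. *)
Lemma dqmM m n k (q : I -> 'M[R]_(m, n)) (q' : I -> 'M[R]_(n, k)) q0 q1 q'0 q'1 :
  dqm q q0 q1 -> dqm q' q'0 q'1 ->
  dqm (fun x => q x *m q' x) (q0 *m q'0) (fun x => q1 x *m q'0 + q0 *m q'1 x).
Proof.
move=> dq dq'; have [b c] := dq; have [b' c'] := dq'; split.
  by apply: bddmD; apply: bddmM => //; exact: bddm_cst.
have c1 := cvgm_mul_bddm0 c (dqm_bddm dq').
have c2 : cvgm F (fun x => q1 x *m (q' x - q'0)) 0.
  apply: cvgm_bddm_mul0 => //.
  by rewrite -(subrr q'0); apply: cvgmB; [exact: dqm_cvgm dq'|exact: cvgm_cst].
have c3 := cvgm_bddm_mul0 (bddm_cst q0) c'.
have := cvgmD (cvgmD c1 c2) c3; rewrite !addr0; do ?move/(_ FF); move=> H.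
apply: (near_eq_cvgm _ H); near=> x.
rewrite !mulmxBl !mulmxBr -!scalemxAl -!scalemxAr mulmxBl mulmxBr !scalerBr.
rewrite subrKA [X in _ = X + _]addrAC -[X in _ = _ + X]addrA subrKA.
by rewrite opprD addrACA.
Unshelve. all: by end_near. Qed.

Lemma dqm_trmx m n (q : I -> 'M[R]_(m, n)) q0 q1 :
  dqm q q0 q1 -> dqm (fun x => (q x)^T) q0^T (fun x => (q1 x)^T).
Proof.
move=> [b c]; split; first exact: bddm_tr.
by move=> i j; have := c j i; rewrite !mxE; under [in X in _ -> X]eq_cvg do rewrite !mxE;
  under eq_cvg do rewrite !mxE.
Qed.

Lemma dqm_invmx n (q : I -> 'M[R]_n) q0 q1 : q0 \in unitmx ->
  dqm q q0 q1 ->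
  dqm (fun x => invmx (q x)) (invmx q0) (fun x => - (invmx q0 *m q1 x *m invmx q0)).
Proof.
move=> u0 dq; have [b c] := dq; have cq := dqm_cvgm dq.
have ci : cvgm F (fun x => invmx (q x)) (invmx q0) by exact: cvgm_invmx.
split.
  by apply: bddmN; apply: bddmM; [apply: bddmM => //|]; exact: bddm_cst.
have ci0 : cvgm F (fun x => invmx (q x) - invmx q0) 0.
  by rewrite -(subrr (invmx q0)); apply: cvgmB; [exact: ci|exact: cvgm_cst].
have c1 := cvgm_mul_bddm0 (cvgm_bddm_mul0 (cvgm_bddm ci) c) (bddm_cst (invmx q0)).
have c2 := cvgm_mul_bddm0 (cvgm_mul_bddm0 ci0 b) (bddm_cst (invmx q0)).
have := cvgmN (cvgmD c1 c2); rewrite addr0 oppr0; do ?move/(_ FF); move=> H.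
apply: (near_eq_cvgm _ H).
have uq : \forall x \near F, q x \in unitmx by exact: cvgm_near_unit u0.
apply: filterS uq => x ux.
(* The resolvent identity reduces the increment of the inverse to that of [q]. *)
have E : invmx (q x) - invmx q0 = - (invmx (q x) *m (q x - q0) *m invmx q0).
  by rewrite mulmxBr mulVmx// mulmxBl mul1mx -mulmxA mulmxV// mulmx1 opprB.
rewrite {1}E; move: (q x - q0) => D {E}.
rewrite mulmxBr !mulmxBl -scalemxAr -scalemxAl subrKA opprB.
by rewrite scalerN opprK addrC.
Qed.

Lemma dqm_bform n (x y : I -> 'cV[R]_n) (q : I -> 'M[R]_n) x0 x1 y0 y1 q0 q1 :
  dqm x x0 x1 -> dqm q q0 q1 -> dqm y y0 y1 ->
  (rho i)^-1 * (bform (x i) (q i) (y i) - bform x0 q0 y0)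
  - (bform (x1 i) q0 y0 + bform x0 (q1 i) y0 + bform x0 q0 (y1 i)) @[i --> F]
  --> (0 : R).
Proof.
move=> dx dq dy; have [_ /(_ 0 0)] := dqmM (dqmM (dqm_trmx dx) dq) dy.
rewrite mxE; apply: cvg_trans; apply: near_eq_cvg; near=> i.
rewrite /bform !mulmxDl; set X1 := _ *m q1 i *m _; set X2 := _ *m q0 *m y0.
by rewrite !mxE.
Unshelve. all: by end_near. Qed.

Lemma dqm_mxtrace n (q : I -> 'M[R]_n) q0 q1 : dqm q q0 q1 ->
  (rho i)^-1 * (\tr (q i) - \tr q0) - \tr (q1 i) @[i --> F] --> (0 : R).
Proof.
move=> [_ /cvgm_mxtrace]; rewrite mxtrace0; apply: cvg_trans.
by apply: near_eq_cvg; near=> i; rewrite raddfB /= mxtraceZ raddfB.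
Unshelve. all: by end_near. Qed.

End first_order_expansions.

Section derivatives.
Context {R : realType} {V : normedModType R}.

Lemma dnbhs0_id : (h : R) @[h --> (0 : R)^'] --> (0 : R).
Proof. exact: cvg_within. Qed.

Lemma dnbhs0_neq0 : \forall h \near (0 : R)^', h != 0.
Proof. exact: nbhs_dnbhs_neq. Qed.

(** A directional derivative is the case [rho = id] along the punctured neighbourhood of 0. The
    rules for [dqm] thus serve both for differentiation and for the stochastic expansion. *)
Lemma derivable_dqm m n (f : V -> 'M[R]_(m, n)) x v : derivable f x v ->
  dqm (0 : R)^' id (fun h => f (h *: v + x)) (f x) (fun=> 'D_v f x).
Proof.
move=> df; split; first exact: bddm_cst.
rewrite -(subrr ('D_v f x)); apply: cvgmB; last exact: cvgm_cst.
by apply/cvg_mxP; exact: df.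
Qed.

Lemma dqm_derivable m n (f : V -> 'M[R]_(m, n)) x v L :
  dqm (0 : R)^' id (fun h => f (h *: v + x)) (f x) (fun=> L) ->
  derivable f x v /\ 'D_v f x = L.
Proof.
move=> [_ c].
have {c} : cvgm (0 : R)^' (fun h => h^-1 *: ((f \o shift x) (h *: v) - f x)) L.
  have H : cvgm (0 : R)^' (fun h => h^-1 *: (f (h *: v + x) - f x) - L + L) (0 + L).
    by apply: cvgmD; [exact: c|exact: cvgm_cst].
  rewrite add0r in H; apply: (near_eq_cvgm _ H).
  by near=> h; rewrite subrK.
move=> /cvg_mxP c; split; first by apply/cvg_ex; exists L.
exact: cvg_lim c.
Unshelve. all: by end_near. Qed.

End derivatives.

Lemma nbhs_eq_cvg (T : topologicalType) (U : topologicalType) (x : T) (f g : T -> U) (l : U) :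
  (\forall y \near x, g y = f y) -> f y @[y --> x] --> l -> g y @[y --> x] --> l.
Proof.
move=> fg; apply: cvg_trans; apply: (@near_eq_cvg _ _ _ (nbhs_filter x)).
by apply: filterS fg => y ->.
Qed.

Lemma nbhs_eq_continuous (T U : topologicalType) (x : T) (f g : T -> U) :
  (\forall y \near x, g y = f y) -> {for x, continuous f} -> {for x, continuous g}.
Proof.
move=> fg cf; have gx : g x = f x := nbhs_singleton fg.
by rewrite /prop_for /continuous_at gx; exact: nbhs_eq_cvg fg cf.
Qed.

Section matrix_partials.
Context {R : realType} {p m n : nat}.
Implicit Types (g : 'cV[R]_p -> 'M[R]_(m, n)) (x : 'cV[R]_p).

Lemma mx_partial_entry g x (k : 'I_p) i j : derivable g x (delta_mx k 0) ->
  'D_(delta_mx k 0) g x i j = 'D_(delta_mx k 0) (fun y => g y i j) x.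
Proof. by move=> dg; rewrite derive_mx// mxE. Qed.

Section at_point.
Variables (g : 'cV[R]_p -> 'M[R]_(m, n)) (x : 'cV[R]_p).
Hypothesis dg : forall k, \forall y \near x, derivable g y (delta_mx k 0).
Hypothesis cg : forall k, {for x, continuous ('D_(delta_mx k 0) g)}.

Let dgij i j (k : 'I_p) : \forall y \near x,
  derivable (fun y => g y i j) y (delta_mx k 0).
Proof. by apply: filterS (dg k) => y /derivable_mxP. Qed.

Let cgij i j (k : 'I_p) :
  {for x, continuous ('D_(delta_mx k 0) (fun y => g y i j))}.
Proof.
have /(@cvg_mxP _ _ (nbhs x) (nbhs_filter x)) /(_ i j) := @cg k.
rewrite mx_partial_entry; last exact: (nbhs_singleton (dg k)).
apply: nbhs_eq_cvg; apply: filterS (dg k) => y dy.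
by rewrite mx_partial_entry.
Qed.

Lemma mx_continuous_of_partials : {for x, continuous g}.
Proof.
apply/(@cvg_mxP _ _ (nbhs x) (nbhs_filter x)) => i j.
exact: (continuous_of_partials (@dgij i j) (@cgij i j)).
Qed.

(** The direction [(eta - x) / rho] stays in the unit ball but need not converge; this is the reason
    why [dqm] admits a moving first-order term. *)
Lemma dqm_frechet (I : Type) (F : set_system I) {FF : Filter F}
    (rho : I -> R) (eta : I -> 'cV[R]_p) :
  (\forall i \near F, 0 < rho i /\ `|eta i - x| <= rho i) ->
  eta i @[i --> F] --> x ->
  dqm F rho (fun i => g (eta i)) (g x)
    (fun i => \sum_k ((rho i)^-1 *: (eta i - x)) k 0 *: 'D_(delta_mx k 0) g x).
Proof.
move=> rho_eta etax; split.
  apply: bddm_sum => k; apply: bddmZ; last exact: bddm_cst.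
  exists 1; apply: filterS rho_eta => i [r0 re]; rewrite mxE normrM.
  have r0' : 0 <= (rho i)^-1 by rewrite invr_ge0 ltW.
  rewrite (ger0_norm r0') mulrC ler_pdivrMr// mul1r.
  by rewrite (le_trans (mx_norm_ge _ _ _)).
move=> i j; rewrite mxE; apply/cvgr0Pnorm_le => e e0.
have := etax _ (frechet_of_partials (@dgij i j) (@cgij i j) e0).
rewrite nbhs_simpl /=; apply: filterS2 rho_eta => h [r0 re].
rewrite /= => gS.
set S : R := \sum_k (eta h - x) k 0 * 'D_(delta_mx k 0) (fun y => g y i j) x.
have -> : ((rho h)^-1 *: (g (eta h) - g x)
    - \sum_k ((rho h)^-1 *: (eta h - x)) k 0 *: 'D_(delta_mx k 0) g x) i j
    = (rho h)^-1 * (g (eta h) i j - g x i j - S).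
  rewrite !mxE [RHS]mulrBr summxE mulr_sumr; congr (_ - _).
  apply: eq_bigr => k _.
  rewrite 2!mxE mx_partial_entry ?mulrA//; exact: (nbhs_singleton (dg k)).
have r0' : 0 <= (rho h)^-1 by rewrite invr_ge0 ltW.
rewrite normrM (ger0_norm r0') mulrC ler_pdivrMr//.
by rewrite (le_trans gS)// ler_wpM2l// ltW.
Qed.

End at_point.
End matrix_partials.

Section C2.
Context {R : realType} {p n : nat}.
Variables (Om : set 'cV[R]_p) (P : 'cV[R]_p -> 'M[R]_n).
Hypothesis (oOm : open Om) (C2P : C2_on Om P).

Lemma C2_near x : Om x -> \forall y \near x, Om y.
Proof. by move=> Omx; apply: open_nbhs_nbhs; split. Qed.

Lemma C2_derivable x (k : 'I_p) : Om x -> derivable P x (delta_mx k 0).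
Proof. by move=> Omx; have [] := C2P Omx k k. Qed.

Lemma C2_near_derivable x (k : 'I_p) : Om x ->
  \forall y \near x, derivable P y (delta_mx k 0).
Proof. by move=> /C2_near; apply: filterS => y; exact: C2_derivable. Qed.

Lemma C2_near_derivable2 x (k l : 'I_p) : Om x ->
  \forall y \near x, derivable (partial l P) y (delta_mx k 0).
Proof. by move=> /C2_near; apply: filterS => y Omy; have [] := C2P Omy k l. Qed.

Lemma C2_continuous_partial x (l : 'I_p) : Om x ->
  {for x, continuous (partial l P)}.
Proof.
move=> Omx; apply: mx_continuous_of_partials => k.
  exact: C2_near_derivable2.
by have [] := C2P Omx k l.
Qed.

Lemma C2_continuous x : Om x -> {for x, continuous P}.
Proof.
move=> Omx; apply: mx_continuous_of_partials => k; first exact: C2_near_derivable.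
exact: C2_continuous_partial.
Qed.

Lemma C2_dqm x (I : Type) (F : set_system I) {FF : Filter F}
    (rho : I -> R) (eta : I -> 'cV[R]_p) : Om x ->
  (\forall i \near F, 0 < rho i /\ `|eta i - x| <= rho i) ->
  eta i @[i --> F] --> x ->
  dqm F rho (fun i => P (eta i)) (P x)
    (fun i => \sum_k ((rho i)^-1 *: (eta i - x)) k 0 *: partial k P x).
Proof.
move=> Omx; apply: dqm_frechet => k; first exact: C2_near_derivable.
exact: C2_continuous_partial.
Qed.

Lemma C2_dqm_partial x (l : 'I_p) (I : Type) (F : set_system I) {FF : Filter F}
    (rho : I -> R) (eta : I -> 'cV[R]_p) : Om x ->
  (\forall i \near F, 0 < rho i /\ `|eta i - x| <= rho i) ->
  eta i @[i --> F] --> x ->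
  dqm F rho (fun i => partial l P (eta i)) (partial l P x)
    (fun i => \sum_k ((rho i)^-1 *: (eta i - x)) k 0 *:
                     partial k (partial l P) x).
Proof.
move=> Omx; apply: dqm_frechet => k; first exact: C2_near_derivable2.
by have [] := C2P Omx k l.
Qed.

Lemma C2_schwarz x (k l : 'I_p) : Om x ->
  partial k (partial l P) x = partial l (partial k P) x.
Proof.
move=> Omx; apply/matrixP => i j.
pose f y := P y i j.
have fE (k1 : 'I_p) y : Om y -> 'D_(delta_mx k1 0) f y = partial k1 P y i j.
  by move=> Omy; rewrite /partial mx_partial_entry//; exact: C2_derivable.
have ffE (k1 k2 : 'I_p) y : Om y -> 'D_(delta_mx k2 0) ('D_(delta_mx k1 0) f) y
    = partial k2 (partial k1 P) y i j.
  move=> Omy; rewrite [RHS]mx_partial_entry; last by have [] := C2P Omy k2 k1.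
  apply: near_eq_derive; apply: filterS (C2_near Omy) => z; exact: fE.
have df (k1 : 'I_p) : \forall y \near x, derivable f y (delta_mx k1 0).
  apply: filterS (C2_near Omx) => y Omy.
  by have /derivable_mxP := @C2_derivable y k1 Omy; exact.
have ddf (k1 k2 : 'I_p) : \forall y \near x,
    derivable ('D_(delta_mx k1 0) f) y (delta_mx k2 0).
  apply: filterS (C2_near Omx) => y Omy.
  have [_ + _] := C2P Omy k2 k1 => /derivable_mxP /(_ i j).
  by apply: near_eq_derivable; apply: filterS (C2_near Omy) => z; move/fE => ->.
have cdf (k1 k2 : 'I_p) :
    {for x, continuous ('D_(delta_mx k2 0) ('D_(delta_mx k1 0) f))}.
  apply: (@nbhs_eq_continuous _ _ x (fun y => partial k2 (partial k1 P) y i j)).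
    by apply: filterS (C2_near Omx) => y /(ffE k1 k2 y).
  have [_ _] := C2P Omx k2 k1.
  by move=> /(@cvg_mxP _ _ (nbhs x) (nbhs_filter x)) /(_ i j).
refine (etrans (esym (ffE l k x Omx)) (etrans _ (ffE k l x Omx))).
exact: (@schwarz_derive R _ f x (delta_mx k 0) (delta_mx l 0) (df k) (df l)
  (ddf l k) (ddf k l) (@cdf l k) (@cdf k l)).
Qed.

Lemma C2_partial_tr x (k : 'I_p) : Om x -> (forall y, Om y -> (P y)^T = P y) ->
  (partial k P x)^T = partial k P x.
Proof.
move=> Omx PT; apply/matrixP => i j.
rewrite mxE /partial !mx_partial_entry; try exact: C2_derivable.
apply: near_eq_derive; apply: filterS (C2_near Omx) => y /PT PyT.
by rewrite -[in RHS]PyT mxE.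
Qed.

End C2.

(** * The gradient of the cost *)

(** Fermat's rule. If [L] were nonzero, all quotients close to the limit would have its strict sign,
    whereas those at [e / 2] and [- (e / 2)] have opposite weak signs. *)
Lemma cvg_quotient_min_eq0 {R : realType} (phi : R -> R) (L : R) :
  (\forall h \near (0 : R), phi 0 <= phi h) ->
  (h^-1 * (phi h - phi 0)) @[h --> (0 : R)^'] --> L -> L = 0.
Proof.
move=> phi_min /cvgrPdist_lt cL; apply/eqP/negPn/negP => L0.
have nL : 0 < `|L| by rewrite normr_gt0.
have : \forall h \near (0 : R)^', phi 0 <= phi h /\
    `|L - h^-1 * (phi h - phi 0)| < `|L|.
  near=> h; split; near: h; last exact: cL.
  exact: nbhs_dnbhs.
move=> /nbhs_ballP[e /= e0 eh].
have pick (h : R) : `|h| = e / 2 -> h != 0 /\ ball (0 : R) e h.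
  move=> he; split; first by rewrite -normr_gt0 he divr_gt0.
  by rewrite -ball_normE /ball_ /= sub0r normrN he gtr_pMr// invf_lt1// ltr1n.
have e20 : 0 < e / 2 by rewrite divr_gt0.
have [hN0 bh] := pick (e / 2) (gtr0_norm e20).
have [hN0' bh'] := pick (- (e / 2)) (etrans (normrN _) (gtr0_norm e20)).
have [m1 q1] := eh _ bh hN0; have [m2 q2] := eh _ bh' hN0'.
have s1 : 0 <= (e / 2)^-1 * (phi (e / 2) - phi 0).
  by rewrite mulr_ge0 ?subr_ge0// invr_ge0 ltW.
have s2 : (- (e / 2))^-1 * (phi (- (e / 2)) - phi 0) <= 0.
  by rewrite invrN mulNr oppr_le0 mulr_ge0 ?subr_ge0// invr_ge0 ltW.
move: q1 q2 s1 s2; set a := _ * _; set b := _ * (phi (- _) - _).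
by case: (ltrgt0P L) L0 nL => // L0 _ nL; rewrite !ltr_norml; lra.
Unshelve. all: by end_near. Qed.

Section gradient.
Context {R : realType} {p n : nat}.
Variables (sigma : R) (Om : set 'cV[R]_p) (P : 'cV[R]_p -> 'M[R]_n).
Hypothesis (oOm : open Om) (C2P : C2_on Om P).
Hypothesis pP : forall eta, Om eta -> posdef (P eta).

(* The derivative of [Gcost] when [P] moves with velocity [P1]. *)
Definition Ggrad (B D : 'M[R]_n) (t : 'cV[R]_n) (P0 P1 : 'M[R]_n) : R :=
  let M := invmx (P0 + D) in
  2 * sigma ^+ 4 * (bform t (M *m B *m - (M *m P1 *m M)) t
                    - \tr (B *m - (M *m P1 *m M))).

Lemma Gcost_quotient B D t eta (k : 'I_p) : Om eta -> posdef (P eta + D) ->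
  B^T = B ->
  (h^-1 * (Gcost sigma B D t (P (h *: delta_mx k 0 + eta))
           - Gcost sigma B D t (P eta))) @[h --> (0 : R)^'] -->
  Ggrad B D t (P eta) (partial k P eta).
Proof.
move=> Ome pPD BT.
set M := invmx (P eta + D); set P1 := partial k P eta.
pose F := (0 : R)^'.
have rhoN0 : \forall h \near F, (id h : R) != 0 by exact: dnbhs0_neq0.
have rho0 : id h @[h --> F] --> (0 : R) by exact: dnbhs0_id.
have MT : M^T = M by apply: trmx_invmx; exact: posdef_tr pPD.
have P1T : P1^T = P1.
  by apply: (@C2_partial_tr _ _ _ Om P oOm C2P eta k Ome) => y /pP; exact: posdef_tr.
have dP : dqm F id (fun h => P (h *: delta_mx k 0 + eta)) (P eta) (fun=> P1).
  by apply: derivable_dqm; exact: (@C2_derivable _ _ _ Om P C2P eta k Ome).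
pose proof (dqmD dP (@dqm_cst _ _ F _ id _ _ D)) as dPD.
pose proof (dqm_invmx rho0 rhoN0 (posdef_unit pPD) dPD) as dM.
rewrite -/M in dM.
set M1 := - (M *m P1 *m M).
have {}dM : dqm F id (fun h => invmx (P (h *: delta_mx k 0 + eta) + D)) M (fun=> M1).
  by apply: dqm_eq1 dM => h; rewrite addr0.
have M1T : M1^T = M1.
  by rewrite /M1 linearN /= !trmx_mul MT P1T mulmxA.
pose proof (@dqm_cst _ _ F _ id _ _ B) as dB.
pose proof (@dqm_cst _ _ F _ id _ _ t) as dt.
have dMBM : dqm F id (fun h => invmx (P (h *: delta_mx k 0 + eta) + D) *m B *m
    invmx (P (h *: delta_mx k 0 + eta) + D)) (M *m B *m M)
    (fun=> (M1 *m B *m M) + M *m B *m M1).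
  apply: dqm_eq1 (dqmM rho0 rhoN0 (dqmM rho0 rhoN0 dM dB) dM) => h.
  by rewrite mulmx0 addr0.
pose proof (dqm_bform rho0 rhoN0 dt dMBM dt) as c1.
pose proof (dqm_mxtrace (dqmM rho0 rhoN0 dB dM)) as c2.
move: c1 c2; cbv beta => c1 c2.
have bfZ x y (A : 'M[R]_n) : bform 0 A y = 0 /\ bform x A 0 = 0.
  by rewrite /bform trmx0 !mul0mx mulmx0 mxE.
have bfD (A A' : 'M[R]_n) x y : bform x (A + A') y = bform x A y + bform x A' y.
  by rewrite /bform mulmxDr mulmxDl mxE.
(* The two product-rule terms are transposes of each other, hence equal as forms at [t]: this is the
   factor 2 in [Ggrad]. The zero vectors appear because [t] is constant here. *)
have E : Ggrad B D t (P eta) P1 =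
  sigma ^+ 4 * (bform 0 (M *m B *m M) t + bform t (M1 *m B *m M + M *m B *m M1) t
                + bform t (M *m B *m M) 0) - 2 * sigma ^+ 4 * \tr (B *m M1).
  rewrite (bfZ 0 t _).1 (bfZ t 0 _).2 bfD [X in _ + (X + _)]bform_tr !trmx_mul MT M1T BT.
  by rewrite mulmxA /Ggrad -/M -/M1; ring.
pose proof (cvgD (cvgM (cvg_cst (sigma ^+ 4)) c1)
   (cvgM (cvg_cst (- (2 * sigma ^+ 4))) c2)) as c3.
rewrite !mulr0 addr0 in c3.
pose proof (cvgD c3 (cvg_cst (Ggrad B D t (P eta) P1))) as c4.
rewrite add0r in c4; apply: cvg_trans c4; apply: near_eq_cvg; near=> h.
rewrite !fctE /= E mul0mx add0r /Gcost -/M.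
by ring.
Unshelve. all: by end_near. Qed.

Lemma Gcost_min_grad0 B D t eta (k : 'I_p) : Om eta -> posdef (P eta + D) ->
  B^T = B ->
  (forall y, Om y -> Gcost sigma B D t (P eta) <= Gcost sigma B D t (P y)) ->
  Ggrad B D t (P eta) (partial k P eta) = 0.
Proof.
move=> Ome pPD BT etamin.
pose phi h := Gcost sigma B D t (P (h *: delta_mx k 0 + eta)).
have phi0 : phi 0 = Gcost sigma B D t (P eta) by rewrite /phi scale0r add0r.
apply: (@cvg_quotient_min_eq0 _ phi).
  rewrite phi0.
  have : \forall h \near (0 : R), Om (h *: delta_mx k 0 + eta).
    have c : (h *: delta_mx k 0 + eta) @[h --> (0 : R)] --> eta.
      rewrite -[X in _ --> X]add0r -(scale0r (delta_mx k 0)).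
      by apply: cvgD; [apply: cvgZ; [exact: cvg_id|exact: cvg_cst]|exact: cvg_cst].
    exact: c _ (C2_near oOm Ome).
  by apply: filterS => h; exact: etamin.
by rewrite phi0; exact: Gcost_quotient.
Qed.

End gradient.

Section bform_linear.
Context {R : realType} {n : nat}.
Implicit Types (x y : 'cV[R]_n) (A : 'M[R]_n).

Lemma bformD x A A' y : bform x (A + A') y = bform x A y + bform x A' y.
Proof. by rewrite /bform mulmxDr mulmxDl mxE. Qed.

Lemma bformZ x c A y : bform x (c *: A) y = c * bform x A y.
Proof. by rewrite /bform -scalemxAr -scalemxAl mxE. Qed.

Lemma bformZl x c A y : bform (c *: x) A y = c * bform x A y.
Proof. by rewrite /bform linearZ /= -!scalemxAl mxE. Qed.

Lemma bformZr x c A y : bform x A (c *: y) = c * bform x A y.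
Proof. by rewrite /bform -scalemxAr mxE. Qed.

Lemma bform_sumZ (J : finType) (u : J -> R) (A : J -> 'M[R]_n) x y :
  bform x (\sum_j u j *: A j) y = \sum_j u j * bform x (A j) y.
Proof.
rewrite /bform mulmx_sumr mulmx_suml summxE; apply: eq_bigr => j _.
by rewrite -scalemxAr -scalemxAl mxE.
Qed.

Lemma mxtrace_sumZ (J : finType) (u : J -> R) (A : J -> 'M[R]_n) :
  \tr (\sum_j u j *: A j) = \sum_j u j * \tr (A j).
Proof. by rewrite raddf_sum /=; apply: eq_bigr => j _; rewrite mxtraceZ. Qed.

End bform_linear.

(** The left side is the first-order term of the [k]-th gradient component when the parameter moves
    by [u] and the least squares estimate by [v *: z]; the right side is row [k] of [C u + v L z].
    Here [A l] and [H l] stand for the first and mixed second partials of the inverse kernel.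
    Transposition merges the two terms in [z] into one symmetrized coefficient. *)
Lemma first_order_algebra {R : realType} {p n : nat} (th : 'cV[R]_n) (c : R)
  (M S : 'M[R]_n) (A : 'I_p -> 'M[R]_n) (H : 'I_p -> 'M[R]_n)
  (u : 'cV[R]_p) (v : R) (z : 'cV[R]_n) (k : 'I_p) :
  M^T = M -> S^T = S -> (A k)^T = A k ->
  c * (bform (v *: z) (M *m S *m A k) th
     + bform th ((\sum_l u l 0 *: A l) *m S *m A k
                     + M *m S *m (\sum_l u l 0 *: H l)) th
     + bform th (M *m S *m A k) (v *: z)
     - \tr (S *m (\sum_l u l 0 *: H l))) =
  \sum_l (c * (bform th (A l *m S *m A k) th + bform th (M *m S *m H l) th
    - \tr (S *m H l))) * u l 0
  + v * \sum_j (c * (th^T *m (M *m S *m A k + A k *m S *m M)) 0 j) * z j 0.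
Proof.
move=> MT ST AT.
have -> : \sum_j (c * (th^T *m (M *m S *m A k + A k *m S *m M)) 0 j) * z j 0 =
    c * (bform z (M *m S *m A k) th + bform th (M *m S *m A k) z).
  rewrite [X in _ = _ * (X + _)]bform_tr !trmx_mul MT ST AT mulmxA -bformD.
  rewrite [A k *m _ *m _ + _]addrC /bform [in RHS]mxE mulr_sumr.
  by apply: eq_bigr => l _; rewrite mulrA.
rewrite !mulmx_suml !mulmx_sumr.
under [X in bform _ (X + _) _]eq_bigr do rewrite -!scalemxAl.
under [X in bform _ (_ + X) _]eq_bigr do rewrite -scalemxAr.
under [X in \tr X]eq_bigr do rewrite -scalemxAr.
rewrite bformD !bform_sumZ mxtrace_sumZ bformZl bformZr.
set b1 := bform z _ _; set b2 := bform _ _ z.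
have -> : \sum_l (c * (bform th (A l *m S *m A k) th + bform th (M *m S *m H l) th
    - \tr (S *m H l))) * u l 0 = c *
   (\sum_l u l 0 * bform th (A l *m S *m A k) th +
    \sum_l u l 0 * bform th (M *m S *m H l) th -
    \sum_l u l 0 * \tr (S *m H l)).
  rewrite -sumrN -!big_split /= mulr_sumr; apply: eq_bigr => l _.
  by ring.
by ring.
Qed.

(** * Partial derivatives of the inverse kernel matrix *)

Section inverse_partials.
Context {R : realType} {p n : nat}.
Variables (Om : set 'cV[R]_p) (P : 'cV[R]_p -> 'M[R]_n).
Hypothesis (oOm : open Om) (C2P : C2_on Om P).
Hypothesis pP : forall eta, Om eta -> posdef (P eta).

Local Notation Pinv := (fun eta => invmx (P eta)).
Let F := (0 : R)^'.
Let rho0 : id h @[h --> F] --> (0 : R). Proof. exact: dnbhs0_id. Qed.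
Let rhoN0 : \forall h \near F, (id h : R) != 0. Proof. exact: dnbhs0_neq0. Qed.

Let dPinv eta (k : 'I_p) : Om eta ->
  dqm F id (fun h => invmx (P (h *: delta_mx k 0 + eta))) (invmx (P eta))
    (fun=> - (invmx (P eta) *m partial k P eta *m invmx (P eta))).
Proof.
move=> Ome; apply: (dqm_invmx rho0 rhoN0); first exact/posdef_unit/pP.
by apply: derivable_dqm; exact: (@C2_derivable _ _ _ Om P C2P eta k Ome).
Qed.

Lemma partial_invmx eta (k : 'I_p) : Om eta ->
  partial k Pinv eta = - (invmx (P eta) *m partial k P eta *m invmx (P eta)).
Proof. by move=> Ome; have [] := @dqm_derivable _ _ _ _ Pinv _ _ _ (@dPinv eta k Ome). Qed.

Lemma partial2_invmx eta (k l : 'I_p) : Om eta ->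
  partial k (partial l Pinv) eta =
  - (partial k Pinv eta *m partial l P eta *m invmx (P eta)
     + invmx (P eta) *m partial k (partial l P) eta *m invmx (P eta)
     + invmx (P eta) *m partial l P eta *m partial k Pinv eta).
Proof.
move=> Ome.
pose g y := - (invmx (P y) *m partial l P y *m invmx (P y)).
have -> : partial k (partial l Pinv) eta = partial k g eta.
  apply: near_eq_derive; apply: filterS (C2_near oOm Ome) => y.
  exact: partial_invmx.
have dPl : dqm F id (fun h => partial l P (h *: delta_mx k 0 + eta))
    (partial l P eta) (fun=> partial k (partial l P) eta).
  by apply: derivable_dqm; have [] := C2P Ome k l.
have dPi := @dPinv eta k Ome; rewrite -(partial_invmx k Ome) in dPi.
pose proof (dqmN (dqmM rho0 rhoN0 (dqmM rho0 rhoN0 dPi dPl) dPi)) as dg.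
have [_ E] := @dqm_derivable _ _ _ _ g _ _ _ dg; rewrite /partial E.
by rewrite mulmxDl.
Qed.

(** [C_y] fixes one order of the two differentiations, while expanding the gradient produces the
    other. Exchanging [k] and [l] swaps the two outer terms of [partial2_invmx], and the middle one
    is symmetric by [C2_schwarz]. *)
Lemma partial2_invmxC eta (k l : 'I_p) : Om eta ->
  partial k (partial l Pinv) eta = partial l (partial k Pinv) eta.
Proof.
move=> Ome.
refine (etrans (partial2_invmx k l Ome) (etrans _ (esym (partial2_invmx l k Ome)))).
move: (partial k (partial l P) eta) (partial l (partial k P) eta)
  (@C2_schwarz _ _ _ Om P oOm C2P eta k l Ome) => Q _ <-.
move: (partial k Pinv eta) (partial l Pinv eta) (partial_invmx k Ome)
  (partial_invmx l Ome) => A B -> ->.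
move: (partial k P eta) (partial l P eta) (invmx (P eta)) => {A B} Pk Pl M.
rewrite !mulNmx !mulmxN !mulmxA.
move: (M *m Pk *m M *m Pl *m M) (M *m Pl *m M *m Pk *m M) (M *m Q *m M) => X Z Y.
by rewrite (addrC (- X + Y)) (addrC (- X)) addrA.
Qed.

End inverse_partials.

Section delta_method.
Context {R : realType} {p n : nat}.
Variables (theta0 : 'cV[R]_n) (sigma : R) (Sigma : 'M[R]_n).
Variables (Om : set 'cV[R]_p) (P : 'cV[R]_p -> 'M[R]_n) (eta_y : 'cV[R]_p).
Hypothesis pSigma : posdef Sigma.
Hypothesis (oOm : open Om) (C2P : C2_on Om P).
Hypothesis pP : forall eta, Om eta -> posdef (P eta).
Hypothesis eta_y_min : argmin_on Om (W_y theta0 sigma Sigma P) eta_y.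
Local Notation C := (C_y theta0 sigma Sigma P eta_y).
Hypothesis uC : C \in unitmx.

Local Notation Pinv := (fun eta => invmx (P eta)).
Let Pi := invmx (P eta_y).
Let Si := invmx Sigma.
Let Pik k := partial k Pinv eta_y.
Let Pikl k l := partial k (partial l Pinv) eta_y.

(* Derivative with respect to t, at theta0, of the gradient of [Gcost] at eta_y. *)
Definition score_mx : 'M[R]_(p, n) := \matrix_(k, j)
  (2 * sigma ^+ 4 * (theta0^T *m (Pi *m Si *m Pik k + Pik k *m Si *m Pi)) 0 j).

Let Ome : Om eta_y. Proof. by case: eta_y_min. Qed.

Lemma Ggrad_eta_y k : Ggrad sigma Si 0 theta0 (P eta_y) (partial k P eta_y) = 0.
Proof.
apply: (@Gcost_min_grad0 _ _ _ sigma Om P oOm C2P pP Si 0 theta0 eta_y k Ome).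
  by rewrite addr0; exact: pP.
  exact/posdef_tr/posdef_invmx.
move=> y Omy; rewrite -!W_yE; [|exact: pP|exact: pP].
by case: eta_y_min => _; exact.
Qed.

Let PiT : Pi^T = Pi.
Proof. by apply: trmx_invmx; exact/posdef_tr/pP. Qed.

Let SiT : Si^T = Si.
Proof. exact/posdef_tr/posdef_invmx. Qed.

Let PikT k : (Pik k)^T = Pik k.
Proof.
rewrite /Pik (partial_invmx C2P pP k Ome) linearN /= !trmx_mul -/Pi PiT.
rewrite (@C2_partial_tr _ _ _ Om P oOm C2P eta_y k Ome) ?mulmxA// => y /pP.
exact: posdef_tr.
Qed.

Lemma first_order_Ggrad (u : 'cV[R]_p) (v : R) (z : 'cV[R]_n) (k : 'I_p) :
  2 * sigma ^+ 4 *
    (bform (v *: z) (Pi *m Si *m Pik k) theta0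
     + bform theta0 ((\sum_l u l 0 *: Pik l) *m Si *m Pik k
                     + Pi *m Si *m (\sum_l u l 0 *: Pikl l k)) theta0
     + bform theta0 (Pi *m Si *m Pik k) (v *: z)
     - \tr (Si *m (\sum_l u l 0 *: Pikl l k))) =
  (C *m u + v *: (score_mx *m z)) k 0.
Proof.
rewrite [RHS]mxE [X in _ = X + _]mxE [X in _ = _ + X]mxE [X in _ = _ + _ * X]mxE.
refine (etrans (@first_order_algebra _ _ _ _ _ _ _ _ (fun l => Pikl l k) _ _ _ k
  PiT SiT (PikT k)) _).
congr (_ + _ * _); apply: eq_bigr => l _; last by rewrite [in RHS]mxE.
rewrite [in RHS]mxE.
by rewrite /Pikl -(partial2_invmxC oOm C2P pP k l Ome).
Qed.

End delta_method.

(** * Expansion of the minimizer *)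

Lemma cvgm_scale_bdd0 {R : realType} {I : Type} (F : set_system I) {FF : Filter F}
  m n (c : I -> R) (q : I -> 'M[R]_(m, n)) :
  (exists M : R, \forall i \near F, `|c i| <= M) -> cvgm F q 0 ->
  cvgm F (fun i => c i *: q i) 0.
Proof.
move=> cb q0 i j; rewrite mxE; under eq_cvg do rewrite mxE.
by apply: cvg_bdd_mul0 => //; have := q0 i j; rewrite mxE.
Qed.

Section delta_expansion.
Context {R : realType} {p n : nat}.
Variables (theta0 : 'cV[R]_n) (sigma : R) (Sigma : 'M[R]_n).
Variables (Om : set 'cV[R]_p) (P : 'cV[R]_p -> 'M[R]_n) (eta_y : 'cV[R]_p).
Hypothesis pSigma : posdef Sigma.
Hypothesis (oOm : open Om) (C2P : C2_on Om P).
Hypothesis pP : forall eta, Om eta -> posdef (P eta).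
Hypothesis eta_y_min : argmin_on Om (W_y theta0 sigma Sigma P) eta_y.
Local Notation C := (C_y theta0 sigma Sigma P eta_y).
Hypothesis uC : C \in unitmx.
Local Notation L := (score_mx theta0 sigma Sigma P eta_y).
Local Notation Pinv := (fun eta => invmx (P eta)).

Context {I : Type} (F : set_system I) {FF : Filter F}.
Variables (s : I -> R) (A : I -> 'M[R]_n) (eta : I -> 'cV[R]_p) (z : I -> 'cV[R]_n).
Hypothesis s_gt0 : \forall i \near F, 0 < s i.
Hypothesis s_cvg0 : s i @[i --> F] --> (0 : R).
Hypothesis A_rate : cvgm F (fun i => (s i)^-1 *: (A i - Sigma)) 0.
Hypothesis eta_cvg : eta i @[i --> F] --> eta_y.
Hypothesis z_bdd : bddm F z.

Let Ome : Om eta_y. Proof. by case: eta_y_min. Qed.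
(** With this scale both [u = (eta - eta_y) / rho] and [v = s / rho] are bounded although no rate is
    known for [eta]. The identity [|u| + v = 1] later recovers the rate [s]. *)
Let rho i := `|eta i - eta_y| + s i.

Let rho_gt0 : \forall i \near F, 0 < rho i.
Proof. by apply: filterS s_gt0 => i si; rewrite /rho ltr_wpDl. Qed.

Let rhoN0 : \forall i \near F, rho i != 0.
Proof. by apply: filterS rho_gt0 => i; rewrite lt0r => /andP[]. Qed.

Let rho0 : rho i @[i --> F] --> (0 : R).
Proof.
rewrite -[X in _ --> X]addr0; apply: cvgD => //.
have -> : (0 : R) = `|eta_y - eta_y| by rewrite subrr normr0.
by apply: cvg_norm; apply: cvgB => //; exact: cvg_cst.
Qed.

Let v i := (rho i)^-1 * s i.

Let v_bdd : exists M : R, \forall i \near F, `|v i| <= M.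
Proof.
exists 1; apply: filterS2 rho_gt0 s_gt0 => i r0 si.
rewrite /v ger0_norm; last by rewrite mulr_ge0 ?invr_ge0// ltW.
by rewrite mulrC ler_pdivrMr// mul1r /rho lerDr.
Qed.

(** The design error is [o(s)] and [s <= rho], so it leaves no first-order term; in [dD] the reason
    is the factor [s^2]. *)
Let dA : dqm F rho A Sigma (fun=> 0).
Proof.
split; first exact: bddm_cst.
apply: (near_eq_cvgm _ (cvgm_scale_bdd0 v_bdd A_rate)).
apply: filterS s_gt0 => i si; rewrite subr0 scalerA /v -mulrA mulfV ?mulr1//.
by rewrite gt_eqF.
Qed.

Let B i := invmx (A i).
Let D i := (s i ^+ 2 * sigma ^+ 2) *: B i.
Let t i := theta0 + s i *: z i.
Let uS := posdef_unit pSigma.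
Let Pi := invmx (P eta_y).
Let Si := invmx Sigma.
Let u i := (rho i)^-1 *: (eta i - eta_y).
Let Pik k := partial k Pinv eta_y.
Let Pikl k l := partial k (partial l Pinv) eta_y.

Let dB : dqm F rho B Si (fun=> 0).
Proof.
pose proof (dqm_invmx rho0 rhoN0 uS dA) as H.
by apply: dqm_eq1 H => i; rewrite mulmx0 mul0mx oppr0.
Qed.

Let dD : dqm F rho D 0 (fun=> 0).
Proof.
split; first exact: bddm_cst.
have c : cvgm F (fun i => (s i * sigma ^+ 2) *: B i) 0.
  rewrite -(scale0r Si); apply: cvgmZ; last exact: dqm_cvgm dB.
  by rewrite -[X in _ --> X](mul0r (sigma ^+ 2)); apply: cvgM => //; exact: cvg_cst.
apply: (near_eq_cvgm _ (cvgm_scale_bdd0 v_bdd c)).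
by near=> i; rewrite !subr0 /D !scalerA /v; congr (_ *: _); ring.
Unshelve. all: by end_near. Qed.

Let dt : dqm F rho t theta0 (fun i => v i *: z i).
Proof.
split; first exact: bddmZ.
apply: (@near_eq_cvgm _ _ F _ _ _ _ (fun=> 0)); last exact: cvgm_cst.
by near=> i; rewrite /t [theta0 + _]addrC addrK scalerA subrr.
Unshelve. all: by end_near. Qed.

Let rho_eta : \forall i \near F, 0 < rho i /\ `|eta i - eta_y| <= rho i.
Proof.
by apply: filterS2 rho_gt0 s_gt0 => i r0 si; split => //; rewrite /rho lerDl ltW.
Qed.

Let dM : dqm F rho (fun i => invmx (P (eta i) + D i)) Pi
  (fun i => \sum_l u i l 0 *: Pik l).
Proof.
pose proof (dqmD (C2_dqm oOm C2P Ome rho_eta eta_cvg) dD) as H.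
rewrite addr0 in H.
pose proof (dqm_invmx rho0 rhoN0 (posdef_unit (pP Ome)) H) as H2.
apply: dqm_eq1 H2 => i; rewrite addr0 mulmx_sumr mulmx_suml -sumrN.
apply: eq_bigr => l _; rewrite /Pik (partial_invmx C2P pP l Ome).
by rewrite scalerN -scalemxAr -scalemxAl.
Qed.

Let dMk k : dqm F rho (fun i => - (invmx (P (eta i) + D i) *m partial k P (eta i)
      *m invmx (P (eta i) + D i))) (Pik k)
  (fun i => \sum_l u i l 0 *: Pikl l k).
Proof.
pose proof (C2_dqm_partial oOm C2P k Ome rho_eta eta_cvg) as H.
pose proof (dqmN (dqmM rho0 rhoN0 (dqmM rho0 rhoN0 dM H) dM)) as H2.
rewrite /Pik (partial_invmx C2P pP k Ome).
apply: dqm_eq1 H2 => i.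
rewrite -/Pi mulmx_suml mulmx_sumr -big_split /= mulmx_suml mulmx_sumr.
rewrite -big_split /= -sumrN; apply: eq_bigr => l _.
rewrite /Pikl (partial2_invmx oOm C2P pP l k Ome) -/Pi -/(Pik l) -/(u i).
move: (Pik l) (partial k P eta_y) (partial l (partial k P) eta_y) (u i l 0) => X Y Z c.
by rewrite -!scalemxAl -!scalemxAr -scalerDr -!scalemxAl -scalerDr mulmxDl scalerN.
Qed.

Hypothesis grad0 : \forall i \near F, forall k,
  Ggrad sigma (B i) (D i) (t i) (P (eta i)) (partial k P (eta i)) = 0.

(** The perturbed gradient vanishes at [eta i] and the limiting one at [eta_y], so the first-order
    term of their difference must itself tend to 0. *)
Lemma linearized_grad_cvg0 : cvgm F (fun i => C *m u i + v i *: (L *m z i)) 0.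
Proof.
move=> k j; rewrite ord1 {j} mxE.
pose proof (dqm_bform rho0 rhoN0 dt (dqmM rho0 rhoN0 (dqmM rho0 rhoN0 dM dB) (dMk k)) dt) as c1.
pose proof (dqm_mxtrace (dqmM rho0 rhoN0 dB (dMk k))) as c2.
pose proof (cvgM (cvg_cst (2 * sigma ^+ 4)) (cvgB c1 c2)) as c3.
rewrite subrr mulr0 in c3.
pose proof (cvgN c3) as c4; rewrite oppr0 in c4.
apply: cvg_trans c4; apply: near_eq_cvg.
apply: filterS grad0 => i /(_ k) g0.
have gy : 2 * sigma ^+ 4 * (bform theta0 (Pi *m Si *m Pik k) theta0
    - \tr (Si *m Pik k)) = 0.
  have := Ggrad_eta_y pSigma oOm C2P pP eta_y_min k.
  by rewrite /Ggrad addr0 /Pik (partial_invmx C2P pP k Ome).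
have fo : 2 * sigma ^+ 4 *
    (bform (v i *: z i) (Pi *m Si *m Pik k) theta0
     + bform theta0 ((\sum_l u i l 0 *: Pik l) *m Si *m Pik k
                     + Pi *m Si *m (\sum_l u i l 0 *: Pikl l k)) theta0
     + bform theta0 (Pi *m Si *m Pik k) (v i *: z i)
     - \tr (Si *m (\sum_l u i l 0 *: Pikl l k)))
    = (C *m u i + v i *: (L *m z i)) k 0.
  exact: (first_order_Ggrad pSigma oOm C2P pP eta_y_min (u i) (v i) (z i) k).
rewrite !fctE /= mulmx0 addr0 mul0mx add0r; refine (etrans _ fo) => {fo}.
rewrite /Ggrad in g0; move: g0 gy.
move: (bform theta0 (Pi *m Si *m Pik k) theta0) (\tr (Si *m Pik k)) => X0 Y0.
move: (bform (t i) _ (t i)) (\tr (B i *m _)) => X Y.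
move: (bform (v i *: z i) _ _) (bform theta0 _ (v i *: z i)) => E1 E2.
move: (bform theta0 _ theta0) (\tr _) => E3 E4.
move: (2 * sigma ^+ 4) => c g0 gy.
transitivity (c * (E1 + E3 + E2 - E4) - (rho i)^-1 * (c * (X - Y))
   + (rho i)^-1 * (c * (X0 - Y0))); first by ring.
by rewrite g0 gy; ring.
Qed.

(** Multiplying by the inverse of [C] gives [u + v w = o(1)] with [w] bounded. Since [|u| + v = 1],
    a small [v] would make [u] small as well, a contradiction; so [v] is bounded away from 0 and
    dividing by it changes the scale from [rho] to [s]. *)
Lemma delta_expansion :
  cvgm F (fun i => (s i)^-1 *: (eta i - eta_y) + invmx C *m (L *m z i)) 0.
Proof.
pose w i := invmx C *m (L *m z i).
pose r i := u i + v i *: w i.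
have r0 : cvgm F r 0.
  pose proof (cvgmM (@cvgm_cst _ _ F _ _ _ (invmx C)) linearized_grad_cvg0) as H.
  rewrite mulmx0 in H; apply: (near_eq_cvgm _ H); near=> i.
  by rewrite /r /w mulmxDr mulKmx// -scalemxAr.
have wb : bddm F w.
  apply: bddmM; first exact: bddm_cst.
  by apply: bddmM => //; exact: bddm_cst.
have [M wM] := wb.
have M0 : 0 < `|M| + 1 by rewrite ltr_wpDl.
have vinv : exists K : R, \forall i \near F, `|(v i)^-1| <= K.
  (* From [1 = |u| + v <= 1/2 + v (|M| + 1) + v]. *)
  exists (2 * (`|M| + 1 + 1)).
  have rs : \forall i \near F, `|r i| <= 2^-1.
    have /cvg_mxP /cvgr0Pnorm_le := r0; apply.
    by rewrite invr_gt0.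
  near=> i.
  have s0 : 0 < s i by near: i.
  have rh0 : 0 < rho i by near: i.
  have v0 : 0 < v i by rewrite /v mulr_gt0// invr_gt0.
  rewrite gtr0_norm ?invr_gt0// -[leLHS]mul1r ler_pdivrMr//.
  have uv : `|u i| + v i = 1.
    by rewrite /u /v normrZ gtr0_norm ?invr_gt0// -mulrDr mulVf// gt_eqF.
  have wi : `|w i| <= `|M| + 1.
    apply: mx_norm_le; first exact: ltW.
    move=> a b; have : forall a b, `|w i a b| <= M by near: i.
    by move=> /(_ a b) /le_trans; apply; rewrite (le_trans (ler_norm M))// lerDl.
  have ui : `|u i| <= `|r i| + v i * `|w i|.
    have -> : u i = r i - v i *: w i by rewrite /r addrK.
    by rewrite (le_trans (ler_normB _ _))// normrZ (gtr0_norm v0).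
  have ri : `|r i| <= 2^-1 by near: i.
  have vw : v i * `|w i| <= v i * (`|M| + 1) by rewrite ler_wpM2l// ltW.
  by lra.
apply: (near_eq_cvgm _ (cvgm_scale_bdd0 vinv r0)).
near=> i.
have s0 : 0 < s i by near: i.
have rh0 : 0 < rho i by near: i.
rewrite [RHS]scalerDr /v /u !scalerA /w.
have -> : ((rho i)^-1 * s i)^-1 * (rho i)^-1 = (s i)^-1.
  by field; rewrite !gt_eqF.
by rewrite mulVf ?scale1r// mulf_neq0 ?invr_eq0// gt_eqF.
Unshelve. all: by end_near. Qed.

End delta_expansion.

Lemma cvg_Gcost {R : realType} {n : nat} (sigma : R) (I : Type) (F : set_system I)
    {FF : Filter F} (B D Q : I -> 'M[R]_n) (t : I -> 'cV[R]_n) B0 D0 t0 Q0 :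
  cvgm F B B0 -> cvgm F D D0 -> cvgm F t t0 -> cvgm F Q Q0 -> Q0 + D0 \in unitmx ->
  Gcost sigma (B i) (D i) (t i) (Q i) @[i --> F] --> Gcost sigma B0 D0 t0 Q0.
Proof.
move=> BB0 DD0 tt0 QQ0 uQ.
have cM : cvgm F (fun i => invmx (Q i + D i)) (invmx (Q0 + D0)).
  by apply: cvgm_invmx => //; exact: cvgmD.
apply: cvgB.
  apply: cvgM; first exact: cvg_cst.
  by apply: cvgm_bform => //; apply: cvgmM => //; exact: cvgmM.
apply: cvgM; first exact: cvg_cst.
by apply: cvgm_mxtrace; exact: cvgmM.
Qed.

(** * Consistency of the minimizer *)

Section consistency.
Context {R : realType} {p n : nat}.
Variables (theta0 : 'cV[R]_n) (sigma : R) (Sigma : 'M[R]_n).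
Variables (Om : set 'cV[R]_p) (P : 'cV[R]_p -> 'M[R]_n) (eta_y : 'cV[R]_p).
Hypothesis (oOm : open Om) (C2P : C2_on Om P).
Hypothesis pP : forall eta, Om eta -> posdef (P eta).
Hypothesis eta_y_min : argmin_on Om (W_y theta0 sigma Sigma P) eta_y.
Variables (K U : set 'cV[R]_p).
Hypothesis (cK : compact K) (KOm : K `<=` Om).
Hypothesis K_min : K `&` argmin_on Om (W_y theta0 sigma Sigma P) `<=` [set eta_y].
Hypothesis (oU : open U) (Uy : U eta_y).

(** A point of [K] outside [U] has a strictly larger limit cost than [eta_y], since equality would
    make it a second minimizer in [K]. Joint continuity in the parameter and the perturbation keeps
    the strict inequality nearby, and compactness makes it uniform over [K]. *)
Lemma near_Gcost_gt (I : Type) (F : set_system I) {FF : Filter F}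
    (B D : I -> 'M[R]_n) (t : I -> 'cV[R]_n) :
  cvgm F B (invmx Sigma) -> cvgm F D 0 -> cvgm F t theta0 ->
  \forall i \near F, forall eta, K eta -> ~ U eta ->
    Gcost sigma (B i) (D i) (t i) (P eta_y) < Gcost sigma (B i) (D i) (t i) (P eta).
Proof.
move=> cB cD ct.
have [Omy ymin] := eta_y_min.
have /compact_near_coveringP ncK := cK.
pose Q i eta := ~ U eta -> Gcost sigma (B i) (D i) (t i) (P eta_y) <
  Gcost sigma (B i) (D i) (t i) (P eta).
have : \near F, K `<=` Q F.
  apply: ncK => x Kx; have Omx := KOm Kx.
  have [Ux|nUx] := pselect (U x).
    have xU : nbhs x U by apply: open_nbhs_nbhs; split.
    exists (U, setT); first by split => //; exact: filterT.
    by move=> [y i] /= [Uy' _] /(_ Uy').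
  have Wlt : W_y theta0 sigma Sigma P eta_y < W_y theta0 sigma Sigma P x.
    rewrite lt_neqAle ymin// andbT; apply/eqP => Wxy.
    have : x = eta_y by apply: K_min; split => //; split => // y; rewrite -Wxy; exact: ymin.
    by move=> xy; apply: nUx; rewrite xy.
  rewrite !W_yE in Wlt; [|exact: pP|exact: pP].
  pose FX := filter_prod (nbhs x) F.
  have FFX : Filter FX by exact: filter_prod_filter.
  have lift m q (f : I -> 'M[R]_(m, q)) f0 :
      cvgm F f f0 -> cvgm FX (fun z => f z.2) f0.
    by move=> cf i j; exact: (cvg_comp _ _ cvg_snd (cf i j)).
  have cP : cvgm FX (fun z => P z.1) (P x).
    have /(@cvg_mxP _ _ (nbhs x) (nbhs_filter x)) cPx := C2_continuous oOm C2P Omx.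
    by move=> i j; exact: (cvg_comp _ _ cvg_fst (cPx i j)).
  have uy : P eta_y + 0 \in unitmx by rewrite addr0; exact/posdef_unit/pP.
  have ux : P x + 0 \in unitmx by rewrite addr0; exact/posdef_unit/pP.
  have c1 := @cvg_Gcost _ _ sigma _ FX _ _ _ (fun=> P eta_y) _ _ _ _ _
    (lift _ _ _ _ cB) (lift _ _ _ _ cD) (lift _ _ _ _ ct) (@cvgm_cst _ _ FX FFX _ _ (P eta_y)) uy.
  have c2 := @cvg_Gcost _ _ sigma _ FX _ _ _ _ _ _ _ _ _
    (lift _ _ _ _ cB) (lift _ _ _ _ cD) (lift _ _ _ _ ct) cP ux.
  pose proof (cvgB (c2 FFX) (c1 FFX)) as c3.
  have pos : 0 < Gcost sigma (invmx Sigma) 0 theta0 (P x)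
      - Gcost sigma (invmx Sigma) 0 theta0 (P eta_y) by rewrite subr_gt0.
  pose proof (@cvgr_gt R _ FX FFX _ _ c3 0 pos) as near_pos.
  change (FX (fun z => Q z.2 z.1)).
  by apply: filterS near_pos => z; rewrite !fctE subr_gt0 => zlt _.
by apply: filterS => i KQ eta Keta; exact: KQ.
Qed.

End consistency.

(** * Borel sets of matrices *)

Section borel_matrices.
Context {R : realType}.

Lemma measurable_random_matrix_ball {d} {T : measurableType d} m n
  (X : T -> 'M[R]_(m, n)) (A : 'M[R]_(m, n)) (e : R) : 0 < e -> random_matrix X ->
  measurable (X @^-1` ball A e).
Proof.
move=> e0 mX.
have -> : X @^-1` ball A e = \bigcap_(ij in [set: 'I_m * 'I_n])
    [set w | `|A ij.1 ij.2 - X w ij.1 ij.2| < e].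
  apply/seteqP; split=> [w [_ Aw] ij _ /=|w Aw]; first exact: (Aw ij.1 ij.2).
  by split => // i j; exact: (Aw (i, j) I).
apply: fin_bigcap_measurable => // -[i j] _ /=.
rewrite -[X in measurable X]setTI.
have mf : measurable_fun setT (fun w => `|A i j - X w i j| < e).
  apply: measurable_fun_ltr; last exact: measurable_cst.
  apply: (measurableT_comp (f := @Num.Def.normr R R)) => //.
  by apply: measurable_funB; [exact: measurable_cst|exact: mX].
by have := mf measurableT [set true] I; rewrite !setTI.
Qed.

(** Balls with rational centres and radii [1 / k.+1] form a countable base, so that Borel
    measurability can be tested on balls. *)
Lemma open_mx_bigcup_rat m n (U : set 'M[R]_(m, n)) : open U ->
  U = \bigcup_(q : 'M[rat]_(m, n) * nat) [set x : 'M[R]_(m, n) |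
    ball (map_mx ratr q.1 : 'M[R]_(m, n)) q.2.+1%:R^-1 x /\
    ball (map_mx ratr q.1 : 'M[R]_(m, n)) q.2.+1%:R^-1 `<=` U].
Proof.
move=> oU; apply/seteqP; split=> [x Ux|x [q _ [xq]]]; last exact.
have /nbhs_ballP[e /= e0 xeU] : nbhs x U by apply: open_nbhs_nbhs.
have e20 : 0 < e / 2 by rewrite divr_gt0.
have [k] := ltr_add_invr e20; rewrite add0r => ke.
have r_gt0 : 0 < (k.+1%:R^-1 : R) by rewrite invr_gt0.
have qex i j : exists q : rat, `|ratr q - x i j| < k.+1%:R^-1.
  have /rat_in_itvoo[q /itvP qx] : x i j < x i j + k.+1%:R^-1 by rewrite ltrDl.
  by exists q; rewrite gtr0_norm ?subr_gt0 ?qx// ltrBlDl qx.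
have [q qP] : exists q : 'M[rat]_(m, n), forall i j, `|ratr (q i j) - x i j| < k.+1%:R^-1.
  exists (\matrix_(i, j) sval (cid (qex i j))) => i j; rewrite mxE.
  exact: svalP (cid (qex i j)).
have bq : ball (map_mx ratr q : 'M[R]_(m, n)) k.+1%:R^-1 x.
  by split => // i j; rewrite mxE; exact: qP.
exists (q, k) => //=; split => // y [_ qy]; apply: xeU; split => // i j.
rewrite /ball /= -(subrKA (ratr (q i j))) (splitr e) (le_lt_trans (ler_normD _ _))//.
rewrite ltrD//; first by rewrite distrC (lt_trans (qP i j)).
by have := qy i j; rewrite mxE /ball /= => /lt_trans; apply.
Qed.

(** The link between [random_matrix], stated for entries, and laws on the Borel sets of matrices. *)
Lemma random_matrix_borel {d} {T : measurableType d} m n (X : T -> 'M[R]_(m, n)) :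
  random_matrix X -> measurable_fun setT (X : T -> borel m n).
Proof.
move=> mX; apply: (@measurability _ _ T (borel m n) setT X (@open 'M[R]_(m, n)) erefl).
move=> _ [U oU <-]; rewrite setTI (open_mx_bigcup_rat oU) preimage_bigcup.
apply: countable_bigcupT_measurable => // -[q k] /=.
have [qkU|nqkU] := pselect
    (ball (map_mx ratr q : 'M[R]_(m, n)) k.+1%:R^-1 `<=` U).
  rewrite (_ : _ @^-1` _ = X @^-1` ball (map_mx ratr q : 'M[R]_(m, n)) k.+1%:R^-1).
    by apply: measurable_random_matrix_ball; rewrite ?invr_gt0.
  by apply/seteqP; split=> [w []|w].
rewrite (_ : _ @^-1` _ = set0)//.
by apply/seteqP; split=> // w [].
Qed.

Lemma measurable_continuous_borel m n (f : 'M[R]_(m, n) -> R) : continuous f ->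
  measurable_fun setT (f : borel m n -> R).
Proof.
move=> /continuousP cf; apply: (measurability _ (RGenOpens.measurableE R)).
move=> _ [_ [a [b ->] <-]]; rewrite setTI; apply: sub_sigma_algebra.
exact/cf/interval_open.
Qed.

Lemma random_matrix_id m n : random_matrix (id : borel m n -> 'M[R]_(m, n)).
Proof.
move=> i j; apply: measurable_continuous_borel => x.
by apply: (@cvg_mxP _ _ _ (nbhs_filter x) _ _ id x).1.
Qed.

Definition box N (B : 'I_N -> set R) : set 'cV[R]_N := [set v | forall i, B i (v i 0)].

Definition boxes N : set (set 'cV[R]_N) :=
  [set box B | B in [set B | forall i, measurable (B i)]].

Lemma measurable_box N (B : 'I_N -> set R) : (forall i, measurable (B i)) ->
  measurable (box B : set (borel N 1)).
Proof.
move=> mB.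
have -> : box B = \bigcap_(i in [set: 'I_N]) [set v : borel N 1 | B i (v i 0)].
  by apply/seteqP; split=> [v Bv i _|v Bv i]; [exact: Bv|exact: (Bv i I)].
apply: fin_bigcap_measurable => // i _.
have H := @random_matrix_id N 1 i 0 measurableT (B i) (mB i).
by rewrite setTI in H.
Qed.

(** For the nontrivial inclusion, the identity on the space carrying the sigma-algebra of the boxes
    has measurable entries, and [random_matrix_borel] applies to it. *)
Lemma borel_boxes N : @measurable _ (borel N 1) = <<s @boxes N >>.
Proof.
apply/seteqP; split=> [A mA|A]; last first.
  apply: smallest_sub; first exact: sigma_algebra_measurable.
  by move=> _ [B mB <-]; exact: measurable_box.
pose T := g_sigma_algebraType (@boxes N).
have mid : random_matrix (id : T -> 'cV[R]_N).
  move=> i j; rewrite ord1 => _ B mB; rewrite setTI.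
  apply: sub_sigma_algebra; exists (fun k => if k == i then B else setT).
    by move=> k; case: ifP.
  apply/seteqP; split=> [v /(_ i)|v Bv k]; rewrite /= ?eqxx//.
  by case: eqVneq => // ->.
have := random_matrix_borel mid measurableT mA.
by rewrite setTI.
Qed.

Lemma setI_closed_boxes N : setI_closed (@boxes N).
Proof.
move=> _ _ [A mA <-] [B mB <-]; exists (fun i => A i `&` B i).
  by move=> i; exact: measurableI.
by apply/seteqP; split=> [v AB|v [Av Bv] i]; [split=> i; have [] := AB i|split].
Qed.

Lemma boxesT N : @boxes N setT.
Proof. by exists (fun=> setT) => //; apply/seteqP; split. Qed.

(** Boxes form a pi-system, and they are the sets of noise values for which independence is
    given. *)
Lemma borel_measure_unique N (m1 m2 : {measure set (borel N 1) -> \bar R}) :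
  (m1 setT < +oo)%E ->
  (forall B, (forall i, measurable (B i)) -> m1 (box B) = m2 (box B)) ->
  forall A, measurable A -> m1 A = m2 A.
Proof.
move=> m1oo m12 A mA.
apply: (@measure_unique _ R (borel N 1) (@boxes N) (fun=> setT)) => //.
- exact: borel_boxes.
- exact: setI_closed_boxes.
- by move=> _; exact: boxesT.
- by apply/seteqP; split => // x _; exists 0%N.
- by move=> _ [B mB <-]; exact: m12.
Qed.

End borel_matrices.

(** * Rotation invariance of the Gaussian law *)

Section lebesgue_affine.
Context {R : realType}.
Local Open Scope ereal_scope.
Local Notation leb := (@lebesgue_measure R).

Lemma measurable_affine (a b : R) :
  measurable_fun setT (fun x : R => (a * x + b)%R).
Proof. by apply: measurable_funD => //; exact: measurable_cst. Qed.

Lemma lebesgue_measure_affine (a b : R) (A : set R) : (0 < a)%R -> measurable A ->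
  a%:E * leb ((fun x => a * x + b)%R @^-1` A) = leb A.
Proof.
move=> a0 mA.
pose f : measurableTypeR R -> measurableTypeR R := fun x => (a * x + b)%R.
have mf : measurable_fun setT f by exact: measurable_affine.
pose mf_mixin := isMeasurableFun.Build _ _ _ _ _ mf.
pose F : {mfun measurableTypeR R >-> measurableTypeR R} := HB.pack f mf_mixin.
pose a' : {nonneg R} := NngNum (ltW a0).
apply/esym.
apply: (@lebesgue_measure_unique R (mscale a' (pushforward leb F))) => //.
move=> _ [[x y] _ <-].
change (leb `]x, y]%classic = a%:E * leb (f @^-1` `]x, y]%classic)).
rewrite (_ : f @^-1` _ = `](x - b) / a, (y - b) / a]%classic)%R; last first.
  apply/seteqP; split=> z /=; rewrite !in_itv /= /f.
    by rewrite ltr_pdivrMr// ler_pdivlMr// !(mulrC z) ltrBlDr lerBrDr.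
  by rewrite ltr_pdivrMr// ler_pdivlMr// !(mulrC z) ltrBlDr lerBrDr.
rewrite !lebesgue_measure_itv /= !lte_fin ltr_pM2r ?invr_gt0// ltrD2r.
case: ifPn => _; last by rewrite mule0.
rewrite -!EFinB -EFinM; congr EFin; field.
by rewrite gt_eqF.
Qed.

Lemma ge0_integral_translate (b : R) (f : R -> \bar R) :
  measurable_fun setT f -> (forall x, 0 <= f x) ->
  \int[leb]_x f (x + b)%R = \int[leb]_x f x.
Proof.
move=> mf f0.
pose g : measurableTypeR R -> measurableTypeR R := fun x => (x + b)%R.
have mg : measurable_fun setT g.
  by apply: measurable_funD => //; exact: measurable_cst.
rewrite [LHS](_ : _ = \int[pushforward leb g]_x f x); last first.
  by rewrite ge0_integral_pushforward.
apply: eq_measure_integral => //= A mA _.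
rewrite -[RHS](lebesgue_measure_affine b (@ltr01 R) mA) mul1e.
by rewrite /pushforward; congr (leb _); apply/seteqP; split=> z /=; rewrite /g mul1r.
Qed.

End lebesgue_affine.

Section normal_density.
Context {R : realType} (sigma : R).
Hypothesis s0 : (0 < sigma)%R.
Local Open Scope ereal_scope.
Local Notation leb := (@lebesgue_measure R).
Local Notation gam := (normal_prob 0%R sigma).

(** The Radon-Nikodym derivative agrees almost everywhere with the density, both having the same
    integral over every measurable set. *)
Lemma ge0_integral_normal_prob (f : R -> \bar R) :
  measurable_fun setT f -> (forall x, 0 <= f x) ->
  \int[gam]_x f x = \int[leb]_x (f x * (normal_pdf 0%R sigma x)%:E).
Proof.
move=> mf f0.
have dom := normal_prob_dominates (0%R : R) sigma.
rewrite -(Radon_Nikodym_SigmaFinite.change_of_variables dom f0 measurableT mf).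
have mpdf : measurable_fun setT (fun x => (normal_pdf 0%R sigma x)%:E).
  by apply/measurable_EFinP; exact: measurable_normal_pdf.
have mRN := measurable_int _ (Radon_Nikodym_SigmaFinite.f_integrable dom).
apply: ae_eq_integral => //; [exact: emeasurable_funM|exact: emeasurable_funM|].
have ae : ae_eq leb setT (Radon_Nikodym_SigmaFinite.f gam leb)
    (fun x => (normal_pdf 0%R sigma x)%:E).
  apply: integral_ae_eq => //; first exact: Radon_Nikodym_SigmaFinite.f_integrable.
  by move=> E _ mE; rewrite -(Radon_Nikodym_SigmaFinite.f_integral dom mE).
by apply: filterS ae => x /= E _; rewrite E.
Qed.

Lemma ge0_integral_scale (r : R) (f : R -> \bar R) : (0 < r)%R ->
  measurable_fun setT f -> (forall x, 0 <= f x) ->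
  \int[leb]_x (r%:E * f (x * r)%R) = \int[leb]_x f x.
Proof.
move=> r0 mf f0.
pose g : measurableTypeR R -> measurableTypeR R := fun x => (r * x + 0)%R.
have mg : measurable_fun setT g by exact: measurable_affine.
pose mg_mixin := isMeasurableFun.Build _ _ _ _ _ mg.
pose G : {mfun measurableTypeR R >-> measurableTypeR R} := HB.pack g mg_mixin.
pose r' : {nonneg R} := NngNum (ltW r0).
have gE x : g x = (x * r)%R by rewrite /g addr0 mulrC.
rewrite ge0_integralZl//; last by rewrite lee_fin ltW.
  rewrite (_ : (fun x => f (x * r)%R) = f \o G); last first.
    by apply/funext => x /=; rewrite gE.
  rewrite -(@ge0_integral_pushforward _ _ _ _ _ _ mg leb setT)//.
  rewrite -(@ge0_integral_mscale _ _ _ (pushforward leb G) setT measurableT r' f)//.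
  apply: eq_measure_integral => //= A mA _.
  exact: lebesgue_measure_affine.
rewrite (_ : (fun x => f (x * r)%R) = f \o g); first exact: measurableT_comp.
by apply/funext => x /=; rewrite gE.
Qed.

Lemma normal_pdf_scale (r x : R) : (0 < r)%R ->
  (normal_pdf 0 sigma x = r * normal_pdf 0 (r * sigma) (x * r))%R.
Proof.
move=> r0.
have sN0 : sigma != 0%R by rewrite gt_eqF.
have rN0 : r != 0%R by rewrite gt_eqF.
have rs0 : (r * sigma != 0)%R by rewrite mulf_neq0.
rewrite !normal_pdfE// /normal_fun !subr0.
have -> : normal_peak (r * sigma)%R = (r^-1 * normal_peak sigma)%R.
  rewrite /normal_peak -invfM; congr (_^-1)%R.
  have -> : ((r * sigma) ^+ 2 * pi *+ 2 = r ^+ 2 * (sigma ^+ 2 * pi *+ 2))%R.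
    by rewrite exprMn !mulr2n; ring.
  by rewrite sqrtrM ?sqr_ge0// sqrtr_sqr gtr0_norm.
rewrite !mulrA divff// mul1r; congr (_ * expR _)%R.
rewrite !exprMn !mulr2n; field.
by rewrite -!mulr2n !mulrn_eq0 !sqrf_eq0 (negbTE rs0) (negbTE sN0).
Qed.

Lemma normal_prob_scale (r : R) (B : set R) : (0 < r)%R -> measurable B ->
  gam [set z | B (z * r)%R] = normal_prob 0%R (r * sigma)%R B.
Proof.
move=> r0 mB.
rewrite /normal_prob [RHS]integral_mkcond -(ge0_integral_scale r0); first last.
- by move=> x; rewrite patchE; case: ifP => // _; rewrite lee_fin normal_pdf_ge0.
- apply/(measurable_restrictT _ mB)/measurable_funTS/measurable_EFinP.
  exact: measurable_normal_pdf.
rewrite integral_mkcond; apply: eq_integral => x _.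
rewrite !patchE.
have -> : (x \in [set z | B (z * r)%R]) = ((x * r)%R \in B).
  by apply/idP/idP; rewrite !inE.
case: ifP => _; last by rewrite mule0.
by rewrite (normal_pdf_scale x r0) EFinM.
Qed.

Lemma normal_pdf_rot (x y x' y' : R) : (x ^+ 2 + y ^+ 2 = x' ^+ 2 + y' ^+ 2)%R ->
  (normal_pdf 0 sigma x * normal_pdf 0 sigma y =
   normal_pdf 0 sigma x' * normal_pdf 0 sigma y')%R.
Proof.
have sN0 : sigma != 0%R by rewrite gt_eqF.
move=> E; rewrite !normal_pdfE// /normal_fun !subr0 mulrACA [RHS]mulrACA.
congr (_ * _)%R; rewrite -!expRD; congr expR.
by rewrite -!mulrDl -!opprD E.
Qed.

End normal_density.

Section gauss_rotation.
Context {R : realType}.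
Local Open Scope ereal_scope.
Local Notation leb := (@lebesgue_measure R).

Lemma measurable_pair_affine (a b : R) :
  measurable_fun setT (fun z : R * R => (a * z.1 + b * z.2)%R).
Proof.
apply: measurable_funD; apply: measurable_funM => //.
Qed.

Lemma measurable_linear2 (K : R * R -> \bar R) (a b c d : R) :
  measurable_fun setT K ->
  measurable_fun setT (fun z : R * R => K (a * z.1 + b * z.2, c * z.1 + d * z.2)%R).
Proof.
move=> mK; apply: (measurableT_comp mK).
apply/measurable_fun_pairP; split; exact: measurable_pair_affine.
Qed.

Section shears.
Variables (K : R * R -> \bar R) (mK : measurable_fun setT K).
Hypothesis K0 : forall z, 0 <= K z.

Let measurable_section (z : R) : measurable_fun setT (fun t => K (z, t)).
Proof. exact: measurableT_comp mK (measurable_pair1 z). Qed.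

Let measurable_section2 (t : R) : measurable_fun setT (fun z => K (z, t)).
Proof. exact: measurableT_comp mK (measurable_pair2 t). Qed.

Lemma integral_shear2 (a : R) :
  \int[leb]_x \int[leb]_y K (x, y + a * x)%R = \int[leb]_x \int[leb]_y K (x, y).
Proof.
apply: eq_integral => x _.
exact: (@ge0_integral_translate _ (a * x) (fun y => K (x, y))).
Qed.

Lemma integral_shear1 (a : R) :
  \int[leb]_x \int[leb]_y K (x + a * y, y)%R = \int[leb]_x \int[leb]_y K (x, y).
Proof.
have mKa : measurable_fun setT (fun z : R * R => K (z.1 + a * z.2, z.2)%R).
  have := measurable_linear2 1 a 0 1 mK.
  by apply: eq_measurable_fun => z _; rewrite !mul1r mul0r add0r.
(* This shear moves the outer variable; Tonelli makes it the inner one, where the shear is a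
   translation. *)
rewrite (fubini_tonelli (m1 := leb) (m2 := leb) (fun z => K (z.1 + a * z.2, z.2)%R))//=.
rewrite [RHS](fubini_tonelli (m1 := leb) (m2 := leb) K)//.
apply: eq_integral => y _.
exact: (@ge0_integral_translate _ (a * y) (fun x => K (x, y))).
Qed.

End shears.

(* A plane rotation is a product of three shears, each of which preserves the iterated
   integral by translation invariance on lines; tau is minus the tangent of the half
   angle. *)
Lemma integral_rotation (K : R * R -> \bar R) (c s : R) :
  measurable_fun setT K -> (forall z, 0 <= K z) -> (0 <= c)%R ->
  (c ^+ 2 + s ^+ 2 = 1)%R ->
  \int[leb]_x \int[leb]_y K (c * x - s * y, s * x + c * y)%R =
  \int[leb]_x \int[leb]_y K (x, y).
Proof.
move=> mK K0 c0 cs.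
(* The assumption [0 <= c] excludes the half turn, for which the half-angle tangent is undefined. *)
have c1 : (1 + c != 0)%R by rewrite gt_eqF// ltr_wpDr.
pose tau := (- (s / (1 + c)))%R.
pose K1 z := K (z.1 + tau * z.2, z.2)%R.
pose K2 z := K1 (z.1, z.2 + s * z.1)%R.
have mK1 : measurable_fun setT K1.
  have := measurable_linear2 1 tau 0 1 mK.
  by apply: eq_measurable_fun => z _; rewrite /K1 !mul1r mul0r add0r.
have mK2 : measurable_fun setT K2.
  have := measurable_linear2 1 0 s 1 mK1.
  by apply: eq_measurable_fun => z _; rewrite /K2 !mul1r mul0r addr0 addrC.
rewrite -(integral_shear1 mK K0 tau).
rewrite -(integral_shear2 (K := K1) mK1 (fun z => K0 _) s).
rewrite -(integral_shear1 (K := K2) mK2 (fun z => K0 _) tau).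
apply: eq_integral => x _; apply: eq_integral => y _.
have h1 : (tau * (1 + c) = - s)%R by rewrite /tau mulNr divfK.
have h2 : (s * tau = c - 1)%R.
  apply: (mulIf c1); rewrite -mulrA h1 mulrN -expr2.
  by rewrite (_ : s ^+ 2 = 1 - c ^+ 2)%R; [ring|rewrite -cs addrAC subrr add0r].
have E2 : (s * x + c * y = y + s * (x + tau * y))%R.
  by rewrite mulrDr mulrA h2; ring.
have E1 : (c * x - s * y = x + tau * y + tau * (y + s * (x + tau * y)))%R.
  rewrite -E2 -mulNr -h1.
  have -> : (c * x = x + (s * tau) * x)%R by rewrite h2; ring.
  by ring.
by rewrite /K2 /K1 /= E2 E1 -E2.
Qed.

Variable sigma : R.
Hypothesis s0 : (0 < sigma)%R.
Local Notation gam := (normal_prob 0%R sigma).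

(** Against Lebesgue measure the integrand acquires the factor [phi x * phi y], which depends only
    on [x^2 + y^2]; the Lebesgue rotation is applied to [F] times this factor. *)
Lemma normal_prob_rotation (F : R * R -> \bar R) (c s : R) :
  measurable_fun setT F -> (forall z, 0 <= F z) -> (0 <= c)%R ->
  (c ^+ 2 + s ^+ 2 = 1)%R ->
  \int[gam]_x \int[gam]_y F (c * x - s * y, s * x + c * y)%R =
  \int[gam]_x \int[gam]_y F (x, y).
Proof.
move=> mF F0 c0 cs.
pose phi := normal_pdf 0%R sigma.
have phi0 x : (0 <= phi x)%R by exact: normal_pdf_ge0.
have mphi : measurable_fun setT phi by exact: measurable_normal_pdf.
have toleb (G : R * R -> \bar R) : measurable_fun setT G -> (forall z, 0 <= G z) ->
    \int[gam]_x \int[gam]_y G (x, y) =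
    \int[leb]_x \int[leb]_y (G (x, y) * (phi x * phi y)%:E).
  move=> mG G0.
  have mGx x : measurable_fun setT (fun y => G (x, y)).
    exact: measurableT_comp mG (measurable_pair1 x).
  rewrite (@ge0_integral_normal_prob R sigma); first last.
  - by move=> x; exact: integral_ge0.
  - exact: (measurable_fun_fubini_tonelli_F (m2 := gam) G).
  apply: eq_integral => x _.
  rewrite (@ge0_integral_normal_prob R sigma)// -ge0_integralZr//; first last.
  - by rewrite lee_fin.
  - by move=> y _; rewrite mule_ge0// lee_fin.
  - apply: emeasurable_funM; first exact: mGx.
    by apply/measurable_EFinP; exact: mphi.
  by apply: eq_integral => y _; rewrite -muleA -EFinM (mulrC (phi x)).
pose K z : \bar R := F z * (phi z.1 * phi z.2)%:E.
have mK : measurable_fun setT K.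
  apply: emeasurable_funM => //; apply/measurable_EFinP/measurable_funM.
    exact: measurableT_comp.
  exact: measurableT_comp.
have K0 z : 0 <= K z by rewrite mule_ge0// lee_fin mulr_ge0.
have mFrot : measurable_fun setT
    (fun z : R * R => F (c * z.1 - s * z.2, s * z.1 + c * z.2)%R).
  have := measurable_linear2 c (- s) s c mF.
  by apply: eq_measurable_fun => z _; rewrite mulNr.
rewrite (toleb (fun z : R * R => F (c * z.1 - s * z.2, s * z.1 + c * z.2)%R))//.
rewrite (toleb F)// -[RHS](integral_rotation mK K0 c0 cs).
apply: eq_integral => x _; apply: eq_integral => y _; rewrite /K /=.
congr (_ * _%:E); apply: normal_pdf_rot => //.
transitivity ((c ^+ 2 + s ^+ 2) * (x ^+ 2 + y ^+ 2))%R; last by ring.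
by rewrite cs mul1r.
Qed.

End gauss_rotation.

(** * Gaussian convolutions and Givens rotations *)

Section gaussian_convolutions.
Context {R : realType} (sigma : R).
Hypothesis s0 : (0 < sigma)%R.
Local Open Scope ereal_scope.
Local Notation gam := (normal_prob 0%R sigma).

Section convolution.
Context {n : nat}.
Implicit Types (f : 'cV[R]_n -> \bar R) (a b x : 'cV[R]_n) (l : seq 'cV[R]_n).

Definition bnn f := (forall x, 0 <= f x) /\ measurable_fun setT (f : borel n 1 -> \bar R).

(* E f(x + z a) with z ~ N(0, sigma^2), so [gconvs l f x] is E f(x + sum_i z_i a_i)
   with independent z_i and a_i the entries of l. *)
Definition gconv a f x := \int[gam]_z f (x + z *: a)%R.

Definition gconvs l f := foldr gconv f l.

Lemma measurable_line a b x : measurable_fun setT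
  (fun z : R * R => (x + z.1 *: a + z.2 *: b)%R : borel n 1).
Proof.
apply: random_matrix_borel => i j.
under eq_fun do rewrite !mxE.
apply: measurable_funD; last by apply: measurable_funM => //; exact: measurable_cst.
by apply: measurable_funD => //; apply: measurable_funM => //; exact: measurable_cst.
Qed.

Lemma measurable_shift a : measurable_fun setT
  (fun z : borel n 1 * R => ((z.1 : 'cV[R]_n) + z.2 *: a)%R : borel n 1).
Proof.
apply: random_matrix_borel => i j.
under eq_fun do rewrite !mxE.
apply: measurable_funD; last by apply: measurable_funM => //; exact: measurable_cst.
exact: (measurableT_comp (@random_matrix_id R n 1 i j) measurable_fst).
Qed.

Lemma measurable_line1 a x : measurable_fun setT (fun z : R => (x + z *: a)%R : borel n 1).
Proof.
apply: random_matrix_borel => i j; under eq_fun do rewrite !mxE.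
by apply: measurable_funD => //; apply: measurable_funM => //; exact: measurable_cst.
Qed.

Lemma gconv_bnn a f : bnn f -> bnn (gconv a f).
Proof.
move=> [f0 mf]; split=> [x|]; first exact: integral_ge0.
apply: (measurable_fun_fubini_tonelli_F (m2 := gam)
  (fun z : borel n 1 * R => f ((z.1 : 'cV[R]_n) + z.2 *: a)%R)) => //.
exact: measurableT_comp mf (measurable_shift a).
Qed.

Lemma gconvs_bnn l f : bnn f -> bnn (gconvs l f).
Proof. by move=> bf; elim: l => //= a l IH; exact: gconv_bnn. Qed.

Lemma gconvC a b f : bnn f -> gconv a (gconv b f) = gconv b (gconv a f).
Proof.
move=> [f0 mf]; apply/funext => x; rewrite /gconv.
have mF := measurableT_comp mf (measurable_line a b x).
pose F z : \bar R := f (x + z.1 *: a + z.2 *: b)%R.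
have H := fubini_tonelli (m1 := gam) (m2 := gam) F mF (fun z => f0 _).
apply: (etrans H); apply: eq_integral => z _; apply: eq_integral => t _.
by rewrite /F /= addrAC.
Qed.

Lemma gconv_rot a b f (c s : R) : bnn f -> (0 <= c)%R -> (c ^+ 2 + s ^+ 2 = 1)%R ->
  gconv a (gconv b f) = gconv (c *: a + s *: b)%R (gconv (c *: b - s *: a)%R f).
Proof.
move=> [f0 mf] c0 cs; apply/funext => x; rewrite /gconv.
have mF := measurableT_comp mf (measurable_line a b x).
pose F z : \bar R := f (x + z.1 *: a + z.2 *: b)%R.
have H := normal_prob_rotation s0 mF (fun z => f0 _ : 0 <= F z) c0 cs.
apply: (etrans (esym H)); apply: eq_integral => z _; apply: eq_integral => t _.
rewrite /F /=; congr (f _).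
rewrite -!addrA; congr (_ + _)%R; apply/matrixP => i j; rewrite !mxE; ring.
Qed.

Lemma gconv0 f : bnn f -> gconv 0%R f = f.
Proof.
move=> [f0 mf]; apply/funext => x; rewrite /gconv.
under eq_integral do rewrite scaler0 addr0.
rewrite (integral_cst gam measurableT (f x)).
by rewrite -[RHS]mule1; congr (_ * _); exact: (@probability_setT _ _ R gam).
Qed.

Definition gequiv l l' := forall f, bnn f -> gconvs l f = gconvs l' f.

Definition gram l : 'M[R]_n := (\sum_(a <- l) a *m a^T)%R.

(* Givens rotations of the vectors of a list change neither the Gaussian law it
   generates nor its Gram matrix. *)
Lemma givens_row (k : 'I_n) l : exists a l', [/\ gequiv l (a :: l'),
  gram l = gram (a :: l'), (0 <= a k 0)%R & forall b, b \in l' -> (b k 0 = 0)%R].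
Proof.
elim: l => [|b l [a [l' [ll' gE ak l'0]]]].
  exists 0%R, [::]; split => //; first by move=> f bf; exact: (esym (gconv0 bf)).
    by rewrite /gram big_cons !big_nil mul0mx addr0.
  by rewrite mxE.
have gE2 : gram (b :: l) = (a *m a^T + b *m b^T + gram l')%R.
  by rewrite /gram big_cons -/(gram l) gE /gram big_cons addrCA addrA.
set rho := Num.sqrt (a k 0 ^+ 2 + b k 0 ^+ 2)%R.
have rho2 : (rho ^+ 2 = a k 0 ^+ 2 + b k 0 ^+ 2)%R.
  by rewrite sqr_sqrtr// addr_ge0// sqr_ge0.
(* If both [k]-th entries vanish, [b] already belongs to the tail and no rotation is made. *)
have [r0|r0] := eqVneq rho 0%R.
  have bk : (b k 0 = 0)%R.
    apply/eqP; rewrite -sqrf_eq0; move: rho2; rewrite r0 expr0n /= => /esym/eqP.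
    by rewrite paddr_eq0 ?sqr_ge0// => /andP[].
  exists a, (b :: l'); split => //.
  - move=> f bf; have bg := gconvs_bnn l' bf.
    have H : gconvs (b :: l) f = gconv b (gconv a (gconvs l' f)).
      by rewrite -[RHS]/(gconv b (gconvs (a :: l') f)) -(ll' f bf).
    exact: (etrans H (gconvC b a bg)).
  - by rewrite gE2 /gram !big_cons addrA.
  - by move=> b'; rewrite inE => /orP[/eqP ->|/l'0].
(* This rotation turns the [k]-th entries of [a] and [b] into [rho] and 0. The sign of [a k 0] is
   part of the induction because [gconv_rot] needs [0 <= c]. *)
pose c := (a k 0 / rho)%R; pose s := (b k 0 / rho)%R.
have rp : (0 < rho)%R by rewrite lt0r r0 sqrtr_ge0.
have c0 : (0 <= c)%R by rewrite divr_ge0// ltW.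
have cs : (c ^+ 2 + s ^+ 2 = 1)%R.
  by rewrite !exprMn -mulrDl -rho2 -exprMn divff// expr1n.
exists (c *: a + s *: b)%R, ((c *: b - s *: a)%R :: l'); split.
- move=> f bf; have bg := gconvs_bnn l' bf.
  have H : gconvs (b :: l) f = gconv b (gconv a (gconvs l' f)).
    by rewrite -[RHS]/(gconv b (gconvs (a :: l') f)) -(ll' f bf).
  exact: (etrans H (etrans (gconvC b a bg) (gconv_rot a b bg c0 cs))).
- rewrite gE2 /gram !big_cons addrA; congr (_ + _)%R.
  apply/matrixP => i j; rewrite !mxE !big_ord1 !mxE.
  transitivity ((c ^+ 2 + s ^+ 2) * (a i 0 * a j 0 + b i 0 * b j 0))%R; last by ring.
  by rewrite cs mul1r.
- rewrite !mxE /c /s -!mulrA ![(rho^-1 * _)%R]mulrC !mulrA -mulrDl.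
  by rewrite divr_ge0// -?expr2 ?addr_ge0 ?sqr_ge0// ltW.
- move=> b'; rewrite inE => /orP[/eqP ->|/l'0//].
  by rewrite !mxE /c /s; ring.
Qed.

Lemma gram_entry l i j : gram l i j = (\sum_(a <- l) a i 0 * a j 0)%R.
Proof. by rewrite /gram summxE; apply: eq_bigr => a _; rewrite mxE big_ord1 mxE. Qed.

Lemma gram0 l : gram l = 0%R -> forall a, a \in l -> a = 0%R.
Proof.
move=> g0 a al; apply/matrixP => i j; rewrite ord1 mxE.
have := congr1 (fun A : 'M[R]_n => A i i) g0; rewrite /= gram_entry mxE => /eqP.
rewrite psumr_eq0; last by move=> b _; rewrite -expr2 sqr_ge0.
by move=> /allP /(_ a al) /=; rewrite -expr2 sqrf_eq0 => /eqP.
Qed.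

Lemma gconvs0 l f : bnn f -> (forall a, a \in l -> a = 0%R) -> gconvs l f = f.
Proof.
move=> bf; elim: l => [//|a l IH l0].
have lf : gconvs l f = f.
  by apply: IH => b bl; apply: l0; rewrite inE bl orbT.
rewrite -[LHS]/(gconv a (gconvs l f)) lf (l0 a) ?inE ?eqxx//.
exact: gconv0.
Qed.

(** A centred Gaussian law depends only on its Gram matrix. After [givens_row] the head alone has a
    nonzero [k]-th entry, so row [k] of the Gram matrix reads [a_k a_j = delta_kj]; as [a_k >= 0],
    the head is the [k]-th basis vector. The tail then has the Gram matrix of the remaining basis
    vectors. *)
Lemma gequiv_basis (s : seq 'I_n) l : uniq s ->
  gram l = gram [seq delta_mx i 0%R | i <- s] ->
  gequiv l [seq delta_mx i 0%R | i <- s].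
Proof.
elim: s l => [|k s IH] l /=.
  move=> _; rewrite /gram big_nil => /gram0 l0 f bf; exact: gconvs0.
move=> /andP[ks us] gl.
have [a [l' [ll' gE ak l'0]]] := givens_row k l.
have gkj j : (a k 0 * a j 0 = (k == j)%:R)%R.
  have := congr1 (fun A : 'M[R]_n => A k j) (etrans (esym gE) gl).
  rewrite /= !gram_entry !big_cons big1_seq ?addr0; last first.
    by move=> b /andP[_ /l'0 ->]; rewrite mul0r.
  move=> ->; rewrite big_map big1_seq ?addr0; last first.
    move=> i /andP[_ iS]; rewrite !mxE eqxx andbT.
    have -> : (k == i) = false by apply/negbTE; apply: contraNneq ks => ->.
    by rewrite mul0r.
  by rewrite !mxE !eqxx /= mul1r andbT eq_sym.
have ak1 : (a k 0 = 1)%R.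
  have := gkj k; rewrite eqxx -expr2 => /eqP; rewrite sqrf_eq1 => /orP[/eqP//|/eqP akN].
  by move: ak; rewrite akN oppr_ge0 ler10.
have aE : a = delta_mx k 0%R.
  apply/matrixP => i j; rewrite ord1 mxE eqxx andbT.
  by have := gkj i; rewrite ak1 mul1r eq_sym.
have gl' : gram l' = gram [seq delta_mx i 0%R | i <- s].
  move: gl; rewrite gE /gram !big_cons aE => /addrI; exact.
move=> f bf; have H := ll' f bf; rewrite aE in H; apply: (etrans H).
by rewrite -[LHS]/(gconv _ (gconvs l' f)) (IH l' us gl' f bf).
Qed.

End convolution.

Lemma gconvs_linear m n (A : 'M[R]_(m, n)) (l : seq 'cV[R]_n) (f : 'cV[R]_m -> \bar R) x :
  gconvs [seq (A *m a)%R | a <- l] f (A *m x)%R = gconvs l (fun y => f (A *m y)%R) x.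
Proof.
elim: l x => //= a l IH x; rewrite /gconv; apply: eq_integral => z _.
by rewrite -IH mulmxDr scalemxAr.
Qed.

End gaussian_convolutions.

(** * Gaussian vectors *)

Section law.
Context {R : realType} {d : measure_display} {T : measurableType d}.
Variable Pr : probability T R.

Section def.
Context {m n : nat} (X : T -> 'M[R]_(m, n)) (mX : random_matrix X).

Let mX_mixin := isMeasurableFun.Build _ _ _ _ (X : T -> borel m n) (random_matrix_borel mX).
Let X_mfun : {mfun T >-> borel m n} := HB.pack (X : T -> borel m n) mX_mixin.

Definition law : probability (borel m n) R := distribution Pr X_mfun.

Lemma lawE A : law A = Pr (X @^-1` A). Proof. by []. Qed.

Lemma ge0_integral_law (f : borel m n -> \bar R) :
  measurable_fun setT f -> (forall x, 0 <= f x)%E ->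
  (\int[law]_x f x = \int[Pr]_w f (X w))%E.
Proof. by move=> mf f0; rewrite [LHS]ge0_integral_distribution. Qed.

Lemma integral_law (f : borel m n -> \bar R) :
  measurable_fun setT f -> Pr.-integrable setT (f \o X) ->
  (\int[law]_x f x = \int[Pr]_w f (X w))%E.
Proof. by move=> mf intf; rewrite [LHS]integral_distribution. Qed.

End def.
End law.

Section iid_gaussian.
Context {R : realType} (sigma : R).
Hypothesis s0 : (0 < sigma)%R.
Local Open Scope ereal_scope.
Local Notation gam := (normal_prob 0%R sigma).

Definition basis N : seq 'cV[R]_N := [seq delta_mx i 0%R | i <- enum 'I_N].

(** The law N(0, sigma^2 I), encoded as an iterated convolution of an indicator so that
    [gequiv_basis] applies directly; [gauss_box] shows that it is the product law. *)
Definition gauss N (A : set 'cV[R]_N) : \bar R :=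
  gconvs sigma (basis N) (fun x => (\1_A x)%:E) 0%R.

(** Monotone convergence in each integral; it yields the countable additivity of [gauss]. *)
Lemma gconvs_nneseries N (l : seq 'cV[R]_N) (f : nat -> 'cV[R]_N -> \bar R) x :
  (forall k, bnn (f k)) ->
  gconvs sigma l (fun y => \sum_(k <oo) f k y) x = \sum_(k <oo) gconvs sigma l (f k) x.
Proof.
move=> bf; elim: l x => [//|a l IH] x.
rewrite -[LHS]/(\int[gam]_z gconvs sigma l _ (x + z *: a)%R).
transitivity (\int[gam]_z \sum_(k <oo) gconvs sigma l (f k) (x + z *: a)%R).
  by apply: eq_integral => z _; exact: IH.
apply: (@integral_nneseries _ _ R gam setT measurableT
  (fun k z => gconvs sigma l (f k) (x + z *: a)%R)).
  move=> k; have [_ mg] := gconvs_bnn sigma l (bf k).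
  exact: measurableT_comp mg (measurable_line1 a x).
by move=> k z _; have [g0 _] := gconvs_bnn sigma l (bf k).
Qed.

Lemma bnn_indic N (A : set (borel N 1)) : measurable A -> bnn (fun x : 'cV[R]_N => (\1_A x)%:E).
Proof.
move=> mA; split=> [x|]; first by rewrite lee_fin.
by apply/measurable_EFinP; exact: measurable_indic.
Qed.

(** The intermediate stage in the induction of [gconvs_box]: coordinates in [s] are integrated out,
    the others still evaluated at [x]. *)
Definition box_prob N (s : seq 'I_N) (B : 'I_N -> set R) (x : 'cV[R]_N) : \bar R :=
  \prod_(i < N) (if i \in s then gam [set z | B i (x i 0 + z)%R] else (\1_(B i) (x i 0%R))%:E).

Lemma gconvs_box N (s : seq 'I_N) (B : 'I_N -> set R) x :
  (forall i, measurable (B i)) -> uniq s ->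
  gconvs sigma [seq delta_mx i 0%R | i <- s] (fun y => (\1_(box B) y)%:E) x =
  box_prob s B x.
Proof.
move=> mB; elim: s x => [x _|k s IH x /= /andP[ks us]].
  rewrite /gconvs /= /box_prob indicE.
  have [Bx|nBx] := pselect (box B x).
    rewrite mem_set// big1// => i _; rewrite indicE mem_set//; exact: Bx.
  rewrite memNset//.
  have [i nBi] : exists i, ~ B i (x i 0%R) by exact/existsNP.
  by rewrite (bigD1 i)//= indicE memNset// mul0e.
have mBz (i : 'I_N) (a : R) : measurable [set z : R | B i (a + z)%R].
  have ma : measurable_fun setT (fun z : R => (a + z)%R).
    by apply: measurable_funD => //; exact: measurable_cst.
  by have := ma measurableT _ (mB i); rewrite setTI.
rewrite -[LHS]/(\int[gam]_z gconvs sigma _ _ (x + z *: delta_mx k 0)%R).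
pose c := \prod_(i < N | i != k)
  (if i \in s then gam [set z | B i (x i 0 + z)%R] else (\1_(B i) (x i 0%R))%:E).
have c0 : 0 <= c.
  by apply: prode_ge0 => i _; case: ifP => _; [exact: measure_ge0|rewrite lee_fin].
transitivity (\int[gam]_z (c * (\1_[set z | B k (x k 0 + z)%R] z)%:E)).
  apply: eq_integral => z _; rewrite IH// /box_prob (bigD1 k)//= (negbTE ks) muleC; congr (_ * _).
    apply: eq_bigr => i ik.
    by rewrite !mxE (negbTE ik) /= mulr0 addr0.
  by rewrite !mxE !eqxx mulr1 !indicE.
rewrite ge0_integralZl//; first last.
  by apply/measurable_EFinP; apply: measurable_indic; exact: mBz.
rewrite integral_indic; [|exact: measurableT|exact: mBz].
rewrite setIT /box_prob [RHS](bigD1 k)//= inE eqxx /= muleC; congr (_ * _).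
by apply: eq_bigr => i ik; rewrite inE (negbTE ik).
Qed.

Section measure.
Variable N : nat.

Let gauss0 : gauss (set0 : set (borel N 1)) = 0.
Proof.
rewrite /gauss; elim: (basis N) (0%R : 'cV[R]_N) => [x|a l IH x].
  by rewrite /gconvs /= indic0.
by apply: integral0_eq => z _; exact: IH.
Qed.

Let gauss_ge0 (A : set (borel N 1)) : 0 <= gauss A.
Proof.
rewrite /gauss; elim: (basis N) (0%R : 'cV[R]_N) => [x|a l IH x].
  by rewrite /gconvs /= lee_fin.
by apply: integral_ge0 => z _; exact: IH.
Qed.

Let gauss_semi_sigma_additive : semi_sigma_additive (@gauss N : set (borel N 1) -> \bar R).
Proof.
move=> F mF tF mUF.
have -> : gauss (\bigcup_k F k) = \sum_(k <oo) gauss (F k).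
  rewrite /gauss -gconvs_nneseries; last by move=> k; exact: bnn_indic.
  apply: (congr1 (fun f => gconvs sigma (basis N) f 0%R)); apply/funext => x.
  exact: indic_bigcup.
apply/cvg_closeP; split; last by rewrite closeE.
by apply: is_cvg_nneseries => k _ _; exact: gauss_ge0.
Qed.

HB.instance Definition _ := isMeasure.Build _ (borel N 1) R (@gauss N : set (borel N 1) -> \bar R)
  gauss0 gauss_ge0 gauss_semi_sigma_additive.

Lemma gauss_box (B : 'I_N -> set R) : (forall i, measurable (B i)) ->
  gauss (box B) = \prod_(i < N) gam (B i).
Proof.
move=> mB; rewrite /gauss /basis gconvs_box ?enum_uniq// /box_prob.
apply: eq_bigr => i _; rewrite mem_enum /=; congr (gam _).
by apply/seteqP; split=> z /=; rewrite mxE add0r.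
Qed.

Let gaussT : gauss (setT : set (borel N 1)) = 1.
Proof.
have -> : setT = @box R N (fun=> setT) by apply/seteqP; split.
rewrite gauss_box// big1// => i _; exact: (@probability_setT _ _ R gam).
Qed.

HB.instance Definition _ := Measure_isProbability.Build _ (borel N 1) R
  (@gauss N : set (borel N 1) -> \bar R) gaussT.

End measure.

Section iid_vector.
Context {d : measure_display} {T : measurableType d} (Pr : probability T R).
Context {N : nat} (V : T -> 'cV[R]_N).
Hypothesis mV : random_matrix V.
Hypothesis V_gam : forall i B, measurable B -> Pr [set w | B (V w i 0%R)] = gam B.
Hypothesis V_indep : forall B : 'I_N -> set R, (forall i, measurable (B i)) ->
  Pr [set w | forall i, B i (V w i 0%R)] =
  \prod_(i < N) Pr [set w | B i (V w i 0%R)].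

Lemma law_gauss (A : set (borel N 1)) : measurable A -> Pr (V @^-1` A) = gauss A.
Proof.
move=> mA; rewrite -(lawE Pr mV).
apply: (@borel_measure_unique _ N (law Pr mV) (@gauss N)) => // [|B mB].
  by rewrite ltey_eq fin_num_measure.
change (Pr [set w | forall i, B i (V w i 0%R)] = gauss (box B)).
rewrite gauss_box// V_indep//.
by apply: eq_bigr => i _; exact: V_gam.
Qed.

End iid_vector.

Lemma gauss_linear_gconvs m N (A : 'M[R]_(m, N)) (B : set 'cV[R]_m) :
  gauss [set v : 'cV[R]_N | B (A *m v)%R] =
  gconvs sigma [seq (A *m a)%R | a <- basis N] (fun x => (\1_B x)%:E) 0%R.
Proof.
rewrite -(mulmx0 1 A) gconvs_linear /gauss.
apply: (congr1 (fun f => gconvs sigma (basis N) f 0%R)); apply/funext => x.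
rewrite !indicE; congr (_%:R%:E).
Qed.

Lemma gram_linear m N (A : 'M[R]_(m, N)) :
  gram [seq (A *m a)%R | a <- basis N] = (A *m A^T)%R.
Proof.
rewrite /gram /basis -map_comp big_map big_enum /=; apply/matrixP => i j.
rewrite summxE mxE; apply: eq_bigr => k _.
rewrite -!colE mxE big_ord1.
by rewrite !mxE.
Qed.

(** The images of the basis under [U] have Gram matrix [U U^T = 1], which is that of the standard
    basis of R^m; [U] itself may be rectangular. *)
Lemma gauss_isometry m N (U : 'M[R]_(m, N)) (B : set (borel m 1)) : measurable B ->
  (U *m U^T = 1%:M)%R -> gauss [set v : 'cV[R]_N | B (U *m v)%R] = gauss B.
Proof.
move=> mB UU; rewrite gauss_linear_gconvs [in RHS]/gauss.
rewrite (@gequiv_basis _ _ s0 m (enum 'I_m))//; first exact: enum_uniq.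
  rewrite gram_linear UU -[[seq _ | _ <- _]]/(basis m).
  have := gram_linear (1%:M : 'M[R]_m); rewrite trmx1 mulmx1 => <-.
  by congr gram; rewrite -[RHS]map_id; apply: eq_map => a; rewrite mul1mx.
exact: bnn_indic.
Qed.

(** In dimension one the Givens rotations collapse the entries of [a] to a single [c >= 0] with
    [c^2 = a^T a]. The law is then a scaled normal law, or a point mass when [c = 0]. *)
Lemma gauss_dot N (a : 'cV[R]_N) (B : set R) : measurable B ->
  gauss [set v : 'cV[R]_N | B ((a^T *m v) 0 0)%R] =
  normal_law 0%R (sigma ^+ 2 * (a^T *m a) 0 0)%R B.
Proof.
move=> mB.
pose C : set 'cV[R]_1 := [set x | B (x 0 0)%R].
have mC : measurable (C : set (borel 1 1)).
  by have := @random_matrix_id R 1 1 0%R 0%R measurableT _ mB; rewrite setTI.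
have bC := bnn_indic mC.
rewrite -[LHS]/(gauss [set v : 'cV[R]_N | C (a^T *m v)%R]) gauss_linear_gconvs.
have [c [l' [ll' gE c0 l'0]]] := givens_row s0 (0%R : 'I_1) [seq (a^T *m b)%R | b <- basis N].
have c2 : (c 0 0 ^+ 2 = (a^T *m a) 0 0)%R.
  have := congr1 (fun M : 'M[R]_1 => M 0 0)%R gE.
  rewrite gram_linear trmxK => ->; rewrite gram_entry big_cons big1_seq ?addr0 ?expr2//.
  by move=> b /andP[_ /l'0 ->]; rewrite mul0r.
rewrite (ll' _ bC) -[LHS]/(gconv sigma c (gconvs sigma l' _) 0%R).
rewrite (gconvs0 sigma bC); last first.
  by move=> b /l'0 b0; apply/matrixP => i j; rewrite !ord1 b0 mxE.
rewrite -c2; have [c00|cN0] := eqVneq (c 0 0)%R 0%R.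
  have -> : c = 0%R by apply/matrixP => i j; rewrite !ord1 c00 mxE.
  rewrite (gconv0 sigma bC) /normal_law mxE expr0n /= mulr0 eqxx diracE indicE.
  have -> // : ((0%R : 'cV[R]_1) \in C) = ((0%R : R) \in B).
  by apply/idP/idP; rewrite !inE /C /= mxE.
have cp : (0 < c 0 0)%R by rewrite lt0r cN0.
have vN0 : (sigma ^+ 2 * c 0 0 ^+ 2 != 0)%R.
  by rewrite mulf_neq0 ?expf_neq0// gt_eqF.
have sv : (Num.sqrt (sigma ^+ 2 * c 0 0 ^+ 2) = c 0 0 * sigma)%R.
  by rewrite -exprMn sqrtr_sqr ger0_norm 1?mulrC// mulr_ge0// ltW.
rewrite /normal_law (negbTE vN0) sv -(normal_prob_scale s0 cp mB).
have mBc : measurable [set z : R | B (z * c 0 0)%R].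
  have mc : measurable_fun setT (fun z : R => (z * c 0 0)%R).
    by apply: measurable_funM => //; exact: measurable_cst.
  by have := mc measurableT _ mB; rewrite setTI.
transitivity (\int[gam]_z (\1_[set z : R | B (z * c 0 0)%R] z)%:E).
  apply: eq_integral => z _; rewrite !indicE.
  have -> // : ((0 + z *: c)%R \in C) = (z \in [set z : R | B (z * c 0 0)%R]).
  by apply/idP/idP; rewrite !inE /C /= !mxE add0r.
by rewrite integral_indic; [rewrite setIT|exact: measurableT|exact: mBc].
Qed.

End iid_gaussian.

(** * Independence of design and noise *)

Section independent_design.
Context {R : realType} (sigma : R).
Hypothesis s0 : (0 < sigma)%R.
Context {d : measure_display} {T : measurableType d} (Pr : probability T R).
Context {N n : nat} (Phi : T -> 'M[R]_(N, n)) (V : T -> 'cV[R]_N).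
Hypothesis mPhi : random_matrix Phi.
Hypothesis mV : random_matrix V.
Local Open Scope ereal_scope.
Hypothesis V_gam : forall i B, measurable B ->
  Pr [set w | B (V w i 0%R)] = normal_prob 0%R sigma B.
Hypothesis indep : mutually_independent Pr Phi V.

Let mPhi' := random_matrix_borel mPhi.
Let mV' := random_matrix_borel mV.

Let V_mixin := isMeasurableFun.Build _ _ _ _ (V : T -> borel N 1) mV'.
Let V_mfun : {mfun T >-> borel N 1} := HB.pack (V : T -> borel N 1) V_mixin.

Lemma independent_entries (B : 'I_N -> set R) : (forall i, measurable (B i)) ->
  Pr [set w | forall i, B i (V w i 0%R)] =
  \prod_(i < N) Pr [set w | B i (V w i 0%R)].
Proof.
move=> mB; have := indep measurableT mB.
by rewrite preimage_setT setTI probability_setT mul1e.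
Qed.

(** For fixed [A] both sides are finite measures in [B] that agree on boxes. *)
Lemma independent_law (A : set (borel N n)) (B : set (borel N 1)) :
  measurable A -> measurable B ->
  Pr (Phi @^-1` A `&` V @^-1` B) = Pr (Phi @^-1` A) * Pr (V @^-1` B).
Proof.
move=> mA mB.
have mPA : measurable (Phi @^-1` A) by have := mPhi' measurableT mA; rewrite setTI.
have PAfin : Pr (Phi @^-1` A) \is a fin_num by exact: fin_num_measure.
have PA0 : (0 <= fine (Pr (Phi @^-1` A)))%R by exact: fine_ge0.
pose m1 := pushforward (mrestr Pr mPA) V_mfun.
pose m2 := mscale (NngNum PA0) (law Pr mV).
have m1E C : m1 C = Pr (Phi @^-1` A `&` V @^-1` C) by rewrite setIC.
have m2E C : m2 C = Pr (Phi @^-1` A) * Pr (V @^-1` C).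
  by rewrite -[in RHS](fineK PAfin).
rewrite -m1E -m2E; apply: (@borel_measure_unique _ N m1 m2) => //.
  have : m1 setT < +oo by rewrite m1E preimage_setT setIT ltey_eq fin_num_measure.
  by [].
move=> C mC; suff : m1 (box C) = m2 (box C) by [].
rewrite m1E m2E.
rewrite -[V @^-1` box C]/([set w | forall i, C i (V w i 0%R)]) indep//.
by congr (_ * _); rewrite independent_entries.
Qed.

(** By independence the joint law of design and noise is a product measure, so the design can be
    frozen. For almost every frozen design [gauss_isometry] gives the same value, and integrating
    that constant changes nothing. *)
Lemma law_random_isometry m (U : 'M[R]_(N, n) -> 'M[R]_(m, N)) (A : set (borel m 1)) :
  random_matrix (U : borel N n -> 'M[R]_(m, N)) ->
  {ae Pr, forall w, U (Phi w) *m (U (Phi w))^T = 1%:M}%R ->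
  measurable A -> Pr [set w | A (U (Phi w) *m V w)%R] = gauss sigma A.
Proof.
move=> mU aeU mA.
pose J w : borel N n * borel N 1 := (Phi w, V w).
have mJ : measurable_fun setT J by apply/measurable_fun_pairP; split.
pose J_mixin := isMeasurableFun.Build _ _ _ _ J mJ.
pose J_mfun : {mfun T >-> (borel N n * borel N 1)%type} := HB.pack J J_mixin.
pose C : set (borel N n * borel N 1) := [set z | A (U z.1 *m (z.2 : 'cV[R]_N))%R].
have mC : measurable C.
  have mUv : random_matrix (fun z : borel N n * borel N 1 =>
      (U z.1 *m (z.2 : 'cV[R]_N))%R).
    apply: random_matrixM => i j.
      exact: measurableT_comp (mU i j) measurable_fst.
    exact: measurableT_comp (@random_matrix_id R N 1 i j) measurable_snd.
  by have := random_matrix_borel mUv measurableT mA; rewrite setTI.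
have E : (law Pr mPhi \x law Pr mV) C = pushforward Pr J_mfun C.
  apply: (product_measure_unique (m' := pushforward Pr J_mfun)) => // A1 B1 mA1 mB1.
  by rewrite -[LHS]/(Pr (Phi @^-1` A1 `&` V @^-1` B1)) independent_law.
rewrite -[LHS]/(pushforward Pr J_mfun C) -E /product_measure1.
pose g (phi : borel N n) := law Pr mV (xsection C phi).
have mg : measurable_fun setT g by exact: measurable_fun_xsection.
rewrite (ge0_integral_law Pr mPhi mg); last by move=> x; exact: measure_ge0.
rewrite -[RHS]mule1 -(@probability_setT _ _ _ Pr) -integral_cst//.
apply: ae_eq_integral => //.
  exact: measurableT_comp mg mPhi'.
apply: filterS aeU => w UU _; rewrite /g lawE /=.
have -> : xsection C (Phi w) = [set v : 'cV[R]_N | A (U (Phi w) *m v)%R].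
  by apply/seteqP; split => v /=; rewrite xsectionE.
rewrite (law_gauss mV V_gam independent_entries).
  exact: (gauss_isometry s0 mA UU).
have mUw : random_matrix (fun v : borel N 1 => (U (Phi w) *m (v : 'cV[R]_N))%R).
  by apply: random_matrixM; [exact: random_matrix_cst|exact: random_matrix_id].
by have := random_matrix_borel mUw measurableT mA; rewrite setTI.
Qed.

End independent_design.

(** * Whitened noise *)

Definition rsqrtn {R : realType} (N : nat) : R := (Num.sqrt N%:R)^-1.

Section rsqrtn_theory.
Context {R : realType}.
Local Notation rs := (@rsqrtn R).

Lemma rsqrtn_gt0 N : (0 < N)%N -> 0 < rs N.
Proof. by move=> N0; rewrite invr_gt0 sqrtr_gt0 ltr0n. Qed.

Lemma sqr_rsqrtn N : rs N ^+ 2 = N%:R^-1.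
Proof. by rewrite exprVn sqr_sqrtr. Qed.

Lemma cvg_rsqrtn : rs @ \oo --> (0 : R).
Proof.
have -> : rs = (fun N => Num.sqrt (N%:R^-1)) by apply/funext => N; rewrite sqrtrV.
rewrite -[X in _ --> X]sqrtr0.
apply: continuous_cvg; first exact: sqrt_continuous.
by rewrite -cvg_shiftS; exact: cvg_harmonic.
Qed.

End rsqrtn_theory.

Section scaled_cost.
Context {R : realType} {p n : nat} (sigma : R) (theta0 : 'cV[R]_n).
Variables (Om : set 'cV[R]_p) (P : 'cV[R]_p -> 'M[R]_n).
Hypothesis s0 : 0 < sigma.
Hypothesis (oOm : open Om) (C2P : C2_on Om P).
Hypothesis pP : forall eta, Om eta -> posdef (P eta).

Lemma GcostZ (c : R) (B D : 'M[R]_n) t Q :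
  Gcost sigma (c *: B) D t Q = c * Gcost sigma B D t Q.
Proof.
rewrite /Gcost; move: (invmx _) => M.
have -> : M *m (c *: B) *m M = c *: (M *m B *m M).
  by rewrite -scalemxAr -scalemxAl.
by rewrite -[c *: B *m M]scalemxAl mxtraceZ bformZ; ring.
Qed.

(* [chol B *m (whitening Phi *m v)] is sqrt N times the error of the least squares
   estimate; the rows of the whitening matrix are orthonormal. *)
Definition whitening (N : nat) (Phi : 'M[R]_(N, n)) : 'M[R]_(n, N) :=
  let B := invmx (N%:R^-1 *: (Phi^T *m Phi)) in
  rsqrtn N *: (invmx (chol B) *m B *m Phi^T).

Section fixed_design.
Variables (N : nat) (Phi : 'M[R]_(N, n)) (v : 'cV[R]_N) (eta : 'cV[R]_p).
Hypothesis N0 : (0 < N)%N.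
Hypothesis rPhi : \rank Phi = n.
Let S := Phi^T *m Phi.
Let A := N%:R^-1 *: S.
Let B := invmx A.
Let s : R := rsqrtn N.

Let N0' : 0 < (N%:R^-1 : R). Proof. by rewrite invr_gt0 ltr0n. Qed.
Let pS : posdef S. Proof. exact: posdef_gram. Qed.
Let pA : posdef A. Proof. exact: posdefZ. Qed.
Let pB : posdef B. Proof. exact: posdef_invmx. Qed.
Let uchol : chol B \in unitmx.
Proof.
have := posdef_unit pB; rewrite -{1}(chol_correct pB) unitmx_mul.
by move=> /andP[].
Qed.

(** Since [s^2 Phi^T Phi] is the inverse of [B], the product collapses to [B] between the inverse of
    [chol B] and its transpose, which is the identity. *)
Lemma whitening_isometry : whitening Phi *m (whitening Phi)^T = 1%:M.
Proof.
have WT : (whitening Phi)^T = s *: (Phi *m B *m (invmx (chol B))^T).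
  rewrite /whitening linearZ /= !trmx_mul trmxK -/S -/A -/B; congr (_ *: _).
  by rewrite (posdef_tr pB) mulmxA.
have EB : invmx (chol B) *m B *m (invmx (chol B))^T = 1%:M.
  rewrite -{2}(chol_correct pB) mulKmx// -trmx_mul mulVmx//.
  by rewrite trmx1.
have EA : B *m (s ^+ 2 *: (Phi^T *m Phi)) = 1%:M.
  by rewrite sqr_rsqrtn -/S -/A mulVmx// posdef_unit.
rewrite WT /whitening -/S -/A -/B -scalemxAl -scalemxAr scalerA -expr2.
rewrite -EB; move: (invmx (chol B)) => K.
rewrite -[in RHS](mul1mx B) -EA.
by rewrite -!scalemxAr -!scalemxAl -?scalemxAr -?scalemxAl !mulmxA.
Qed.

Lemma theta_ls_whitening : invmx S *m Phi^T *m (Phi *m theta0 + v) =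
  theta0 + s *: (chol B *m (whitening Phi *m v)).
Proof.
have uS := posdef_unit pS.
have BE : invmx S = (s ^+ 2) *: B.
  rewrite sqr_rsqrtn /B /A invmxZ ?posdef_unit// scalerA mulfV ?scale1r//.
  by rewrite gt_eqF.
rewrite mulmxDr; congr (_ + _).
  by rewrite mulmxA -(mulmxA (invmx S)) mulVmx// mul1mx.
rewrite /whitening -/S -/A -/B -scalemxAl -scalemxAr scalerA -expr2 BE.
rewrite -!scalemxAl -!mulmxA mulKVmx//.
Qed.

Hypothesis eta_min : argmin_on Om
  (fun eta => cost_Sy sigma Phi (Phi *m theta0 + v) (P eta)) eta.
Let D := (s ^+ 2 * sigma ^+ 2) *: B.
Let t := theta0 + s *: (chol B *m (whitening Phi *m v)).

(** The terms of the cost free of [P] cancel in the comparison, and the factor [1 / N] comes out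
    because [Gcost] is homogeneous in [B] for fixed [D]. *)
Lemma Gcost_argmin y : Om y ->
  Gcost sigma B D t (P eta) <= Gcost sigma B D t (P y).
Proof.
move=> Omy; have [Ome /(_ y Omy)] := eta_min.
have BE : invmx S = N%:R^-1 *: B.
  rewrite /B /A invmxZ ?posdef_unit// scalerA mulfV ?scale1r//.
  by rewrite gt_eqF.
rewrite !(cost_SyE_unnormalized s0 pS); [|exact: pP|exact: pP].
rewrite theta_ls_whitening -/t BE scalerA !GcostZ.
rewrite (_ : sigma ^+ 2 * _ = s ^+ 2 * sigma ^+ 2); last by rewrite sqr_rsqrtn mulrC.
by rewrite -/D lerD2l ler_pM2l.
Qed.

Lemma Ggrad_argmin (k : 'I_p) : Ggrad sigma B D t (P eta) (partial k P eta) = 0.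
Proof.
have [Ome _] := eta_min.
apply: (@Gcost_min_grad0 _ _ _ sigma Om P oOm C2P pP B D t eta k Ome).
- apply: posdefD; first exact: pP.
  apply: posdefZ => //.
  by rewrite sqr_rsqrtn mulr_gt0// exprn_gt0.
- exact: posdef_tr.
- by move=> y Omy; exact: Gcost_argmin.
Qed.

End fixed_design.
End scaled_cost.

(** * Expansion uniform over the data *)

Section uniform_expansion.
Context {R : realType} {p n : nat}.
Variables (theta0 : 'cV[R]_n) (sigma : R) (Sigma : 'M[R]_n).
Variables (Om : set 'cV[R]_p) (P : 'cV[R]_p -> 'M[R]_n) (eta_y : 'cV[R]_p).
Hypothesis pSigma : posdef Sigma.
Hypothesis (oOm : open Om) (C2P : C2_on Om P).
Hypothesis pP : forall eta, Om eta -> posdef (P eta).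
Hypothesis eta_y_min : argmin_on Om (W_y theta0 sigma Sigma P) eta_y.
Hypothesis uC : C_y theta0 sigma Sigma P eta_y \in unitmx.
Variable K : set 'cV[R]_p.
Hypothesis (cK : compact K) (KOm : K `<=` Om).
Hypothesis K_min : K `&` argmin_on Om (W_y theta0 sigma Sigma P) `<=` [set eta_y].

(** The asymptotic linear response of the rescaled estimation error to the whitened noise. *)
Definition limit_mx : 'M[R]_(p, n) := - (invmx (C_y theta0 sigma Sigma P eta_y) *m
  (score_mx theta0 sigma Sigma P eta_y *m chol (invmx Sigma))).

Let D (s : R) (A : 'M[R]_n) := (s ^+ 2 * sigma ^+ 2) *: invmx A.
Let t (s : R) (A : 'M[R]_n) (xi : 'cV[R]_n) :=
  theta0 + s *: (chol (invmx A) *m xi).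

(** A deterministic snapshot of one sample: the scale [1 / sqrt N], the normalized Gram matrix, the
    whitened noise and the estimate. *)
Record design := Design {
  dscale : R; dgram : 'M[R]_n; dnoise : 'cV[R]_n; destimate : 'cV[R]_p }.

Local Notation "i .s" := (dscale i) (at level 2, format "i .s").
Local Notation "i .A" := (dgram i) (at level 2, format "i .A").
Local Notation "i .xi" := (dnoise i) (at level 2, format "i .xi").
Local Notation "i .eta" := (destimate i) (at level 2, format "i .eta").

Let G i := Gcost sigma (invmx i.A) (D i.s i.A) (t i.s i.A i.xi).

Record near_limit (L e : R) (i : design) : Prop := NearLimit {
  nl_scale : 0 < i.s < e;
  nl_gram : `|i.s^-1 *: (i.A - Sigma)| < e;
  nl_noise : `|i.xi| <= L;
  nl_K : K i.eta;
  nl_min : forall y, Om y -> G i (P i.eta) <= G i (P y);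
  nl_grad : forall k, Ggrad sigma (invmx i.A) (D i.s i.A) (t i.s i.A i.xi)
    (P i.eta) (partial k P i.eta) = 0 }.

(* Taking limits along this filter makes the expansion uniform over all designs, noises
   and minimizers, so that no measurable selection or almost sure representation is
   needed. *)
Definition limit_designs L : set_system design :=
  [set S | exists2 e, 0 < e & near_limit L e `<=` S].

#[local] Instance limit_designs_filter L : Filter (limit_designs L).
Proof.
split.
- by exists 1.
- move=> S S' [e e0 eS] [e' e'0 eS']; exists (Num.min e e').
    by rewrite lt_min e0.
  move=> i [/andP[si]]; rewrite !lt_min => /andP[se se'] /andP[Ae Ae'] xiL Ki mi gi.
  by split; [apply: eS|apply: eS']; split => //; apply/andP.
- by move=> S S' SS' [e e0 eS]; exists e => // i /eS /SS'.
Qed.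

Lemma expansion_cvg L : cvgm (limit_designs L)
  (fun i => i.s^-1 *: (i.eta - eta_y) - limit_mx *m i.xi) 0.
Proof.
set F := limit_designs L.
have FF : Filter F by exact: limit_designs_filter.
have nl : \forall i \near F, near_limit L 1 i by exists 1.
have s0 : \forall i \near F, 0 < i.s.
  by apply: filterS nl => i [/andP[]].
have cs : i.s @[i --> F] --> (0 : R).
  apply/cvgr0Pnorm_lt => e e0; exists e => // i [/andP[s0' se] _ _ _ _ _].
  by rewrite gtr0_norm.
have cA0 : cvgm F (fun i => i.s^-1 *: (i.A - Sigma)) 0.
  by apply/cvg_mxP/cvgr0Pnorm_lt => e e0; exists e => // i [].
have cA : cvgm F (fun i => i.A) Sigma.
  pose proof (cvgmD (cvgmZ cs cA0) (@cvgm_cst _ _ F _ _ _ Sigma)) as H.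
  rewrite scaler0 add0r in H; apply: (near_eq_cvgm _ H).
  apply: filterS s0 => i s0.
  by rewrite scalerA mulfV ?gt_eqF// scale1r subrK.
have cB : cvgm F (fun i => invmx i.A) (invmx Sigma).
  by apply: cvgm_invmx => //; exact: posdef_unit.
have cch : cvgm F (fun i => chol (invmx i.A)) (chol (invmx Sigma)).
  by apply: cvgm_chol => //; exact: posdef_invmx.
have bxi : bddm F (fun i => i.xi).
  exists L; apply: filterS nl => i [_ _ xiL _ _ _] a b.
  by apply: le_trans xiL; exact: mx_norm_ge.
have bz : bddm F (fun i => chol (invmx i.A) *m i.xi).
  by apply: bddmM => //; exact: cvgm_bddm cch.
have cD : cvgm F (fun i => D i.s i.A) 0.
  rewrite -(scale0r (invmx Sigma)); apply: cvgmZ => //.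
  rewrite -[X in _ --> X](mul0r (sigma ^+ 2)).
  apply: cvgM; last exact: cvg_cst.
  by rewrite -[X in _ --> X](mul0r 0); apply: cvgM.
have ct : cvgm F (fun i => t i.s i.A i.xi) theta0.
  have c0 : cvgm F (fun i => (i.s *: (1%:M : 'M[R]_n)) *m (chol (invmx i.A) *m i.xi)) 0.
    apply: cvgm_mul_bddm0 => //.
    by rewrite -(scale0r (1%:M : 'M[R]_n)); apply: cvgmZ => //; exact: cvgm_cst.
  pose proof (cvgmD (@cvgm_cst _ _ F _ _ _ theta0) c0) as H.
  rewrite addr0 in H; apply: (near_eq_cvgm _ H); apply: nearW => i.
  by rewrite /t -scalemxAl mul1mx.
have ceta : i.eta @[i --> F] --> eta_y.
  apply/cvgrPdist_lt => e e0.
  have Ub : ball eta_y e eta_y by exact: ballxx.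
  have H : \forall i \near F, forall eta, K eta -> ~ ball eta_y e eta ->
      G i (P eta_y) < G i (P eta).
    pose proof (ball_open eta_y e) as bo.
    pose proof (near_Gcost_gt oOm C2P pP eta_y_min cK KOm K_min bo Ub) as H1.
    exact: (H1 _ F FF _ _ _ cB cD ct).
  apply: filterS2 nl H => i [_ _ _ Ki mi _] H.
  (* A minimizer in [K] outside the ball would cost strictly more than [eta_y], against [nl_min]. *)
  have : ball eta_y e i.eta.
    apply: contrapT => nU; have := H _ Ki nU.
    by rewrite ltNge mi//; case: eta_y_min.
  by rewrite -ball_normE.
have ng : \forall i \near F, forall k,
    Ggrad sigma (invmx i.A) (D i.s i.A) (t i.s i.A i.xi)
      (P i.eta) (partial k P i.eta) = 0.
  by apply: filterS nl => i [].
pose proof (delta_expansion pSigma oOm C2P pP eta_y_min uC s0 cs cA0 ceta bz ng) as H1.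
move: H1.
set Ci := invmx (C_y _ _ _ _ _); set Lm := score_mx _ _ _ _ _ => H1.
(* The Cholesky factor still varies with the design; since the noise is bounded, replacing it by its
   limit costs [o(1)]. *)
have dch : cvgm F (fun i => Ci *m (Lm *m (chol (invmx Sigma) - chol (invmx i.A)))) 0.
  pose proof (cvgmM (@cvgm_cst _ _ F _ _ _ Ci) (cvgmM (@cvgm_cst _ _ F _ _ _ Lm)
    (cvgmB (@cvgm_cst _ _ F _ _ _ (chol (invmx Sigma))) cch))) as H.
  by rewrite subrr !mulmx0 in H.
pose proof (cvgmD H1 (cvgm_mul_bddm0 dch bxi)) as H.
rewrite addr0 in H; apply: (near_eq_cvgm _ H); apply: nearW => i.
rewrite /limit_mx -/Ci -/Lm mulNmx opprK -addrA; congr (_ + _).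
rewrite -!mulmxA -!mulmxDr; congr (_ *m (_ *m _)).
by rewrite mulmxBl addrC subrK.
Qed.

Lemma uniform_expansion L eps : 0 < eps -> exists2 e, 0 < e & forall s A xi eta,
  0 < s < e -> `|s^-1 *: (A - Sigma)| < e -> `|xi| <= L -> K eta ->
  (forall y, Om y -> Gcost sigma (invmx A) (D s A) (t s A xi) (P eta) <=
    Gcost sigma (invmx A) (D s A) (t s A xi) (P y)) ->
  (forall k, Ggrad sigma (invmx A) (D s A) (t s A xi) (P eta) (partial k P eta) = 0) ->
  `|s^-1 *: (eta - eta_y) - limit_mx *m xi| <= eps.
Proof.
move=> eps0.
have /cvg_mxP /cvgr0Pnorm_le /(_ _ eps0)[e e0 eH] := expansion_cvg L.
exists e => // s A xi eta sA AS xL Ke me ge.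
by apply: (eH (Design s A xi eta)); split.
Qed.

End uniform_expansion.

(** * Convergence in distribution by coupling *)

Section compactness.
Context {R : realType}.

Lemma compact_mx_le m (L : R) : compact [set y : 'cV[R]_m | `|y| <= L].
Proof.
(* Transposition transfers compactness of closed bounded sets of row vectors. *)
have -> : [set y : 'cV[R]_m | `|y| <= L] = trmx @` [set x : 'rV[R]_m | `|x^T| <= L].
  apply/seteqP; split=> [y yL|_ [x xL <-]//].
  by exists y^T; rewrite /= trmxK.
have cT : continuous (trmx : 'rV[R]_m -> 'cV[R]_m).
  move=> x; apply/(@cvg_mxP _ _ (nbhs x) (nbhs_filter x)).
  by apply: cvgmT; apply/(@cvg_mxP _ _ (nbhs x) (nbhs_filter x)).
apply: continuous_compact; first exact: continuous_subspaceT.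
apply: bounded_closed_compact.
  exists L; split; first exact: num_real.
  move=> M LM x /= xL; have M0 : 0 <= M.
    by rewrite (le_trans _ (ltW LM))// (le_trans _ xL).
  apply: mx_norm_le => // i j.
  have := mx_norm_ge x^T j i; rewrite mxE => xn.
  exact: le_trans (le_trans xn xL) (ltW LM).
apply: (@preimage_closed _ _ (fun x : 'rV[R]_m => `|x^T|) [set r | r <= L]).
  move=> x _; have cx := cT x.
  exact: (cvg_norm cx).
exact: closed_le.
Qed.

(** A test function is merely continuous, so its modulus is controlled only near the compact image
    of a ball; the coupling argument pays for the outside by a tail probability. *)
Lemma uniform_continuity_near_compact m p (J : 'M[R]_(p, m)) (f : 'cV[R]_p -> R)
    (L e : R) : continuous f -> 0 < e ->
  exists2 d, 0 < d & forall y, `|y| <= L -> forall x, `|x - J *m y| <= d ->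
    `|f x - f (J *m y)| <= e.
Proof.
move=> cf e0.
have /compact_near_coveringP cK := compact_mx_le (m := m) (L := L).
pose Q (h : 'cV[R]_p) (y : 'cV[R]_m) := `|f (J *m y + h) - f (J *m y)| <= e.
have : \forall h \near (0 : 'cV[R]_p), [set y : 'cV[R]_m | `|y| <= L] `<=` Q h.
  apply: (cK _ (nbhs (0 : 'cV[R]_p)) Q (nbhs_filter _)) => y yL.
  have FFy := nbhs_filter y; have FF0 := nbhs_filter (0 : 'cV[R]_p).
  pose F := filter_prod (nbhs y) (nbhs (0 : 'cV[R]_p)).
  have FF : Filter F by exact: filter_prod_filter.
  have c1 : cvgm F (fun z => J *m z.1) (J *m y).
    apply: cvgmM; first exact: cvgm_cst.
    by apply/cvg_mxP; exact: cvg_fst.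
  have c2 : cvgm F (fun z => J *m z.1 + z.2) (J *m y).
    rewrite -[X in cvgm _ _ X]addr0; apply: cvgmD => //.
    by apply/cvg_mxP; exact: cvg_snd.
  have f1 : f (J *m z.1) @[z --> F] --> f (J *m y).
    exact: cvg_comp ((@cvg_mxP _ _ F FF _ _ _ _).2 c1) (cf (J *m y)).
  have f2 : f (J *m z.1 + z.2) @[z --> F] --> f (J *m y).
    exact: cvg_comp ((@cvg_mxP _ _ F FF _ _ _ _).2 c2) (cf (J *m y)).
  pose proof (cvgB f2 f1) as f3; rewrite subrr in f3.
  have := (@cvgr0Pnorm_le _ _ _ F FF _).1 f3 e e0.
  by [].
move=> /nbhs_normP[d /= d0 dQ]; exists (d / 2); first exact: divr_gt0.
move=> y yL x xd; have := dQ (x - J *m y) _ y yL.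
rewrite /Q /= [J *m y + _]addrC subrK; apply.
rewrite /ball_ /= sub0r normrN (le_lt_trans xd)//.
by rewrite ltr_pdivrMr// ltr_pMr// ltr1n.
Qed.

End compactness.

Lemma measurable_norm_gt {R : realType} m n (L : R) :
  measurable ([set y : 'M[R]_(m, n) | L < `|y|] : set (borel m n)).
Proof.
apply: sub_sigma_algebra.
apply: (@open_comp _ _ (fun y : 'M[R]_(m, n) => `|y|) [set r | L < r]).
  by move=> x _; exact: norm_continuous.
exact: open_gt.
Qed.

Section coupling.
Context {R : realType} {d : measure_display} {T : measurableType d}.
Variable Pr : probability T R.

Lemma probability_norm_tail m n (gamma : probability (borel m n) R) (e : R) :
  0 < e -> exists L : R, (gamma [set y : 'M[R]_(m, n) | (L < `|y|)%R] <= e%:E)%E.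
Proof.
move=> e0.
pose A (k : nat) : set (borel m n) := [set y : 'M[R]_(m, n) | k%:R < `|y|].
have mA k : measurable (A k) by exact: measurable_norm_gt.
have A0 : \bigcap_k A k = set0.
  apply/seteqP; split=> // y Ay; have := Ay (Num.truncn `|y : 'M[R]_(m, n)|).+1 I.
  by rewrite /A /= ltNge (ltW (truncnS_gt _)).
have : gamma (A k) @[k --> \oo] --> 0%E.
  rewrite -(measure0 gamma) -A0; apply: nonincreasing_cvg_mu => //.
  - by rewrite ltey_eq fin_num_measure.
  - by rewrite A0.
  - move=> i j ij; apply/subsetPset => y; rewrite /A /=.
    by apply: le_lt_trans; rewrite ler_nat.
move=> /fine_cvgP[_ /cvgr0Pnorm_le /(_ e e0)[k _ /(_ k (leqnn k))]] /=.
rewrite ger0_norm ?fine_ge0// => H; exists k%:R.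
by rewrite -[leLHS]fineK ?fin_num_measure//; exact: mA.
Qed.

Lemma random_matrix_mulmx p m (J : 'M[R]_(p, m)) :
  random_matrix (fun y : borel m 1 => J *m (y : 'cV[R]_m)).
Proof.
by apply: random_matrixM; [exact: random_matrix_cst|exact: random_matrix_id].
Qed.

Lemma integrable_bounded_continuous m n (X : T -> 'M[R]_(m, n)) (f : 'M[R]_(m, n) -> R) c :
  random_matrix X -> continuous f -> (forall x, `|f x| <= c) ->
  Pr.-integrable setT (EFin \o (f \o X)).
Proof.
move=> mX cf fc; apply: measurable_bounded_integrable => //.
- by rewrite ltey_eq fin_num_measure.
- exact: measurableT_comp (measurable_continuous_borel cf) (random_matrix_borel mX).
- exists c; split; first exact: num_real.
  by move=> M cM w _; exact: le_trans (fc _) (ltW cM).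
Qed.

End coupling.

Section cvg_in_distribution_coupling.
Context {R : realType} {d : measure_display} {T : measurableType d}.
Variables (Pr : probability T R) (p m : nat).
Variables (X : nat -> T -> 'cV[R]_p) (Y : nat -> T -> 'cV[R]_m) (J : 'M[R]_(p, m)).
Variable gamma : probability (@borel R m 1) R.
Hypothesis mX : forall N, random_matrix (X N).
Hypothesis mY : forall N, random_matrix (Y N).
Hypothesis law_Y : \forall N \near \oo,
  forall A : set (borel m 1), measurable A -> Pr (Y N @^-1` A) = gamma A.
Hypothesis XY : forall L eps e : R, 0 < eps -> 0 < e ->
  \forall N \near \oo, exists B, [/\ measurable B, (Pr B <= e%:E)%E &
    forall w, ~ B w -> `|Y N w| <= L -> `|X N w - J *m Y N w| <= eps].

(** For large [N] the expectation of [f (J Y_N)] equals the limit exactly, so only the mean of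
    [|f X_N - f (J Y_N)|] is to be bounded: it is small on the good event, and at most [2 c] on an
    event of small probability. *)
Lemma cvg_in_distribution_coupling :
  cvg_in_distribution Pr X (law gamma (random_matrix_mulmx J)).
Proof.
move=> f cf [c fc].
have c0 : 0 <= c by rewrite (le_trans _ (fc 0)).
set lim := (\int[_]_x _)%E.
have cJ : continuous (fun y : 'cV[R]_m => f (J *m y)).
  move=> y; have FFy := nbhs_filter y.
  have cy : cvgm (nbhs y) (fun z => J *m z) (J *m y).
    by apply: cvgmM; [exact: cvgm_cst|apply/cvg_mxP].
  exact: cvg_comp ((@cvg_mxP _ _ _ FFy _ _ _ _).2 cy) (cf (J *m y)).
have intJ : gamma.-integrable setT (EFin \o (fun y : 'cV[R]_m => f (J *m y))).
  exact: (integrable_bounded_continuous gamma (random_matrix_id (R := R) (m := m) (n := 1)) cJ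
    (fun y => fc _)).
have limE : lim = (\int[gamma]_y (f (J *m y))%:E)%E.
  rewrite /lim integral_law//.
  by apply/measurable_EFinP; exact: measurable_continuous_borel.
have limY : \forall N \near \oo, lim = (\int[Pr]_w (f (J *m Y N w))%:E)%E.
  apply: filterS law_Y => N lawN; rewrite limE.
  have intY := integrable_bounded_continuous Pr (mY N) cJ (fun y => fc _).
  rewrite -(@integral_law _ _ _ Pr _ _ _ (mY N) (fun y => (f (J *m y))%:E))//; last first.
    by apply/measurable_EFinP; exact: measurable_continuous_borel.
  by apply: eq_measure_integral => A mA _; exact/esym/lawN.
have intX N := integrable_bounded_continuous Pr (mX N) cf fc.
rewrite unlock.
have limfin : lim = (fine lim)%:E by rewrite fineK// limE; exact: integrable_fin_num.
rewrite limfin; apply: cvg_EFin.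
  by apply: nearW => N; exact: (integrable_fin_num measurableT (intX N)).
apply/cvgrPdist_le => e e0.
have e2 : 0 < e / 2 by exact: divr_gt0.
(* The exceptional event has probability at most [2 * eps] and costs at most [2 * c], in all
   [4 * c * eps]; the summand 1 avoids dividing by zero when [c = 0]. *)
have [eps eps0 feps] : exists2 eps, 0 < eps & eps * (4 * c + 1) <= e / 2.
  exists (e / 2 / (4 * c + 1)).
    by rewrite divr_gt0// ltr_wpDl// mulr_ge0.
  by rewrite divfK// gt_eqF// ltr_wpDl// mulr_ge0.
have [L gL] := probability_norm_tail gamma eps0.
have [dl dl0 fdl] := uniform_continuity_near_compact J L cf e2.
near=> N.
have [B [mB PB BX]] : exists B, [/\ measurable B, (Pr B <= eps%:E)%E &
    forall w, ~ B w -> `|Y N w| <= L -> `|X N w - J *m Y N w| <= dl].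
  by near: N; exact: XY.
have lawN : forall A : set (borel m 1), measurable A -> Pr (Y N @^-1` A) = gamma A.
  by near: N.
have -> : lim = (\int[Pr]_w (f (J *m Y N w))%:E)%E by near: N.
have intY := integrable_bounded_continuous Pr (mY N) cJ (fun y => fc _).
pose B' := Y N @^-1` [set y : 'cV[R]_m | L < `|y|].
have mB' : measurable B'.
  rewrite -[B']setTI.
  exact: (random_matrix_borel (mY N) measurableT (@measurable_norm_gt _ _ _ L)).
have PB' : (Pr B' <= eps%:E)%E by rewrite lawN//; exact: measurable_norm_gt.
pose E := B `|` B'.
have mE : measurable E by exact: measurableU.
have PE : fine (Pr E) <= 2 * eps.
  rewrite -lee_fin fineK ?fin_num_measure//.
  rewrite (le_trans (measureU2 _ mB mB'))//.
  by rewrite mulr_natl mulr2n EFinD leeD.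
have int1 : Pr.-integrable setT (EFin \o (fun w => 2 * c * \1_E w : R)).
  by apply: (integrableZl measurableT (2 * c) (integrable_indic Pr mE)).
have intc : Pr.-integrable setT (EFin \o (cst (e / 2) : T -> R)).
  exact: finite_measure_integrable_cst.
rewrite -RintegralB//.
have intB := integrableB measurableT intY (intX N).
apply: le_trans; first exact: (le_normr_Rintegral measurableT intB).
apply: (@le_trans _ _ (\int[Pr]_w (e / 2 + 2 * c * \1_E w))).
  apply: le_Rintegral => //.
  - exact: (integrable_abse intB).
  - exact: (integrableD measurableT intc int1).
  move=> w _.
  have [Ew|nEw] := pselect (E w).
    rewrite indicE mem_set// mulr1 (le_trans (ler_normB _ _))//.
    rewrite mulr_natl mulr2n (le_trans (lerD (fc _) (fc _)))// lerDr ltW//.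
  rewrite indicE memNset// mulr0 addr0 distrC.
  have YL : `|Y N w| <= L by rewrite leNgt; apply/negP => H; apply: nEw; right.
  by apply: fdl => //; apply: BX => // Bw; apply: nEw; left.
rewrite RintegralD// Rintegral_cst// RintegralZl//; last exact: integrable_indic.
rewrite [X in fine X](_ : _ = 1%E) ?mulr1; last exact: probability_setT.
have -> : \int[Pr]_w (\1_E w : R) = fine (Pr E).
  by rewrite /Rintegral integral_indic// setIT.
have : 2 * c * fine (Pr E) <= 2 * c * (2 * eps).
  by rewrite ler_wpM2l// mulr_ge0.
move: feps; lra.
Unshelve. all: by end_near. Qed.

End cvg_in_distribution_coupling.

(** * The limit law *)

Section limit_law.
Context {R : realType} {p n : nat}.
Variables (theta0 : 'cV[R]_n) (sigma : R) (Sigma : 'M[R]_n).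
Variables (Om : set 'cV[R]_p) (P : 'cV[R]_p -> 'M[R]_n) (eta : 'cV[R]_p).
Hypothesis s0 : 0 < sigma.
Hypothesis pSigma : posdef Sigma.
Hypothesis (oOm : open Om) (C2P : C2_on Om P).
Hypothesis pP : forall eta, Om eta -> posdef (P eta).
Hypothesis Ome : Om eta.

Lemma partial_invmx_tr k :
  (partial k (fun x => invmx (P x)) eta)^T = partial k (fun x => invmx (P x)) eta.
Proof.
rewrite (partial_invmx C2P pP k Ome) linearN /= !trmx_mul (posdef_tr (posdef_invmx (pP Ome))).
rewrite (@C2_partial_tr _ _ _ Om P oOm C2P eta k Ome) ?mulmxA// => y /pP.
exact: posdef_tr.
Qed.

Lemma C_y_tr : (C_y theta0 sigma Sigma P eta)^T = C_y theta0 sigma Sigma P eta.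
Proof.
have SiT : (invmx Sigma)^T = invmx Sigma by exact/posdef_tr/posdef_invmx.
apply/matrixP => k l; rewrite !mxE.
have := partial2_invmxC oOm C2P pP k l Ome.
have := partial_invmx_tr k; have := partial_invmx_tr l.
move: (partial k (partial l _) eta) (partial l (partial k _) eta) => Pkl Plk.
move: (partial k _ eta) (partial l _ eta) => Pk Pl PlT PkT ->.
congr (_ * (_ + _ - _)).
by rewrite bform_tr !trmx_mul PlT PkT SiT mulmxA.
Qed.

(** Row [k] of the score matrix is [2 sigma^4] times [theta0^T B_k] with [B_k] symmetric; thus [D_y]
    is the covariance of the score under noise of covariance [sigma^2 Sigma^-1]. *)
Lemma D_y_score_mx : D_y theta0 sigma Sigma P eta = sigma ^+ 2 *:
  (score_mx theta0 sigma Sigma P eta *m invmx Sigma *m (score_mx theta0 sigma Sigma P eta)^T).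
Proof.
have SiT : (invmx Sigma)^T = invmx Sigma by exact/posdef_tr/posdef_invmx.
have PiT := posdef_tr (posdef_invmx (pP Ome)).
have PkT := partial_invmx_tr.
set L := score_mx _ _ _ _ _.
pose B k := invmx (P eta) *m invmx Sigma *m partial k (fun x => invmx (P x)) eta
  + partial k (fun x => invmx (P x)) eta *m invmx Sigma *m invmx (P eta).
have BT k : (B k)^T = B k.
  by rewrite /B linearD /= !trmx_mul PkT SiT PiT !mulmxA addrC.
have rowL k : row k L = (2 * sigma ^+ 4) *: (theta0^T *m B k).
  by apply/rowP => j; rewrite !mxE; congr (_ * _); rewrite -mxE.
apply/matrixP => k l; rewrite mxE [RHS]mxE -/(B k) -/(B l).
have -> : (L *m invmx Sigma *m L^T) k l = (row k L *m invmx Sigma *m (row l L)^T) 0 0.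
  by rewrite -row_mul mxE [RHS]mxE; apply: eq_bigr => j _; rewrite !mxE.
rewrite !rowL linearZ /= trmx_mul trmxK BT -!scalemxAl -scalemxAr 2!mxE mulmxA.
by rewrite /bform !mulmxA; ring.
Qed.

(** In [J J^T] the Cholesky factors multiply to the inverse of [Sigma], and symmetry of [C_y] puts
    the same inverse on both sides. *)
Lemma limit_mx_sandwich (a : 'cV[R]_p) : C_y theta0 sigma Sigma P eta \in unitmx ->
  let J := limit_mx theta0 sigma Sigma P eta in
  sigma ^+ 2 * ((J^T *m a)^T *m (J^T *m a)) 0 0 =
  bform a (invmx (C_y theta0 sigma Sigma P eta) *m D_y theta0 sigma Sigma P eta
    *m invmx (C_y theta0 sigma Sigma P eta)) a.
Proof.
move=> uC; rewrite /= D_y_score_mx.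
have CT : (invmx (C_y theta0 sigma Sigma P eta))^T = invmx (C_y theta0 sigma Sigma P eta).
  by rewrite trmx_inv C_y_tr.
rewrite -(chol_correct (posdef_invmx pSigma)) /limit_mx.
move: (invmx (C_y _ _ _ _ _)) (score_mx _ _ _ _ _) (chol _) CT => Ci L H CT.
rewrite -scalemxAr -scalemxAl bformZ /bform; congr (_ * _).
have KT : (- (Ci *m (L *m H)))^T = - (H^T *m L^T *m Ci).
  by rewrite [LHS]linearN /= !trmx_mul CT.
by rewrite trmx_mul trmxK KT mulmxN !mulNmx mulmxN opprK !mulmxA.
Qed.

Lemma multivariate_normal_limit_mx :
  C_y theta0 sigma Sigma P eta \in unitmx ->
  multivariate_normal 0
    (invmx (C_y theta0 sigma Sigma P eta) *m D_y theta0 sigma Sigma P eta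
     *m invmx (C_y theta0 sigma Sigma P eta))
    (law (gauss sigma (N := n)) (random_matrix_mulmx (limit_mx theta0 sigma Sigma P eta))).
Proof.
move=> uC a B mB; rewrite -limit_mx_sandwich//.
set J := limit_mx _ _ _ _ _.
rewrite mulmx0 mxE -gauss_dot// lawE; congr (gauss _ _).
by apply/seteqP; split => y /=; rewrite trmx_mul trmxK mulmxA.
Qed.

End limit_law.

Section measurability.
Context {R : realType} {d : measure_display} {T : measurableType d}.

Lemma random_matrix_gram N n (X : T -> 'M[R]_(N, n)) : random_matrix X ->
  random_matrix (fun w => N%:R^-1 *: ((X w)^T *m X w)).
Proof.
move=> mX; apply: random_matrixZ; first exact: measurable_cst.
by apply: random_matrixM => //; exact: random_matrixT.
Qed.

Lemma random_matrix_whitening N n (X : T -> 'M[R]_(N, n)) : random_matrix X ->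
  random_matrix (fun w => whitening (X w)).
Proof.
move=> mX; have mB := random_matrix_invmx (random_matrix_gram mX).
apply: random_matrixZ; first exact: measurable_cst.
apply: random_matrixM; last exact: random_matrixT.
by apply: random_matrixM => //; apply: random_matrix_invmx; exact: random_matrix_chol.
Qed.

Lemma measurable_frob_norm m n (X : T -> 'M[R]_(m, n)) : random_matrix X ->
  measurable_fun setT (fun w => frob_norm (X w)).
Proof.
move=> mX; apply: measurableT_comp.
  exact: continuous_measurable_fun (@sqrt_continuous R).
apply: measurable_sum => i; apply: measurable_sum => j.
by apply: measurable_funX; exact: mX.
Qed.

Lemma measurable_random_matrix_compact m n (X : T -> 'M[R]_(m, n)) (K : set 'M[R]_(m, n)) :
  random_matrix X -> compact K -> measurable [set w | K (X w)].
Proof.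
move=> mX cK; have cl : closed K by exact: (compact_closed (@norm_hausdorff _ _) cK).
rewrite -[X in measurable X]setTI -[X in _ `&` X]setCK.
have -> : ~` [set w | K (X w)] = X @^-1` (~` K) by [].
apply: (random_matrix_borel mX measurableT (Y := ~` ~` K)).
apply: measurableC; apply: sub_sigma_algebra.
by rewrite /= openC.
Qed.

End measurability.

Lemma mx_norm_le_frob {R : realType} m n (A : 'M[R]_(m, n)) : `|A| <= frob_norm A.
Proof.
apply: mx_norm_le; first exact: sqrtr_ge0.
move=> i j; rewrite -sqrtr_sqr ler_wsqrtr//.
rewrite (bigD1 i)//= (bigD1 j)//= -addrA lerDl addr_ge0//.
  by apply: sumr_ge0 => l _; rewrite sqr_ge0.
by apply: sumr_ge0 => k _; apply: sumr_ge0 => l _; rewrite sqr_ge0.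
Qed.

(** * Exceptional events of small probability *)

Section bad_events.
Context {R : realType} {d : measure_display} {T : measurableType d}.
Variable Pr : probability T R.

Lemma near_probability_compl (A : nat -> set T) (e : R) :
  (forall N, measurable (A N)) -> Pr (A N) @[N --> \oo] --> 1%E -> 0 < e ->
  \forall N \near \oo, (Pr (~` A N) <= e%:E)%E.
Proof.
move=> mA /fine_cvgP[_ /cvgrPdist_le H] e0.
apply: filterS (H e e0) => N /= AN.
rewrite probability_setC// -[X in (1 - X)%E]fineK ?fin_num_measure//.
by rewrite -EFinB lee_fin (le_trans (ler_norm _)).
Qed.

Lemma near_rate_scaled n0 m n (A : nat -> T -> 'M[R]_(m, n)) (delta : nat -> R) (c e : R) :
  (forall N, random_matrix (A N)) ->
  (forall N, (n0 < N)%N -> 0 < delta N) ->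
  bigO_p Pr (fun N w => frob_norm (A N w)) delta ->
  delta =o_\oo (fun N => (Num.sqrt (N%:R : R))^-1) ->
  0 < c -> 0 < e ->
  \forall N \near \oo, exists B, [/\ measurable B, (Pr B <= e%:E)%E &
    forall w, ~ B w -> `|(rsqrtn N)^-1 *: A N w| < c].
Proof.
move=> mA delta0 rate /eqoP small c0 e0.
have [L L0 PL] := rate e e0.
(* Off the event of [bigO_p] the error is at most [L * delta N]; this ratio of [delta N] to
   [1 / sqrt N] turns the bound into [c / 2] after rescaling, which leaves a strict inequality. *)
have cL : 0 < c / (2 * L) by rewrite divr_gt0// mulr_gt0.
near=> N.
have N0 : (n0 < N)%N by near: N; exact: nbhs_infty_gt.
have dN := delta0 N N0.
have N0' : (0 < N)%N by exact: leq_ltn_trans N0.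
have s0 : 0 < rsqrtn N :> R by exact: rsqrtn_gt0.
have dle : `|delta N| <= c / (2 * L) * `|(Num.sqrt (N%:R : R))^-1|.
  by near: N; exact: small.
exists [set w | L < `|frob_norm (A N w) / delta N|]; split.
- rewrite -[X in measurable X]setTI.
  have mf : measurable_fun setT (fun w => `|frob_norm (A N w) / delta N|).
    apply: measurableT_comp => //.
    by apply: measurable_funM; [exact: measurable_frob_norm|exact: measurable_cst].
  rewrite (_ : [set w | _] = (fun w => `|frob_norm (A N w) / delta N|) @^-1` `]L, +oo[%classic).
    exact: mf.
  by apply/seteqP; split => w /=; rewrite in_itv/= andbT.
- exact: ltW (PL N).
move=> w /negP; rewrite -leNgt ger0_norm; last first.
  by rewrite divr_ge0// ?sqrtr_ge0// ltW.
rewrite ler_pdivrMr// => fL.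
have -> : `|(rsqrtn N)^-1 *: A N w| = `|A N w| / rsqrtn N.
  have si0 : 0 < (rsqrtn N)^-1 :> R by rewrite /rsqrtn invrK sqrtr_gt0 ltr0n.
  by rewrite normrZ gtr0_norm// mulrC.
rewrite ltr_pdivrMr//.
apply: le_lt_trans (mx_norm_le_frob _) _.
apply: le_lt_trans fL _.
rewrite gtr0_norm// in dle.
rewrite -/(rsqrtn N) gtr0_norm// in dle.
have : L * delta N <= L * (c / (2 * L) * rsqrtn N) by rewrite ler_pM2l.
move=> /le_lt_trans; apply.
have -> : L * (c / (2 * L) * rsqrtn N) = c * rsqrtn N / 2 by field; rewrite gt_eqF.
by rewrite ltr_pdivrMr// ltr_pMr ?ltr1n// mulr_gt0.
Unshelve. all: by end_near. Qed.

End bad_events.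

Theorem theorem4 (R : realType) (d : measure_display) (T : measurableType d)
  (Pr : probability T R) (n p : nat)
  (theta0 : 'cV[R]_n) (sigma : R)
  (Phi : forall N : nat, T -> 'M[R]_(N, n)) (V : forall N : nat, T -> 'cV[R]_N)
  (Om : set 'cV[R]_p) (P : 'cV[R]_p -> 'M[R]_n) (Sigma : 'M[R]_n)
  (delta : nat -> R)
  (eta_EB eta_Sy eta_EEB eta_MSEy : nat -> T -> 'cV[R]_p)
  (eta_y : 'cV[R]_p)
  (hsigma : 0 < sigma)
  (hPhi : forall N, random_matrix (Phi N))
  (hPhi_rank : forall N, (n < N)%N -> {ae Pr, forall w, \rank (Phi N w) = n})
  (hV : forall N, random_matrix (V N))
  (hV_normal : forall N (i : 'I_N) (B : set R), measurable B ->
     Pr [set w | B (V N w i 0)] = normal_law 0 (sigma ^+ 2) B)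
  (hV_indep : forall N, mutually_independent Pr (Phi N) (V N))
  (hP_C2 : C2_on Om P)
  (* (A1) *)
  (hEB : forall N, (n < N)%N -> {ae Pr, forall w, Om° (eta_EB N w) /\
     argmin_on Om (fun eta => cost_EB sigma (Phi N w)
         (Phi N w *m theta0 + V N w) (P eta))
       (eta_EB N w)})
  (hSy : forall N, (n < N)%N -> {ae Pr, forall w, Om° (eta_Sy N w) /\
     argmin_on Om (fun eta => cost_Sy sigma (Phi N w)
         (Phi N w *m theta0 + V N w) (P eta))
       (eta_Sy N w)})
  (hEEB : forall N, (n < N)%N -> {ae Pr, forall w, Om° (eta_EEB N w) /\
     argmin_on Om (fun eta => cost_EEB sigma (Phi N w) theta0 (P eta))
       (eta_EEB N w)})
  (hMSEy : forall N, (n < N)%N -> {ae Pr, forall w, Om° (eta_MSEy N w) /\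
     argmin_on Om (fun eta => cost_MSEy sigma (Phi N w) theta0 (P eta))
       (eta_MSEy N w)})
  (hSy_meas : forall N, random_matrix (eta_Sy N))
  (* (A2) *)
  (hP : forall eta, Om eta -> posdef (P eta))
  (hSigma : posdef Sigma)
  (hPhi_lim : {ae Pr, forall w,
     (N%:R^-1 *: ((Phi N w)^T *m Phi N w)) @[N --> \oo] --> Sigma})
  (* (A3) *)
  (hb_isolated : argmin_on Om (W_b theta0 P) `<=`
     isolated (argmin_on Om (W_b theta0 P)))
  (hy_isolated : argmin_on Om (W_y theta0 sigma Sigma P) `<=`
     isolated (argmin_on Om (W_y theta0 sigma Sigma P)))
  (heta_y : argmin_on Om (W_y theta0 sigma Sigma P) eta_y)
  (* Identifies the minimizer meant by eta_y and replaces compactness of Om: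
     the estimates end up in a compact part of Om in which eta_y is the only
     minimizer of W_y (consistency is not assumed). *)
  (hSy_loc : exists K : set 'cV[R]_p,
     [/\ compact K, K `<=` Om,
         K `&` argmin_on Om (W_y theta0 sigma Sigma P) `<=` [set eta_y] &
         Pr [set w | K (eta_Sy N w)] @[N --> \oo] --> 1%E])
  (* (A4) *)
  (hdelta_gt0 : forall N, (n < N)%N -> 0 < delta N)
  (hdelta0 : delta @ \oo --> (0 : R))
  (hPhi_rate : bigO_p Pr
     (fun N w => frob_norm (N%:R^-1 *: ((Phi N w)^T *m Phi N w) - Sigma)) delta)
  (* (A5) *)
  (hOm : open Om)
  (hdelta : delta =o_\oo (fun N => (Num.sqrt (N%:R : R))^-1))
  (hC : C_y theta0 sigma Sigma P eta_y \in unitmx) :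
  exists2 mu : probability (borel p 1) R,
    multivariate_normal 0
      (invmx (C_y theta0 sigma Sigma P eta_y)
       *m D_y theta0 sigma Sigma P eta_y
       *m invmx (C_y theta0 sigma Sigma P eta_y)) mu &
    cvg_in_distribution Pr
      (fun N w => Num.sqrt (N%:R : R) *: (eta_Sy N w - eta_y)) mu.
Proof.
have [Omy _] := heta_y.
have [K [cK KOm K_min K1]] := hSy_loc.
set J := limit_mx theta0 sigma Sigma P eta_y.
exists (law (gauss sigma (N := n)) (random_matrix_mulmx J)).
  exact: (multivariate_normal_limit_mx hsigma hSigma hOm hP_C2 hP Omy).
pose xi N w := whitening (Phi N w) *m V N w.
have mxi N : random_matrix (xi N).
  by apply: random_matrixM => //; exact: random_matrix_whitening.
have V_gam N (i : 'I_N) (B : set R) : measurable B ->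
    Pr [set w | B (V N w i 0)] = normal_prob 0 sigma B.
  move=> mB; rewrite hV_normal// /normal_law sqrf_eq0 gt_eqF// sqrtr_sqr.
  by rewrite gtr0_norm.
have nN : \forall N \near \oo, (n < N)%N by exact: nbhs_infty_gt.
apply: (@cvg_in_distribution_coupling _ _ _ Pr p n _ xi) => //.
- move=> N; apply: random_matrixZ; first exact: measurable_cst.
  by apply: random_matrixB => //; exact: random_matrix_cst.
- apply: filterS nN => N nN A mA.
  apply: (law_random_isometry hsigma (hPhi N) (hV N) (@V_gam N) (hV_indep N)) => //.
    exact: (random_matrix_whitening (@random_matrix_id _ N n)).
  apply: filterS (hPhi_rank N nN) => w rk.
  exact: whitening_isometry (leq_ltn_trans (leq0n n) nN) rk.
move=> L eps e eps0 e0.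
have e2 : 0 < e / 2 by exact: divr_gt0.
(* The closeness [c] depends only on [L] and [eps], so it is fixed before [N] is taken large. *)
have [c c0 expand] := uniform_expansion hSigma hOm hP_C2 hP heta_y hC cK KOm K_min L eps0.
have mK N : measurable [set w | K (eta_Sy N w)] by exact: measurable_random_matrix_compact.
have mA N : random_matrix (fun w => N%:R^-1 *: ((Phi N w)^T *m Phi N w) - Sigma).
  apply: random_matrixB; last exact: random_matrix_cst.
  exact: random_matrix_gram.
near=> N.
have N_n : (n < N)%N by near: N.
have N0 : (0 < N)%N by exact: leq_ltn_trans N_n.
have [B1 [mB1 PB1 B1S]] : exists B, [/\ measurable B, (Pr B <= (e / 2)%:E)%E &
    forall w, ~ B w -> `|(rsqrtn N)^-1 *: (N%:R^-1 *: ((Phi N w)^T *m Phi N w) - Sigma)| < c].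
  by near: N; exact: near_rate_scaled mA hdelta_gt0 hPhi_rate hdelta c0 e2.
have PB2 : (Pr (~` [set w | K (eta_Sy N w)]) <= (e / 2)%:E)%E.
  by near: N; exact: near_probability_compl.
have [B3 [mB3 PB3 B3S]] := filterI (hPhi_rank N N_n) (hSy N N_n).
have sc : rsqrtn N < c.
  near: N; have /cvgr0Pnorm_lt /(_ c c0) := @cvg_rsqrtn R.
  by apply: filterS => N; apply: le_lt_trans; exact: ler_norm.
(* Large design errors and estimates outside [K] cost [e / 2] each; [B3] is a null set off which the
   rank condition and minimality hold. *)
exists (B1 `|` ~` [set w | K (eta_Sy N w)] `|` B3); split.
- by apply: measurableU => //; apply: measurableU => //; exact: measurableC.
- apply: le_trans (measureU2 _ _ mB3) _; first by apply: measurableU => //; exact: measurableC.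
  rewrite [X in (_ + X)%E](_ : _ = 0%E)// adde0.
  apply: le_trans (measureU2 _ mB1 (measurableC (mK N))) _.
  have -> : e%:E = ((e / 2)%:E + (e / 2)%:E)%E by rewrite -EFinD -splitr.
  by rewrite leeD.
move=> w nB xiL.
have nB1 : ~ B1 w by move=> H; apply: nB; left; left.
have Kw : K (eta_Sy N w) by apply: contrapT => H; apply: nB; left; right.
have [rk [_ eta_min]] : \rank (Phi N w) = n /\ Om° (eta_Sy N w) /\
    argmin_on Om (fun eta => cost_Sy sigma (Phi N w)
      (Phi N w *m theta0 + V N w) (P eta)) (eta_Sy N w).
  by apply: contrapT => H; apply: nB; right; apply: B3S.
have rsE : Num.sqrt (N%:R : R) = (rsqrtn N)^-1 by rewrite /rsqrtn invrK.
rewrite rsE.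
apply: (expand _ (N%:R^-1 *: ((Phi N w)^T *m Phi N w))) => //.
- by rewrite rsqrtn_gt0.
- exact: B1S.
- by move=> y Omy'; exact: (Gcost_argmin hsigma hP N0 rk eta_min Omy').
- by move=> k; exact: (Ggrad_argmin hsigma hOm hP_C2 hP N0 rk eta_min k).
Unshelve. all: by end_near. Qed.
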